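(* Assume Baumgartner's Axiom $\mathsf{BA}$. If $K$ and $L$ are separable compact lines of weight $\omega_1$, then the Banach spaces $C(K)$ and $C(L)$ are isomorphic.
   Context: A subset $A$ of a topological space $X$ is $\omega_1$-dense in $X$ if $|U\cap A|=\omega_1$ for every nonempty open $U\subseteq X$. Baumgartner's Axiom $\mathsf{BA}$ (also denoted $\mathsf{BA}(\omega_1)$) is the statement: every two sets of reals that are $\omega_1$-dense in $\mathbb{R}$ are order isomorphic. A separable compact line is a linearly ordered set whose order topology is compact and separable. For a compact space $K$, $C(K)$ is the Banach space of continuous real-valued functions on $K$ with the supremum norm. Banach spaces are isomorphic if there is a bounded linear bijection between them with bounded inverse. The weight of a space is the least cardinality of a base of its topology. *)

(* Defs.v *)
From HB Require Import structures.
From mathcomp Require Import all_boot all_order all_algebra.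
From mathcomp Require Import all_classical all_reals all_analysis.
From mathcomp Require Import ring.

Set Implicit Arguments.
Unset Strict Implicit.
Unset Printing Implicit Defensive.

Import Order.TTheory GRing.Theory Num.Theory.
Import numFieldNormedType.Exports.

Local Open Scope card_scope.
Local Open Scope classical_set_scope.
Local Open Scope ring_scope.

(* [|A| = omega_1], where omega_1 is the least uncountable cardinal. *)
Definition card_omega1 (T : Type) (A : set T) : Prop :=
  ~ countable A /\
  forall (U : Type) (B : set U), ~ countable B -> A #<= B.

Definition omega1_dense (X : topologicalType) (A : set X) : Prop :=
  forall U : set X, open U -> U !=set0 -> card_omega1 (U `&` A).

Definition order_isomorphic (R : realType) (A B : set R) : Prop :=
  exists2 f : R -> R, set_bij A B f &
    forall x y, A x -> A y -> (f x <= f y) = (x <= y).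

Definition baumgartner_axiom (R : realType) : Prop :=
  forall A B : set R, omega1_dense A -> omega1_dense B ->
    order_isomorphic A B.

Definition separable (X : topologicalType) : Prop :=
  exists2 D : set X, countable D & dense D.

(* The weight of [X] is [|B|] for a base [B] of least cardinality. *)
Definition weight_omega1 (X : topologicalType) : Prop :=
  exists B : set (set X),
    [/\ basis B, (forall B' : set (set X), basis B' -> B #<= B') & card_omega1 B].

(* The compactness proof is an index of the type because it is what makes the
   supremum defining the norm finite; [continuousType K R] itself already
   carries another (compact-open) topology. *)
Definition continuous_space (R : realType) (K : topologicalType)
  (cK : compact [set: K]) : Type := continuousType K R.

Section continuous_space.
Context (R : realType) (K : topologicalType) (cK : compact [set: K]).
Local Notation CK := (continuous_space R cK).

Definition ctsfun : {pred K -> R} := fun f => `[< continuous f >].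

Lemma ctsfun_rect (P : CK -> Type) :
  (forall f (cf : f \in ctsfun), P (mkcts (asboolW cf))) -> forall u, P u.
Proof.
move=> PS [f [[cf]]].
have cf' : f \in ctsfun by apply/asboolP.
have -> : cf = asboolW cf' by exact: Prop_irrelevance.
exact: PS.
Qed.

Lemma ctsfun_valP (f : K -> R) (cf : f \in ctsfun) :
  (mkcts (asboolW cf) : CK) = f :> (K -> R).
Proof. by []. Qed.

HB.instance Definition _ := @isSub.Build (K -> R) ctsfun CK
  (fun f => f : continuousType K R) _ ctsfun_rect ctsfun_valP.
HB.instance Definition _ := [Choice of CK by <:].

Lemma ctsfun_submod_closed : submod_closed ctsfun.
Proof.
split; first by apply/asboolP => x; exact: cvg_cst.
move=> a f g /asboolP cf /asboolP cg; apply/asboolP => x.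
by apply: cvgD; [apply: cvgZr; exact: cf|exact: cg].
Qed.
HB.instance Definition _ :=
  GRing.isSubmodClosed.Build R (K -> R) ctsfun ctsfun_submod_closed.
HB.instance Definition _ := [SubChoice_isSubLmodule of CK by <:].

Definition sup_norm (f : CK) : R := sup (range (fun x => `|f x|)).

Lemma sup_norm_has_ubound (f : CK) : has_ubound (range (fun x => `|f x|)).
Proof.
have cabs : {within [set: K], continuous (fun x => `|f x|)}.
  apply: continuous_subspaceT => x.
  by apply: continuous_comp; [exact: cts_fun|exact: norm_continuous].
have [M [_ HM]] := compact_bounded (continuous_compact cabs cK).
exists (M + 1) => y Hy; apply: le_trans (ler_norm _) _.
by apply: (HM (M + 1)) => //; rewrite ltrDl.
Qed.

Lemma sup_norm_ub (f : CK) x : `|f x| <= sup_norm f.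
Proof. by apply: (ub_le_sup (sup_norm_has_ubound f)); exists x. Qed.

Lemma sup_norm_ge0 (f : CK) : 0 <= sup_norm f.
Proof.
have [/set0P[x _]|/negPn/eqP K0] := boolP ([set: K] != set0).
  exact: le_trans (sup_norm_ub f x).
by rewrite /sup_norm K0 image_set0 sup0.
Qed.

Lemma sup_norm_le (f : CK) e :
  0 <= e -> (forall x, `|f x| <= e) -> sup_norm f <= e.
Proof.
move=> e0 fe; have [/set0P[x _]|/negPn/eqP K0] := boolP ([set: K] != set0).
  by apply: ge_sup => [|_ [y _ <-]//]; exists `|f x|, x.
by rewrite /sup_norm K0 image_set0 sup0.
Qed.

Lemma sup_normD (f g : CK) : sup_norm (f + g) <= sup_norm f + sup_norm g.
Proof.
apply: sup_norm_le => [|x]; first by rewrite addr_ge0// sup_norm_ge0.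
by apply: le_trans (ler_normD (f x) (g x)) _; rewrite lerD// sup_norm_ub.
Qed.

Lemma sup_normZ (a : R) (f : CK) : sup_norm (a *: f) = `|a| * sup_norm f.
Proof.
have le b (g : CK) : sup_norm (b *: g) <= `|b| * sup_norm g.
  apply: sup_norm_le => [|x]; first by rewrite mulr_ge0// sup_norm_ge0.
  by rewrite [leLHS](normrM b (g x)) ler_wpM2l// sup_norm_ub.
apply/eqP; rewrite eq_le le/=.
have [->|a0] := eqVneq a 0; first by rewrite normr0 mul0r sup_norm_ge0.
rewrite -ler_pdivlMl ?normr_gt0// -normfV.
by rewrite -{1}[f](scalerK a0) le.
Qed.

Lemma sup_norm0_eq0 (f : CK) : sup_norm f = 0 -> f = 0.
Proof.
move=> f0; apply/val_inj/funext => x; apply/eqP.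
by rewrite -normr_le0 -[leRHS]f0 sup_norm_ub.
Qed.

HB.instance Definition _ :=
  Lmodule_isNormed.Build R CK sup_normD sup_normZ sup_norm0_eq0.

Lemma continuous_space_complete (F : set_system CK) :
  ProperFilter F -> cauchy F -> cvg F.
Proof.
move=> FF Fc.
have Fex e : 0 < e -> exists f : CK, F (ball f e).
  by move=> e0; exact: (cauchyP F).1 Fc e e0.
have evalB e (f g : CK) x : ball f e g -> `|f x - g x| < e.
  by rewrite -ball_normE; exact: le_lt_trans (sup_norm_ub (f - g) x).
have cvx x : cvg ((fun f : CK => f x) @ F).
  apply: cauchy_cvg; apply: cauchy_exP => e e0.
  have [f Ff] := Fex e e0; exists (f x).
  by apply: (@filterS _ F _ (ball f e)) Ff => g fg; rewrite /= -ball_normE /=; exact: evalB.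
pose l x := lim ((fun f : CK => f x) @ F).
have lP e (f : CK) x : F (ball f e) -> `|f x - l x| <= e.
  move=> Ff.
  have cv : (fun g : CK => `|f x - g x|) @ F --> `|f x - l x|.
    by apply: cvg_norm; apply: cvgB; [exact: cvg_cst|exact: cvx].
  apply: (@closed_cvg _ _ F FF _ (fun y : R => y <= e) (@closed_le R e) _ _ cv).
  by apply: (@filterS _ F _ (ball f e)) Ff => g fg; exact/ltW/evalB.
have cl : continuous l.
  move=> x; apply/cvgrPdist_lt => e e0.
  have e3 : 0 < e / 3 by rewrite divr_gt0.
  have [f Ff] := Fex _ e3.
  have := @cts_fun _ _ f x => /cvgrPdist_lt /(_ _ e3).
  apply: filterS => y fxy.
  have := lP _ _ x Ff; have := lP _ _ y Ff; rewrite distrC => ly lx.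
  have -> : l x - l y = - (f x - l x) + (f x - f y) - (l y - f y) by ring.
  rewrite [e](_ : _ = e / 3 + e / 3 + e / 3); last by field.
  apply: le_lt_trans (ler_normB _ _) _; rewrite ltr_leD//.
  by apply: le_lt_trans (ler_normD _ _) _; rewrite normrN ler_ltD.
pose c : CK := mkcts cl.
apply/cvg_ex; exists c; apply/cvg_ballP => e e0.
have e4 : 0 < e / 4 by rewrite divr_gt0.
have [f Ff] := Fex _ e4.
apply: (@filterS _ F _ (ball f (e / 4))) (Ff) => g fg; rewrite -ball_normE/=.
apply: (@le_lt_trans _ _ (e / 2)); last by rewrite gtr_pMr// invf_lt1// ltr1n.
apply: sup_norm_le => [|x]; first by rewrite divr_ge0// ltW.
have -> : (c - g) x = - (f x - l x) + (f x - g x).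
  by rewrite opprB addrA subrK.
rewrite [e / 2](_ : _ = e / 4 + e / 4); last by field.
by apply: le_trans (ler_normD _ _) _; rewrite normrN lerD ?lP// ltW// evalB.
Qed.

HB.instance Definition _ := Uniform_isComplete.Build CK continuous_space_complete.

End continuous_space.

Definition banach_isomorphic (R : realType) (V W : completeNormedModType R)
    : Prop :=
  exists (f : {linear V -> W}) (g : {linear W -> V}),
    [/\ cancel f g, cancel g f, bounded_fun_norm f & bounded_fun_norm g].

(* Main.v *)
From HB Require Import structures.
Require Import Defs.
From mathcomp Require Import all_boot all_order all_algebra.
From mathcomp Require Import all_classical all_reals all_analysis.
From mathcomp Require Import ring lra.

Set Implicit Arguments.
Unset Strict Implicit.
Unset Printing Implicit Defensive.

Import Order.TTheory GRing.Theory Num.Theory.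
Import numFieldNormedType.Exports.

Local Open Scope card_scope.
Local Open Scope classical_set_scope.
Local Open Scope ring_scope.

(** The operators are built between spaces [dspace N A] of functions on a closed
    set [N] of reals in which the points of [A] are split into a left and a right
    half; the functions vanish at infinity and carry the supremum norm.  A
    separable compact line [K] has a continuous increasing coordinate that
    identifies only endpoints of jumps, and it turns [C(K)] into such a space
    [dspace F A], where [A] consists of the coordinates of the identified jumps
    ([exists_coordinate], [coord_isom]).  Weight omega_1 means that [A] has
    exactly omega_1 points.

    By Baumgartner's axiom all omega_1-dense sets [B] are order isomorphic, so the
    spaces [dspace setT B] are complemented in each other
    ([complemented_order_isomorphic]).  They link any two lines as follows.

    On the one hand some [dspace setT B] is complemented in [C(K)]: mapping the
    two-sided condensation points of [A] monotonically onto the line makes the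
    line a quotient of [F], and the split points that result are omega_1-dense
    ([complemented_dense], [complemented_pullback]).

    On the other hand [c0(C(L))] is complemented in some [dspace setT B].  For
    this the coordinate of [L] is chosen so that [A] is nowhere dense.  Then
    [C(L)] is complemented in the sum of [dspace (closure A) A] and of [C[0,1]], by
    linear interpolation in the gaps of the closure ([complemented_unsplit]), and
    [C[0,1]] is complemented in the continuous functions on the Cantor set by
    Milutin's averaging operator ([complemented_unit_itv]).  Both pieces live on
    closed nowhere dense sets, and so does a sequence of translated copies of
    them ([complemented_translates]).  Points added in the gaps make the set of
    split points omega_1-dense ([omega1_dense_fill]), and interpolation extends
    functions to the whole line ([complemented_closed]).

    Hence [c0(C(L))] is complemented in [C(K)] for any two lines, equal or not
    ([c0_cspace_complemented]), and the decomposition method of Pelczynski gives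
    the isomorphism ([pelczynski]). *)

(** * Function spaces and complemented subspaces *)

Section function_spaces.
Context {R : realType}.

Definition lincomb (T : Type) (a : R) (f g : T -> R) : T -> R :=
  fun x => a * f x + g x.

(** The norm is always the supremum norm; it never appears as a number, since
    an operator of norm at most [C] is one that maps functions bounded by [M]
    to functions bounded by [C * M]. *)
Record fspace := FSpace {
  dom : Type;
  fmem : set (dom -> R);
  mem0 : fmem (fun _ => 0);
  mem_lin : forall a f g, fmem f -> fmem g -> fmem (lincomb a f g) }.

Definition oper (V W : fspace) (F : (dom V -> R) -> (dom W -> R)) : Prop :=
  [/\ forall f, fmem f -> fmem (F f),
      forall a f g, fmem f -> fmem g -> F (lincomb a f g) = lincomb a (F f) (F g)
    & exists2 C, 0 <= C & forall f M, fmem f -> 0 <= M ->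
        (forall x, `|f x| <= M) -> forall y, `|F f y| <= C * M].

(** [V] is isomorphic to a complemented subspace of [W]. *)
Definition complemented (V W : fspace) : Prop :=
  exists F G, [/\ oper (V := V) (W := W) F, oper (V := W) (W := V) G &
    forall f, fmem f -> G (F f) = f].

Definition isom (V W : fspace) : Prop :=
  exists F G, [/\ oper (V := V) (W := W) F, oper (V := W) (W := V) G,
    forall f, fmem f -> G (F f) = f & forall g, fmem g -> F (G g) = g].

Lemma oper_comp (V W X : fspace) F G :
  oper (V := V) (W := W) F -> oper (V := W) (W := X) G ->
  oper (V := V) (W := X) (G \o F).
Proof.
move=> [F1 F2 [C C0 F3]] [G1 G2 [D D0 G3]]; split => /=.
- by move=> f Vf; exact/G1/F1.
- by move=> a f g Vf Vg; rewrite F2// G2//; exact: F1.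
- exists (D * C); first exact: mulr_ge0.
  move=> f M Vf M0 fM y; rewrite -mulrA; apply: G3; [exact: F1|exact: mulr_ge0|].
  exact: F3.
Qed.

Lemma oper_id (V : fspace) : oper (V := V) (W := V) id.
Proof. by split => //; exists 1 => // f M _ _ fM y; rewrite mul1r. Qed.

Lemma complemented_refl V : complemented V V.
Proof. by exists id, id; split => //; exact: oper_id. Qed.

Lemma complemented_trans W V X :
  complemented V W -> complemented W X -> complemented V X.
Proof.
move=> [F [G [oF oG FG]]] [F' [G' [oF' oG' FG']]].
exists (F' \o F), (G \o G'); split; [exact: oper_comp|exact: oper_comp|].
by move=> f Vf /=; rewrite FG' ?FG//; case: oF => + _ _; exact.
Qed.

Lemma isom_sym V W : isom V W -> isom W V.
Proof. by move=> [F [G []]]; exists G, F. Qed.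

Lemma isom_trans W V X : isom V W -> isom W X -> isom V X.
Proof.
move=> [F [G [oF oG FG GF]]] [F' [G' [oF' oG' FG' GF']]].
exists (F' \o F), (G \o G'); split; [exact: oper_comp|exact: oper_comp| |].
  by move=> f Vf /=; rewrite FG' ?FG//; case: oF => + _ _; exact.
by move=> f Vf /=; rewrite GF ?GF'//; case: oG' => + _ _; exact.
Qed.

Lemma isom_complemented V W : isom V W -> complemented V W.
Proof. by move=> [F [G [oF oG FG _]]]; exists F, G. Qed.

Lemma isom_reindex (V W : fspace) (e : dom W -> dom V) (e' : dom V -> dom W) :
  cancel e e' -> cancel e' e -> (forall f, fmem f <-> fmem (f \o e)) -> isom V W.
Proof.
move=> ee' e'e Ve; exists (fun f => f \o e), (fun g => g \o e'); split.
- split => [f Vf|//|]; first exact/Ve.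
  by exists 1 => // f M _ _ fM y; rewrite mul1r; exact: fM.
- split => [g Wg|//|].
    by apply/Ve; rewrite (_ : _ \o _ = g)//; apply/funext => x /=; rewrite ee'.
  by exists 1 => // f M _ _ fM y; rewrite mul1r; exact: fM.
- by move=> f _; apply/funext => x /=; rewrite e'e.
- by move=> f _; apply/funext => x /=; rewrite ee'.
Qed.

Lemma incl_oper (T : Type) (P Q : set (T -> R)) P0 Pl Q0 Ql :
  (P `<=` Q) ->
  oper (V := @FSpace T P P0 Pl) (W := @FSpace T Q Q0 Ql) id.
Proof. by move=> PQ; split => //; exists 1 => // f M _ _ fM y; rewrite mul1r. Qed.

(** ** Direct sums *)

Definition inlf {S T : Type} (f : S + T -> R) : S -> R := fun x => f (inl x).
Definition inrf {S T : Type} (f : S + T -> R) : T -> R := fun x => f (inr x).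
Definition sumf {S T : Type} (f : S -> R) (g : T -> R) : S + T -> R :=
  fun z => match z with inl x => f x | inr y => g y end.

Definition sum_mem (V W : fspace) : set (dom V + dom W -> R) :=
  [set f | fmem (inlf f) /\ fmem (inrf f)].

Lemma sum_mem0 V W : @sum_mem V W (fun _ => 0).
Proof. by split; exact: mem0. Qed.

Lemma sum_mem_lin V W a f g :
  @sum_mem V W f -> @sum_mem V W g -> @sum_mem V W (lincomb a f g).
Proof. by move=> [f1 f2] [g1 g2]; split; exact: mem_lin. Qed.

Definition fsum V W : fspace := FSpace (@sum_mem0 V W) (@sum_mem_lin V W).

Lemma sumf_eta S T (f : S + T -> R) : sumf (inlf f) (inrf f) = f.
Proof. by apply/funext; case. Qed.

Lemma oper_inl V W : oper (V := fsum V W) (W := V) inlf.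
Proof.
by split => [f []//|//|]; exists 1 => // f M _ _ fM y; rewrite mul1r; exact: fM.
Qed.

Lemma oper_inr V W : oper (V := fsum V W) (W := W) inrf.
Proof.
by split => [f []//|//|]; exists 1 => // f M _ _ fM y; rewrite mul1r; exact: fM.
Qed.

Lemma oper_pair V W X F G :
  oper (V := X) (W := V) F -> oper (V := X) (W := W) G ->
  oper (V := X) (W := fsum V W) (fun f => sumf (F f) (G f)).
Proof.
move=> [F1 F2 [C C0 F3]] [G1 G2 [D D0 G3]]; split.
- by move=> f Xf; split; [exact: F1|exact: G1].
- by move=> a f g Xf Xg; rewrite F2// G2//; apply/funext; case.
- exists (C + D); first exact: addr_ge0.
  move=> f M Xf M0 fM [y|y] /=.
    by apply: le_trans (F3 _ _ Xf M0 fM y) _; rewrite ler_wpM2r// lerDl.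
  by apply: le_trans (G3 _ _ Xf M0 fM y) _; rewrite ler_wpM2r// lerDr.
Qed.

Lemma oper_lin V W a F G :
  oper (V := V) (W := W) F -> oper (V := V) (W := W) G ->
  oper (V := V) (W := W) (fun f => lincomb a (F f) (G f)).
Proof.
move=> [F1 F2 [C C0 F3]] [G1 G2 [D D0 G3]]; split.
- by move=> f Vf; apply: mem_lin; [exact: F1|exact: G1].
- move=> b f g Vf Vg; rewrite F2// G2//; apply/funext => x; rewrite /lincomb; ring.
- exists (`|a| * C + D); first by rewrite addr_ge0// mulr_ge0.
  move=> f M Vf M0 fM y; apply: le_trans (ler_normD _ _) _.
  rewrite mulrDl lerD//; last exact: G3.
  by rewrite normrM -mulrA ler_wpM2l//; exact: F3.
Qed.

Lemma isom_fsum V V' W W' : isom V V' -> isom W W' -> isom (fsum V W) (fsum V' W').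
Proof.
move=> [F [G [oF oG FG GF]]] [F' [G' [oF' oG' FG' GF']]].
exists (fun f => sumf (F (inlf f)) (F' (inrf f))).
exists (fun f => sumf (G (inlf f)) (G' (inrf f))); split.
- apply: (@oper_pair V' W' (fsum V W) (F \o inlf) (F' \o inrf)); apply: oper_comp; [exact: oper_inl|exact: oF|
    exact: oper_inr|exact: oF'].
- apply: (@oper_pair V W (fsum V' W') (G \o inlf) (G' \o inrf)); apply: oper_comp; [exact: oper_inl|exact: oG|
    exact: oper_inr|exact: oG'].
- by move=> f [f1 f2]; rewrite /inlf/inrf/= FG// FG'// -[RHS]sumf_eta.
- by move=> f [f1 f2]; rewrite /inlf/inrf/= GF// GF'// -[RHS]sumf_eta.
Qed.

Lemma isom_refl V : isom V V.
Proof. by exists id, id; split => //; exact: oper_id. Qed.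

Lemma complemented_fsum V V' W W' : complemented V V' -> complemented W W' ->
  complemented (fsum V W) (fsum V' W').
Proof.
move=> [F [G [oF oG FG]]] [F' [G' [oF' oG' FG']]].
exists (fun f => sumf (F (inlf f)) (F' (inrf f))).
exists (fun f => sumf (G (inlf f)) (G' (inrf f))); split.
- apply: (@oper_pair V' W' (fsum V W) (F \o inlf) (F' \o inrf)); apply: oper_comp; [exact: oper_inl|exact: oF|
    exact: oper_inr|exact: oF'].
- apply: (@oper_pair V W (fsum V' W') (G \o inlf) (G' \o inrf)); apply: oper_comp; [exact: oper_inl|exact: oG|
    exact: oper_inr|exact: oG'].
- by move=> f [f1 f2]; rewrite /inlf/inrf/= FG// FG'// -[RHS]sumf_eta.
Qed.

Lemma fsumC V W : isom (fsum V W) (fsum W V).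
Proof.
pose sw (A B : Type) (z : A + B) : B + A :=
  match z with inl x => inr x | inr y => inl y end.
apply: (@isom_reindex (fsum V W) (fsum W V) (@sw _ _) (@sw _ _)).
- by case.
- by case.
- by move=> f; split => -[].
Qed.

Lemma fsumA U V W : isom (fsum U (fsum V W)) (fsum (fsum U V) W).
Proof.
pose s (A B C : Type) (z : A + B + C) : A + (B + C) :=
  match z with inl (inl x) => inl x | inl (inr x) => inr (inl x)
             | inr y => inr (inr y) end.
pose t (A B C : Type) (z : A + (B + C)) : A + B + C :=
  match z with inl x => inl (inl x) | inr (inl x) => inl (inr x)
             | inr (inr y) => inr y end.
apply: (@isom_reindex (fsum U (fsum V W)) (fsum (fsum U V) W) (@s _ _ _) (@t _ _ _)).
- by case=> [[]|].
- by case=> [|[]].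
- by move=> f; split => [[? []]|[[]]]; split.
Qed.

(** The idempotent [F \o G] on [W] splits it as the sum of its range, a copy of
    [V], and the kernel of [G]. *)
Lemma complemented_split V W : complemented V W -> exists Z, isom W (fsum V Z).
Proof.
move=> [F [G [oF oG FG]]]; have [F1 F2 F3] := oF; have [G1 G2 _] := oG.
have Gz : G (fun _ => 0) = fun _ => 0.
  have := G2 (-1) _ _ (mem0 W) (mem0 W).
  rewrite (_ : lincomb _ _ _ = fun _ => 0); last by apply/funext => x; rewrite /lincomb; ring.
  move=> ->; apply/funext => x; rewrite /lincomb; ring.
pose Zm := [set f | fmem (f : dom W -> R) /\ G f = fun _ => 0].
have Z0 : Zm (fun _ => 0) by split => //; exact: mem0.
have Zl a f g : Zm f -> Zm g -> Zm (lincomb a f g).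
  move=> [f1 f2] [g1 g2]; split; first exact: mem_lin.
  by rewrite G2// f2 g2; apply/funext => x; rewrite /lincomb; ring.
exists (FSpace Z0 Zl).
have Zproj f : fmem f -> Zm (lincomb (-1) (F (G f)) f).
  move=> Wf; have WFG : fmem (F (G f)) by exact/F1/G1.
  split; first exact: mem_lin.
  rewrite G2// (FG (G f)); last exact: G1.
  by apply/funext => x; rewrite /lincomb; ring.
exists (fun f => sumf (G f) (lincomb (-1) (F (G f)) f)).
exists (fun h => lincomb 1 (F (inlf h)) (inrf h)); split.
- apply: (@oper_pair V (FSpace Z0 Zl) W G (fun f => lincomb (-1) (F (G f)) f)) => //.
  have [H1 H2 H3] := @oper_lin _ _ (-1) _ _ (oper_comp oG oF) (oper_id W).
  by split.
- apply: oper_lin.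
    by apply: (@oper_comp (fsum V (FSpace Z0 Zl)) V W inlf F) => //; exact: oper_inl.
  split; [by move=> f [_ []]|by []|].
  by exists 1 => // f M _ _ fM y; rewrite mul1r; exact: fM.
- move=> f Wf; apply/funext => x; rewrite /lincomb/inlf/inrf/=.
  by rewrite -[fun x => G f x]/(G f); ring.
- move=> h [h1 [h2 h3]]; have Wi : fmem (F (inlf h)) by exact: F1.
  have E : G (lincomb 1 (F (inlf h)) (inrf h)) = inlf h.
    by rewrite G2// FG// h3; apply/funext => x; rewrite /lincomb; ring.
  by rewrite E -[RHS]sumf_eta; congr sumf; apply/funext => x; rewrite /lincomb; ring.
Qed.

(** ** Sums of sequences vanishing at infinity *)

(** The n-th term of the sequence encoded by [f] is [fun x => f (n, x)]. *)
Definition c0_mem (V : fspace) : set (nat * dom V -> R) :=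
  [set f | (forall n, fmem (fun x => f (n, x))) /\
    forall e, 0 < e -> exists n0, forall n x, (n0 <= n)%N -> `|f (n, x)| <= e].

Lemma c0_mem0 V : @c0_mem V (fun _ => 0).
Proof.
split=> [n|e e0]; first exact: mem0.
by exists 0%N => n x _; rewrite normr0 ltW.
Qed.

Lemma c0_mem_lin V a f g : @c0_mem V f -> @c0_mem V g -> @c0_mem V (lincomb a f g).
Proof.
move=> [f1 f2] [g1 g2]; split => [n|e e0].
  exact: (@mem_lin V a (fun x => f (n, x)) (fun x => g (n, x))).
have ea : 0 < e / (`|a| + 1) by rewrite divr_gt0// ltr_wpDl.
have ha : 0 < `|a| + 1 by rewrite ltr_wpDl.
have e2 : 0 < e / (`|a| + 1) / 2 by rewrite divr_gt0.
have [n1 h1] := f2 _ e2; have [n2 h2] := g2 _ e2.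
exists (maxn n1 n2) => n x; rewrite geq_max => /andP[n1n n2n].
apply: le_trans (ler_normD _ _) _; rewrite normrM.
have {}h1 := h1 n x n1n; have {}h2 := h2 n x n2n.
have : `|a| * `|f (n, x)| <= `|a| * (e / (`|a| + 1) / 2) by rewrite ler_wpM2l.
have : e = `|a| * (e / (`|a| + 1)) + e / (`|a| + 1).
  by field; rewrite gt_eqF.
by lra.
Qed.

Definition c0sum V : fspace := FSpace (@c0_mem0 V) (@c0_mem_lin V).

Lemma oper_c0 V W F : oper (V := V) (W := W) F ->
  oper (V := c0sum V) (W := c0sum W) (fun f z => F (fun x => f (z.1, x)) z.2).
Proof.
move=> [F1 F2 [C C0 F3]]; split.
- move=> f [f1 f2]; split => [n|e e0]; first exact: (F1 _ (f1 n)).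
  have eC : 0 < e / (C + 1) by rewrite divr_gt0// ltr_wpDl.
  have [n0 h] := f2 _ eC; exists n0 => n x n0n /=.
  apply: le_trans (F3 _ _ (f1 n) (ltW eC) (fun y => h n y n0n) x) _.
  by rewrite mulrC -mulrA ler_piMr ?(ltW e0)// mulrC ler_pdivrMr ?mul1r ?lerDl// ltr_wpDl.
- by move=> a f g [f1 _] [g1 _]; apply/funext => -[n x]; rewrite /= F2.
- by exists C => // f M [f1 _] M0 fM [n x]; apply: F3.
Qed.

Lemma complemented_c0 V W : complemented V W -> complemented (c0sum V) (c0sum W).
Proof.
move=> [F [G [oF oG FG]]].
exists (fun f z => F (fun x => f (z.1, x)) z.2), (fun f z => G (fun x => f (z.1, x)) z.2).
split; [exact: oper_c0|exact: oper_c0|].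
by move=> f [f1 _]; apply/funext => -[n x]; rewrite /= FG.
Qed.

Lemma isom_c0 V W : isom V W -> isom (c0sum V) (c0sum W).
Proof.
move=> [F [G [oF oG FG GF]]].
exists (fun f z => F (fun x => f (z.1, x)) z.2), (fun f z => G (fun x => f (z.1, x)) z.2).
split; [exact: oper_c0|exact: oper_c0| |].
  by move=> f [f1 _]; apply/funext => -[n x]; rewrite /= FG.
by move=> f [f1 _]; apply/funext => -[n x]; rewrite /= GF.
Qed.

Lemma c0_fsum V W : isom (c0sum (fsum V W)) (fsum (c0sum V) (c0sum W)).
Proof.
pose e (z : nat * dom V + nat * dom W) : nat * (dom V + dom W) :=
  match z with inl (n, x) => (n, inl x) | inr (n, x) => (n, inr x) end.
pose e' (z : nat * (dom V + dom W)) : nat * dom V + nat * dom W :=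
  match z with (n, inl x) => inl (n, x) | (n, inr x) => inr (n, x) end.
apply: (@isom_reindex (c0sum (fsum V W)) (fsum (c0sum V) (c0sum W)) e e').
- by do 2 case.
- by case=> ? [].
- move=> f; split.
    move=> [f1 f2]; split; split => [n|d d0]; try by case: (f1 n).
      by have [n0 h] := f2 _ d0; exists n0 => n x n0n; exact: h.
    by have [n0 h] := f2 _ d0; exists n0 => n x n0n; exact: h.
  move=> [[f1 f2] [g1 g2]]; split => [n|d d0]; first by split; [exact: f1|exact: g1].
  have [n1 h1] := f2 _ d0; have [n2 h2] := g2 _ d0.
  exists (maxn n1 n2) => n [x|x]; rewrite geq_max => /andP[? ?].
    exact: h1.
  exact: h2.
Qed.

(** Prepending the new term to the sequence. *)
Lemma c0_absorb V : isom (fsum V (c0sum V)) (c0sum V).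
Proof.
pose e (z : nat * dom V) : dom V + nat * dom V :=
  match z with (0%N, x) => inl x | (n.+1, x) => inr (n, x) end.
pose e' (z : dom V + nat * dom V) : nat * dom V :=
  match z with inl x => (0%N, x) | inr (n, x) => (n.+1, x) end.
apply: (@isom_reindex (fsum V (c0sum V)) (c0sum V) e e').
- by move=> [[|n] x].
- by case=> [|[]].
- move=> f; split.
    move=> [f1 [g1 g2]]; split => [[|n]|d d0]; [exact: f1|exact: g1|].
    by have [n0 h] := g2 _ d0; exists n0.+1 => -[|n] x // n0n; exact: h.
  move=> [f1 f2]; split; [exact: (f1 0%N)|split => [n|d d0]]; first exact: (f1 n.+1).
  by have [n0 h] := f2 _ d0; exists n0 => n x n0n; apply: (h n.+1); rewrite leqW.
Qed.

Lemma complemented_c0_summand V : complemented V (c0sum V).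
Proof.
have [F [G [oF oG FG _]]] := c0_absorb V.
exists (F \o (fun f => sumf f (fun _ => 0))), (inlf \o G); split.
- apply: oper_comp oF; apply: (@oper_pair V (c0sum V) V id (fun _ _ => 0)); first exact: oper_id.
  split => [f _|a f g _ _|]; first exact: c0_mem0.
    by apply/funext => x; rewrite /lincomb; ring.
  by exists 0 => // f M _ M0 _ y; rewrite normr0 mul0r.
- by apply: oper_comp oG _; exact: oper_inl.
- by move=> f Vf; rewrite /= FG//; split => //; exact: c0_mem0.
Qed.

(** The decomposition method: [X] contains [c0(X)], which is isomorphic to
    [Y + c0(X)] since [X = Y + Z] gives [c0(X) = c0(Y) + c0(Z)] and [c0(Y)]
    absorbs a copy of [Y].  So [X] absorbs [Y] as well. *)
Lemma pelczynski_absorb X Y :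
  complemented Y X -> complemented (c0sum X) X -> isom X (fsum Y X).
Proof.
move=> /complemented_split[Z XYZ] /complemented_split[W XcW].
have cX : isom (c0sum X) (fsum Y (c0sum X)).
  have h : isom (c0sum X) (fsum (c0sum Y) (c0sum Z)).
    exact: isom_trans (isom_c0 XYZ) (c0_fsum _ _).
  apply: isom_trans (h) _.
  apply: isom_trans (isom_fsum (isom_sym (c0_absorb Y)) (isom_refl _)) _.
  apply: isom_trans (isom_sym (fsumA _ _ _)) _.
  exact: isom_fsum (isom_refl _) (isom_sym h).
apply: isom_trans (XcW) _; apply: isom_trans (isom_fsum cX (isom_refl W)) _.
apply: isom_trans (isom_sym (fsumA _ _ _)) _.
exact: isom_fsum (isom_refl _) (isom_sym XcW).
Qed.

(** Applied twice, absorption identifies both spaces with [X + Y]. *)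
Lemma pelczynski X Y : complemented X Y -> complemented Y X ->
  complemented (c0sum X) X -> complemented (c0sum Y) Y -> isom X Y.
Proof.
move=> XY YX cX cY; apply: isom_trans (pelczynski_absorb YX cX) _.
exact: isom_trans (fsumC _ _) (isom_sym (pelczynski_absorb XY cY)).
Qed.

End function_spaces.
Arguments fspace : clear implicits.

(** * Functions on split subsets of the line *)

Section split_line.
Context {R : realType}.
Implicit Types (N M A : set R) (f : R * bool -> R).

(** A boolean stands for a side, [true] for the right one, so that limits from
    the left and from the right obey one statement. *)
Definition side (i : bool) (t y : R) : bool := if i then t < y else y < t.

Definition between (i : bool) (t s y : R) : bool := side i t s && side i s y.

Lemma side_ball i t (d : R) : 0 < d ->
  exists2 y, side i t y & forall s, between i t s y -> `|s - t| < d.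
Proof.
move=> d0; exists (if i then t + d else t - d); rewrite /between /side.
  by case: i; rewrite ?ltrDl ?gtrBl.
case: i => s /andP[s1 s2]; first by rewrite ltr_distlC; lra.
by rewrite ltr_distl; lra.
Qed.

Lemma side_meet i t y1 y2 : side i t y1 -> side i t y2 ->
  exists2 y, side i t y &
    forall s, between i t s y -> between i t s y1 /\ between i t s y2.
Proof.
rewrite /between /side; case: i => t1 t2.
  exists (Num.min y1 y2); first by rewrite lt_min t1.
  by move=> s; rewrite lt_min => /and3P[-> -> ->].
exists (Num.max y1 y2); first by rewrite gt_max t1.
by move=> s; rewrite gt_max => /and3P[-> -> ->].
Qed.

Lemma side_shrink i t y (d : R) : side i t y -> 0 < d ->
  exists2 y', side i t y' &
    forall s, between i t s y' -> between i t s y /\ `|s - t| < d.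
Proof.
move=> ty d0; have [z tz zd] := side_ball i t d0.
have [y' ty' h] := side_meet ty tz; exists y' => // s /h[? ?]; split => //.
exact: zd.
Qed.

(** The point [(t, false)] is the left half and [(t, true)] the right half of
    the split point [t]; the points outside [A] are not split.  When [N] is
    closed these are the continuous functions vanishing at infinity on the
    ordered space obtained from [N] by splitting the points of [A]. *)
Record dmem N A f : Prop := DMem {
  d_off : forall t i, ~ N t -> f (t, i) = 0;
  d_bdd : exists2 B : R, 0 <= B & forall z, `|f z| <= B;
  d_unsplit : forall t, ~ A t -> f (t, false) = f (t, true);
  d_side : forall t i (e : R), N t -> 0 < e -> exists2 y, side i t y &
    forall s j, N s -> between i t s y -> `|f (s, j) - f (t, i)| <= e;
  d_infty : forall e : R, 0 < e -> exists B : R, forall t i, B < `|t| -> `|f (t, i)| <= e }.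

Lemma dmem0 N A : dmem N A (fun _ => 0).
Proof.
split => //.
- by exists 0 => // z; rewrite normr0.
- move=> t i e Nt e0; have [y ty _] := side_ball i t e0.
  by exists y => // s j _ _; rewrite subrr normr0 ltW.
- by move=> e e0; exists 0 => t i _; rewrite normr0 ltW.
Qed.

Lemma lincomb_small (a e : R) : 0 < e ->
  exists2 d, 0 < d & forall x y, `|x| <= d -> `|y| <= d -> `|a * x + y| <= e.
Proof.
move=> e0; exists (e / (`|a| + 1)); first by rewrite divr_gt0// ltr_wpDl.
move=> x y xd yd; apply: le_trans (ler_normD _ _) _; rewrite normrM.
have : `|a| * `|x| <= `|a| * (e / (`|a| + 1)) by rewrite ler_wpM2l.
have : e = `|a| * (e / (`|a| + 1)) + e / (`|a| + 1).
  by field; rewrite gt_eqF// ltr_wpDl.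
lra.
Qed.

Lemma dmem_lin N A a f g : dmem N A f -> dmem N A g -> dmem N A (lincomb a f g).
Proof.
move=> [f1 [Mf Mf0 f2] f3 f4 f5] [g1 [Mg Mg0 g2] g3 g4 g5]; split; rewrite /lincomb.
- by move=> t i Nt; rewrite f1// g1//; ring.
- exists (`|a| * Mf + Mg); first by rewrite addr_ge0// mulr_ge0.
  move=> z; apply: le_trans (ler_normD _ _) _; rewrite lerD// normrM ler_wpM2l//.
- by move=> t At; rewrite f3// g3.
- move=> t i e Nt e0; have [d d0 small] := lincomb_small a e0.
  have [y1 ty1 h1] := f4 t i d Nt d0; have [y2 ty2 h2] := g4 t i d Nt d0.
  have [y ty h] := side_meet ty1 ty2; exists y => // s j Ns /h[b1 b2].
  rewrite (_ : _ - _ = a * (f (s, j) - f (t, i)) + (g (s, j) - g (t, i))); last by ring.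
  by apply: small; [exact: h1|exact: h2].
- move=> e e0; have [d d0 small] := lincomb_small a e0.
  have [M1 h1] := f5 _ d0; have [M2 h2] := g5 _ d0.
  exists (Num.max M1 M2) => t i; rewrite gt_max => /andP[? ?].
  by apply: small; [exact: h1|exact: h2].
Qed.

Definition dspace N A : fspace R := FSpace (@dmem0 N A) (@dmem_lin N A).

Lemma dmemA N A A' f : (forall t, N t -> A t -> A' t) -> dmem N A f -> dmem N A' f.
Proof.
move=> AA' [f1 f2 f3 f4 f5]; split => // t A't.
have [Nt|Nt] := pselect (N t); last by rewrite !f1.
by apply: f3; apply: contra_not A't; exact: AA'.
Qed.

Lemma dspace_weaken (V : fspace R) N A A' F : (forall t, N t -> A t -> A' t) ->
  oper (V := V) (W := dspace N A) F -> oper (V := V) (W := dspace N A') F.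
Proof. by move=> AA' [F1 F2 F3]; split => // f Vf; apply: dmemA AA' _; exact: F1. Qed.

Lemma dspace_eqA N A A' : (forall t, N t -> A t <-> A' t) ->
  complemented (dspace N A) (dspace N A').
Proof.
move=> AA'; exists id, id; split => //; apply: incl_oper => f; apply: dmemA => t Nt;
  by case: (AA' t Nt).
Qed.

(** ** Restriction and extension by zero *)

Definition res N f : R * bool -> R := fun z => if `[< N z.1 >] then f z else 0.

Lemma resE N f t i : N t -> res N f (t, i) = f (t, i).
Proof. by move=> Nt; rewrite /res/=; case: asboolP. Qed.

Lemma resE0 N f t i : ~ N t -> res N f (t, i) = 0.
Proof. by move=> Nt; rewrite /res/=; case: asboolP. Qed.

Lemma res_id N A f : dmem N A f -> res N f = f.
Proof.
move=> [f1 _ _ _ _]; apply/funext => -[t i]; have [Nt|Nt] := pselect (N t).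
  by rewrite resE.
by rewrite resE0// f1.
Qed.

Lemma res_dmem N M A f : (N `<=` M) -> dmem M A f -> dmem N A (res N f).
Proof.
move=> NM [f1 [Mf Mf0 f2] f3 f4 f5]; split.
- by move=> t i; exact: resE0.
- by exists Mf => // -[t i]; rewrite /res; case: ifP => // _; rewrite normr0.
- by move=> t At; rewrite /res/= f3.
- move=> t i e Nt e0; have [y ty h] := f4 t i e (NM _ Nt) e0.
  by exists y => // s j Ns bs; rewrite !resE//; apply: h => //; exact: NM.
- move=> e e0; have [M0 h] := f5 _ e0; exists M0 => t i Mt.
  by rewrite /res; case: ifP => // _; [exact: h|rewrite normr0 ltW].
Qed.

Lemma res_lincomb N a f g : res N (lincomb a f g) = lincomb a (res N f) (res N g).
Proof. by apply/funext => z; rewrite /res /lincomb; case: ifP => // _; ring. Qed.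

Lemma res_oper N M A : N `<=` M -> oper (V := dspace M A) (W := dspace N A) (res N).
Proof.
move=> NM; split.
- by move=> f; exact: res_dmem.
- by move=> a f g _ _; exact: res_lincomb.
- exists 1 => // f K _ K0 fK z; rewrite mul1r /res.
  by case: ifP => // _; rewrite normr0.
Qed.

(** Extension by zero keeps the one-sided limits when [N] is both open and closed
    relative to the larger set, which the second hypothesis expresses. *)
Lemma dmem_ext0 N M A f : (N `<=` M) ->
  (forall t, M t -> exists2 d, 0 < d &
    (N t /\ forall s, M s -> `|s - t| < d -> N s) \/
    (forall s, `|s - t| < d -> ~ N s)) ->
  dmem N A f -> dmem M A f.
Proof.
move=> NM sep [f1 f2 f3 f4 f5]; split => //.
- by move=> t i Mt; apply: f1; apply: contra_not Mt; exact: NM.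
- move=> t i e Mt e0; have [d d0 [[Nt h]|h]] := sep _ Mt.
    have [y ty hy] := f4 t i e Nt e0; have [y' ty' hy'] := side_shrink ty d0.
    by exists y' => // s j Ms /hy'[b /h Ns]; apply: hy => //; exact: Ns.
  have [y ty hy] := side_ball i t d0; exists y => // s j Ms /hy /h Ns.
  by rewrite !f1 ?subrr ?normr0 ?ltW//; apply: h; rewrite subrr normr0.
Qed.

Lemma dspace_sum N1 A1 N2 A2 c :
  (forall t, N1 t -> t < c) -> (forall t, N2 t -> c < t) ->
  A1 `<=` N1 -> A2 `<=` N2 ->
  complemented (fsum (dspace N1 A1) (dspace N2 A2)) (dspace (N1 `|` N2) (A1 `|` A2)).
Proof.
move=> N1c N2c AN1 AN2.
have i1 f : dmem N1 A1 f -> dmem (N1 `|` N2) (A1 `|` A2) f.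
  move=> /(dmemA (A' := A1 `|` A2)) h; apply: dmem_ext0 (h _).
  - by move=> t; left.
  - move=> t [Nt|Nt].
      exists (c - t); first by rewrite subr_gt0 N1c.
      left; split => // s [//|/N2c]; rewrite ltr_distlC; lra.
    exists (t - c); first by rewrite subr_gt0 N2c.
    by right => s; rewrite ltr_distl => h1 /N1c; lra.
  - by move=> t _; left.
have i2 f : dmem N2 A2 f -> dmem (N1 `|` N2) (A1 `|` A2) f.
  move=> /(dmemA (A' := A1 `|` A2)) h; apply: dmem_ext0 (h _).
  - by move=> t; right.
  - move=> t [Nt|Nt].
      exists (c - t); first by rewrite subr_gt0 N1c.
      by right => s; rewrite ltr_distlC => h1 /N2c; lra.
    exists (t - c); first by rewrite subr_gt0 N2c.
    left; split => // s [/N1c|//]; rewrite ltr_distl; lra.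
  - by move=> t _; right.
exists (fun h => lincomb 1 (inlf h) (inrf h)).
exists (fun f => sumf (res N1 f) (res N2 f)); split.
- apply: (@oper_lin _ (fsum (dspace N1 A1) (dspace N2 A2)) (dspace (N1 `|` N2) (A1 `|` A2))).
    exact: (oper_comp (oper_inl _ _) (incl_oper _ _ _ _ i1)).
  exact: (oper_comp (oper_inr _ _) (incl_oper _ _ _ _ i2)).
- apply: (@oper_pair _ (dspace N1 A1) (dspace N2 A2) (dspace (N1 `|` N2) (A1 `|` A2))).
    apply: (dspace_weaken (A := A1 `|` A2)).
      by move=> t /N1c tc [//|/AN2/N2c]; lra.
    by apply: res_oper => t; left.
  apply: (dspace_weaken (A := A1 `|` A2)).
    by move=> t /N2c tc [/AN1/N1c|//]; lra.
  by apply: res_oper => t; right.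
- move=> f [f1 f2]; rewrite -[RHS]sumf_eta; congr sumf; apply/funext => -[t i].
    have [Nt|Nt] := pselect (N1 t).
      rewrite resE// /lincomb (d_off f2); first by ring.
      by move=> /N2c; have := N1c _ Nt; lra.
    by rewrite resE0// (d_off f1).
  have [Nt|Nt] := pselect (N2 t).
    rewrite resE// /lincomb (d_off f1); first by ring.
    by move=> /N1c; have := N2c _ Nt; lra.
  by rewrite resE0// (d_off f2).
Qed.

(** ** Linear interpolation in the gaps of a closed set *)

Definition real_gap N t := exists2 e : R, 0 < e & forall s, `|s - t| < e -> ~ N s.

Lemma closed_gap N t : closed N -> ~ N t -> real_gap N t.
Proof.
move=> cN Nt; have /open_nbhs_nbhs : open_nbhs t (~` N).
  by split => //; exact: closed_openC.
move=> /nbhs_ballP[e e0 h]; exists e => // s st; apply: h.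
by rewrite /ball/= distrC.
Qed.

Lemma gap_closed N : (forall t, ~ N t -> real_gap N t) -> closed N.
Proof.
move=> h; rewrite -openC openE => t /h[e e0 he].
by apply/nbhs_ballP; exists e => //= s; rewrite /ball/= distrC => /he.
Qed.

(** Adding the points far from [N], where the extensions vanish, makes all gaps
    bounded. *)
Definition fill N : set R := [set t | N t \/ forall s, N s -> 1 <= `|s - t|].

Lemma closed_fill N : closed N -> closed (fill N).
Proof.
move=> cN; apply: gap_closed => t /not_orP[Nt].
move=> /existsNP[s /not_implyP[Ns /negP]]; rewrite -ltNge => st.
have [e e0 he] := closed_gap cN Nt.
exists (Num.min e (1 - `|s - t|)); first by rewrite lt_min e0 subr_gt0.
move=> r; rewrite lt_min => /andP[re rs] [/(he _ re)//|/(_ _ Ns)].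
have := ler_distD t s r; rewrite (distrC t r); lra.
Qed.

Lemma dmem_fill N A f : dmem N A f -> dmem (fill N) A f.
Proof.
apply: dmem_ext0 => [t|t]; first by left.
move=> ft; exists 1 => //; case: ft => [Nt|far].
  left; split => // s [//|/(_ _ Nt)]; rewrite distrC; lra.
by right => s st Ns; have := far _ Ns; lra.
Qed.

Definition gap_lo N t : R := sup [set s | fill N s /\ s < t].
Definition gap_hi N t : R := inf [set s | fill N s /\ t < s].

Lemma fill_near N t i : exists2 s, fill N s & side i t s && (`|s - t| <= 2).
Proof.
have [[s [Ns st]]|h] := pselect (exists s, N s /\ (side i t s && (`|s - t| <= 2))).
  by exists s => //; left.
case: i h => h.
  have [Nt|Nt] := pselect (exists2 s, N s & `|s - (t + 1)| < 1).
    case: Nt => s Ns; rewrite ltr_distl => st; exfalso; apply: h; exists s.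
    by split => //; rewrite /side ler_distl; lra.
  exists (t + 1); last by rewrite /side ler_distl; lra.
  by right => s Ns; rewrite leNgt; apply/negP => st; apply: Nt; exists s.
have [Nt|Nt] := pselect (exists2 s, N s & `|s - (t - 1)| < 1).
  case: Nt => s Ns; rewrite ltr_distl => st; exfalso; apply: h; exists s.
  by split => //; rewrite /side ler_distl; lra.
exists (t - 1); last by rewrite /side ler_distl; lra.
by right => s Ns; rewrite leNgt; apply/negP => st; apply: Nt; exists s.
Qed.

Record gap_spec N t : Prop := GapSpec {
  gs_lo : fill N (gap_lo N t);
  gs_hi : fill N (gap_hi N t);
  gs_lolt : gap_lo N t < t;
  gs_hilt : t < gap_hi N t;
  gs_lo2 : t - 2 <= gap_lo N t;
  gs_hi2 : gap_hi N t <= t + 2;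
  gs_lomax : forall s, fill N s -> s < t -> s <= gap_lo N t;
  gs_himin : forall s, fill N s -> t < s -> gap_hi N t <= s }.

Lemma gapP N t : closed N -> ~ fill N t -> gap_spec N t.
Proof.
move=> /closed_fill cN Nt.
have [a Na /andP[/= at_ a2]] := fill_near N t false.
have [b Nb /andP[/= tb b2]] := fill_near N t true.
pose S := [set s | fill N s /\ s < t]; pose T := [set s | fill N s /\ t < s].
have Sub : ubound S t by move=> s [_ /ltW].
have Tlb : lbound T t by move=> s [_ /ltW].
have hS : has_sup S by split; [exists a|exists t].
have hT : has_inf T by split; [exists b|exists t].
have supS s : S s -> s <= sup S by apply: ub_le_sup; exists t.
have infT s : T s -> inf T <= s by apply: ge_inf; exists t.
have flo : fill N (sup S).
  apply: contrapT => /(closed_gap cN)[e e0 he].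
  have [s Ss se] := sup_adherent e0 hS.
  apply: (he s); last by case: Ss.
  by have := supS _ Ss; rewrite ltr_distl; lra.
have fhi : fill N (inf T).
  apply: contrapT => /(closed_gap cN)[e e0 he].
  have [s Ss se] := inf_adherent e0 hT.
  apply: (he s); last by case: Ss.
  by have := infT _ Ss; rewrite ltr_distl; lra.
have lo_le : sup S <= t by apply: ge_sup => //; exists a.
have hi_le : t <= inf T by apply: le_inf_nonempty || apply: lb_le_inf => //; exists b.
have lo_lt : sup S < t by rewrite lt_neqAle lo_le andbT; apply/eqP => E; apply: Nt; rewrite -E.
have hi_lt : t < inf T by rewrite lt_neqAle hi_le andbT; apply/eqP => E; apply: Nt; rewrite E.
split => //.
- have : a <= sup S by apply: supS.
  by move: a2; rewrite ler_distl /gap_lo -/S; lra.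
- have : inf T <= b by apply: infT.
  by move: b2; rewrite ler_distl /gap_hi -/T; lra.
- by move=> s Ns st; apply: supS.
- by move=> s Ns st; apply: infT.
Qed.

Lemma gap_same N t s : closed N -> ~ fill N t -> gap_lo N t < s < gap_hi N t ->
  [/\ ~ fill N s, gap_lo N s = gap_lo N t & gap_hi N s = gap_hi N t].
Proof.
move=> cN Nt /andP[ls sh]; have [g1 g2 g3 g4 _ _ g7 g8] := gapP cN Nt.
have Ns : ~ fill N s.
  move=> Ns; have [st|ts|E] := ltgtP s t.
  - by have := g7 _ Ns st; lra.
  - by have := g8 _ Ns ts; lra.
  - by apply: Nt; rewrite -E.
have [k1 k2 k3 k4 _ _ k7 k8] := gapP cN Ns; split => //; apply/eqP; rewrite eq_le.
- rewrite k7// andbT; have [//|h] := leP (gap_lo N s) (gap_lo N t).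
  have [h'|h'|E] := ltgtP (gap_lo N s) t.
  + by have := g7 _ k1 h'; lra.
  + by have := g8 _ k1 h'; lra.
  + by exfalso; apply: Nt; rewrite -E.
- rewrite k8//=; have [//|h] := leP (gap_hi N t) (gap_hi N s).
  have [h'|h'|E] := ltgtP (gap_hi N s) t.
  + by have := g7 _ k2 h'; lra.
  + by have := g8 _ k2 h'; lra.
  + by exfalso; apply: Nt; rewrite -E.
Qed.

(** In a gap, the value taken at an end is that of the half facing the gap. *)
Definition interp N f : R * bool -> R := fun z =>
  if `[< fill N z.1 >] then f z else
  let u := gap_lo N z.1 in let v := gap_hi N z.1 in
  (v - z.1) / (v - u) * f (u, true) + (z.1 - u) / (v - u) * f (v, false).

Lemma interpE N f t i : fill N t -> interp N f (t, i) = f (t, i).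
Proof. by move=> Nt; rewrite /interp/=; case: asboolP. Qed.

Lemma interpE0 N f t i : ~ fill N t -> interp N f (t, i) =
  (gap_hi N t - t) / (gap_hi N t - gap_lo N t) * f (gap_lo N t, true) +
  (t - gap_lo N t) / (gap_hi N t - gap_lo N t) * f (gap_hi N t, false).
Proof. by move=> Nt; rewrite /interp/=; case: asboolP. Qed.

Lemma convex_close (u v t x y c e : R) : u < t -> t < v ->
  `|x - c| <= e -> `|y - c| <= e ->
  `|(v - t) / (v - u) * x + (t - u) / (v - u) * y - c| <= e.
Proof.
move=> ut tv xe ye; have vu : 0 < v - u by lra.
have p0 : 0 <= (v - t) / (v - u) by rewrite divr_ge0; lra.
have q0 : 0 <= (t - u) / (v - u) by rewrite divr_ge0; lra.
have : (v - t) / (v - u) + (t - u) / (v - u) = 1 by field; lra.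
move: p0 q0; set p := (v - t) / _; set q := (t - u) / _ => p0 q0 pq; clearbody p q.
rewrite (_ : _ - c = p * (x - c) + q * (y - c)); last first.
  by transitivity (p * x + q * y - (p + q) * c); [rewrite pq mul1r|ring].
apply: le_trans (ler_normD _ _) _; rewrite !normrM (ger0_norm p0) (ger0_norm q0).
by rewrite (_ : e = p * e + q * e) ?lerD ?ler_wpM2l// -mulrDl pq mul1r.
Qed.

(** Only the one-sided limits at a point [t] of the closed set need an argument.
    If the set accumulates at [t] on the given side, the gaps near [t] have both
    ends near [t], where the values are close to the limit.  Otherwise a gap
    starts at [t], and there the interpolation is affine. *)
Lemma interp_dmem N A f : closed N -> dmem N A f -> dmem setT A (interp N f).
Proof.
move=> cN fN; have [f1 [M M0 f2] f3 f4 f5] := dmem_fill fN.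
have diff z z' : `|f z - f z'| <= 2 * M.
  apply: le_trans (ler_normB _ _) _.
  by have := f2 z; have := f2 z'; lra.
split.
- by move=> t i /(_ Logic.I).
- exists M => // -[t i]; have [Nt|Nt] := pselect (fill N t); first by rewrite interpE.
  have [_ _ g3 g4 _ _ _ _] := gapP cN Nt.
  by rewrite interpE0// -[X in `|X|]subr0; apply: convex_close => //; rewrite subr0.
- move=> t At; have [Nt|Nt] := pselect (fill N t); first by rewrite !interpE ?f3.
  by rewrite !interpE0.
- move=> t i e _ e0; have [Nt|Nt] := pselect (fill N t); last first.
    (* inside a gap the interpolation is affine *)
    have [g1 g2 g3 g4 _ _ g7 g8] := gapP cN Nt.
    set u := gap_lo N t in g3 g7 *; set v := gap_hi N t in g4 g8 *.
    have d0 : 0 < Num.min (Num.min (t - u) (v - t)) (e * (v - u) / (2 * M + 1)).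
      rewrite !lt_min !subr_gt0 g3 g4/= divr_gt0//; last by lra.
      by rewrite mulr_gt0//; lra.
    have [y ty hy] := side_ball i t d0; exists y => // s j _ /hy.
    rewrite !lt_min => /andP[/andP[su sv] sd].
    have uv : u < s < v by move: su sv; rewrite !ltr_distl; lra.
    have [Ns Eu Ev] := gap_same cN Nt uv.
    rewrite !interpE0// Eu Ev -/u -/v.
    rewrite (_ : _ - _ = (s - t) / (v - u) * (f (v, false) - f (u, true))); last first.
      by field; lra.
    have vu : 0 < v - u by lra.
    rewrite normrM normrM normfV (gtr0_norm vu).
    apply: (@le_trans _ _ (`|s - t| / (v - u) * (2 * M + 1))).
      apply: ler_wpM2l; first by rewrite divr_ge0// ltW.
      by have := diff (v, false) (u, true); lra.
    rewrite mulrAC ler_pdivrMr// -ler_pdivlMr; last by lra.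
    exact: ltW.
  rewrite interpE//; have [y0 ty0 h0] := f4 t i e Nt e0.
  have [[s0 [Ns0 bs0]]|iso] := pselect (exists s, fill N s /\ between i t s y0).
    have clos r : fill N r -> (r == t) || between i t r y0 ->
        forall j, (r = t -> j = i) -> `|f (r, j) - f (t, i)| <= e.
      move=> Nr /orP[/eqP->|br] j ji; last exact: h0.
      by rewrite ji// subrr normr0 ltW.
    exists s0; first by case/andP: bs0.
    move=> s j _ bs; have [Ns|Ns] := pselect (fill N s).
      rewrite interpE//; apply: h0 => //; move: bs bs0; rewrite /between /side.
      by case: i {ty0 clos f4} => /andP[? ?] /andP[? ?]; apply/andP; split => //; lra.
    have [g1 g2 g3 g4 _ _ g7 g8] := gapP cN Ns.
    rewrite interpE0//; apply: convex_close => //; apply: clos => //.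
    + move: bs bs0; rewrite /between /side; case: i {h0 ty0 f4} => /andP[? ?] /andP[? ?].
        have : t <= gap_lo N s by apply: g7.
        by rewrite le_eqVlt => /orP[/eqP->|->]; rewrite ?eqxx//=; apply/orP; right; lra.
      have : s0 <= gap_lo N s by apply: g7.
      by move=> ?; apply/orP; right; lra.
    + by move: bs; rewrite /between /side; case: i {h0 ty0 f4 bs0} => // /andP[? ?] ?; lra.
    + move: bs bs0; rewrite /between /side; case: i {h0 ty0 f4} => /andP[? ?] /andP[? ?].
        have : gap_hi N s <= s0 by apply: g8.
        by move=> ?; apply/orP; right; lra.
      have : gap_hi N s <= t by apply: g8.
      by rewrite le_eqVlt => /orP[/eqP->|->]; rewrite ?eqxx//=; apply/orP; right; lra.
    + by move: bs; rewrite /between /side; case: i {h0 ty0 f4 bs0} => // /andP[? ?] ?; lra.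
  (* no point of the set between [t] and [y0]: a gap starts at [t] *)
  have {}iso s : fill N s -> between i t s y0 -> False by move=> ? ?; apply: iso; exists s.
  have d0 : 0 < e * `|y0 - t| / (2 * M + 1).
    rewrite divr_gt0//; last by lra.
    rewrite mulr_gt0// normr_gt0 subr_eq0; apply/eqP => E.
    by move: ty0; rewrite E /side; case: (i); rewrite ltxx.
  have [y ty hy] := side_shrink ty0 d0; exists y => // s j _ /hy[bs sd].
  have Ns : ~ fill N s by move=> Ns; exact: iso bs.
  have [g1 g2 g3 g4 _ _ g7 g8] := gapP cN Ns.
  rewrite interpE0//; set u := gap_lo N s in g1 g3 g7 *; set v := gap_hi N s in g2 g4 g8 *.
  have vu : 0 < v - u by lra.
  have key (w a b : R) : 0 < w -> `|y0 - t| <= w -> `|a - b| <= 2 * M ->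
      `|s - t| / w * `|a - b| <= e.
    move=> w0 yw ab; apply: (@le_trans _ _ (`|s - t| / w * (2 * M + 1))).
      by apply: ler_wpM2l; [rewrite divr_ge0// ltW|lra].
    rewrite mulrAC ler_pdivrMr// -ler_pdivlMr; last by lra.
    apply: le_trans (ltW sd) _; apply: ler_wpM2r; first by rewrite invr_ge0; lra.
    by apply: ler_wpM2l => //; exact: ltW.
  move: ty0 bs iso; rewrite /between /side; case: i {f4 h0 ty hy} => ty0 /andP[ts sy0] iso.
    have E : u = t.
      apply/eqP; rewrite eq_le g7// andbT leNgt; apply/negP => tu.
      by apply: (iso u) => //; lra.
    have yv : y0 <= v.
      by rewrite leNgt; apply/negP => vy; apply: (iso v) => //; lra.
    rewrite E in vu *.
    rewrite (_ : _ - _ = (s - t) / (v - t) * (f (v, false) - f (t, true))); last first.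
      by field; lra.
    rewrite normrM normrM normfV (gtr0_norm vu); apply: key => //.
    by rewrite ger0_norm; lra.
  have E : v = t.
    apply/eqP; rewrite eq_le g8//= leNgt; apply/negP => tu.
    by apply: (iso v) => //; lra.
  have yv : u <= y0.
    by rewrite leNgt; apply/negP => vy; apply: (iso u) => //; lra.
  rewrite E in vu *.
  rewrite (_ : _ - _ = (t - s) / (t - u) * (f (u, true) - f (t, false))); last first.
    by field; lra.
  rewrite normrM normrM normfV (gtr0_norm vu) (distrC t s); apply: key => //.
  by rewrite ler0_norm; lra.
- move=> e e0; have [K hK] := f5 _ e0; exists (K + 2) => t i Kt.
  have [Nt|Nt] := pselect (fill N t); first by rewrite interpE//; apply: hK; lra.
  have [_ _ g3 g4 g5 g6 _ _] := gapP cN Nt.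
  rewrite interpE0// -[X in `|X|]subr0; apply: convex_close => //; rewrite subr0; apply: hK.
    by have := ler_distD t (gap_lo N t) 0; have := ler_distD (gap_lo N t) t 0;
      rewrite !subr0 (gtr0_norm (_ : 0 < t - gap_lo N t)); lra.
  by have := ler_distD (gap_hi N t) t 0;
    rewrite !subr0 (ltr0_norm (_ : t - gap_hi N t < 0)); lra.
Qed.

Lemma interp_oper N A : closed N ->
  oper (V := dspace N A) (W := dspace setT A) (interp N).
Proof.
move=> cN; split.
- by move=> f; exact: interp_dmem.
- move=> a f g _ _; apply/funext => -[t i]; rewrite /interp /lincomb.
  by case: ifP => // _; ring.
- exists 1 => // f K _ K0 fK [t i]; rewrite mul1r.
  have [Nt|Nt] := pselect (fill N t); first by rewrite interpE.
  have [_ _ g3 g4 _ _ _ _] := gapP cN Nt.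
  by rewrite interpE0// -[X in `|X|]subr0; apply: convex_close => //; rewrite subr0.
Qed.

(** Interpolation is a right inverse of the restriction to [N]. *)
Lemma complemented_closed N M A : closed N -> N `<=` M ->
  complemented (dspace N A) (dspace M A).
Proof.
move=> cN NM; exists (res M \o interp N), (res N); split.
- exact: oper_comp (interp_oper A cN) (res_oper A (@subsetT _ M)).
- exact: res_oper.
- move=> f fN; rewrite /= -[RHS](res_id fN); apply/funext => -[t i].
  rewrite /res/=; case: asboolP => // Nt; rewrite asboolT ?interpE//; last exact: NM.
  by left.
Qed.

(** Subtracting the extension of the restriction to a closed set containing all
    split points leaves a continuous function on [M] itself. *)
Lemma complemented_unsplit N M A : closed N -> N `<=` M -> A `<=` N ->
  complemented (dspace M A) (fsum (dspace N A) (dspace M set0)).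
Proof.
move=> cN NM AN; pose E := res M \o interp N.
have oE : oper (V := dspace N A) (W := dspace M A) E.
  exact: oper_comp (interp_oper A cN) (res_oper A (@subsetT _ M)).
have oP : oper (V := dspace M A) (W := dspace M A) (fun f => lincomb (-1) (E (res N f)) f).
  apply: oper_lin (oper_id _); exact: oper_comp (res_oper A NM) oE.
exists (fun f => sumf (res N f) (lincomb (-1) (E (res N f)) f)).
exists (fun h => lincomb 1 (E (inlf h)) (inrf h)); split.
- apply: (@oper_pair _ (dspace N A) (dspace M set0) (dspace M A)); first exact: res_oper.
  have [P1 P2 P3] := oP; split => // f fM; have [p1 p2 p3 p4 p5] := P1 f fM; split => // t _.
  have [Nt|Nt] := pselect (N t); last by apply: p3; apply: contra_not Nt; exact: AN.
  rewrite /lincomb /E /res/= asboolT; last exact: NM.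
  rewrite !interpE; [|by left|by left].
  by rewrite /res/= asboolT//; ring.
- apply: (@oper_lin _ (fsum (dspace N A) (dspace M set0)) (dspace M A)).
    exact: oper_comp (oper_inl _ _) oE.
  by apply: (dspace_weaken (A := set0)) => //; exact: (oper_inr (dspace N A)).
- move=> f fM; apply/funext => z; rewrite /lincomb /inlf /inrf /=.
  by rewrite -[fun x => res N f x]/(res N f); ring.
Qed.

End split_line.

(** ** Placing a sequence of functions on disjoint translates *)

Section translates.
Context {R : realType}.
Implicit Types (N A : set R).

(** The period 4 is larger than the length 3 of the interval that will contain
    [N], so that distinct translates stay at distance at least 1. *)
Definition translates N : set R := [set t | exists n : nat, N (t - 4 * n%:R)].

Variables (N A : set R).
Hypotheses (N03 : forall t, N t -> 0 <= t <= 3) (AN : A `<=` N).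

Lemma block_uniq t (n m : nat) s r : N s -> N r ->
  s = t - 4 * n%:R -> `|r - (t - 4 * m%:R)| < 1 -> n = m.
Proof.
move=> /N03 ns /N03 mt E; rewrite ltr_distl => h.
have h1 : (n < m.+1)%N by rewrite -(ltr_nat R) -natr1; lra.
have h2 : (m < n.+1)%N by rewrite -(ltr_nat R) -natr1; lra.
by apply/eqP; rewrite eqn_leq -ltnS h1 -ltnS h2.
Qed.

Definition block t : nat := xget 0%N [set n : nat | N (t - 4 * n%:R)].

Lemma blockE t n : N (t - 4 * n%:R) -> block t = n.
Proof.
move=> Nt; rewrite /block; case: xgetP => [m _ Nm|/(_ n)//].
by apply: (block_uniq Nm Nt erefl); rewrite subrr normr0.
Qed.

Definition spread (f : nat * (R * bool) -> R) : R * bool -> R :=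
  fun z => f (block z.1, (z.1 - 4 * (block z.1)%:R, z.2)).

Lemma spreadE f t i n : N (t - 4 * n%:R) ->
  spread f (t, i) = f (n, (t - 4 * n%:R, i)).
Proof. by move=> /blockE E; rewrite /spread /= E. Qed.

Lemma spread0 f t i : fmem (f : dom (c0sum (dspace N A)) -> R) ->
  ~ translates N t -> spread f (t, i) = 0.
Proof. by move=> [f1 _] Nt; apply: (d_off (f1 _)) => h; apply: Nt; exists (block t). Qed.

Lemma spread_dmem f : fmem (f : dom (c0sum (dspace N A)) -> R) ->
  dmem (translates N) (translates A) (spread f).
Proof.
move=> ff; have [f1 f2] := ff; split.
- by move=> t i; exact: spread0.
- have [n0 h0] := f2 1 ltr01.
  have [B B0 hB] : exists2 B : R, 0 <= B & forall n z, (n < n0)%N -> `|f (n, z)| <= B.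
    elim: {h0} n0 => [|n0 [B B0 hB]]; first by exists 0.
    have [C C0 hC] := d_bdd (f1 n0); exists (B + C); first exact: addr_ge0.
    move=> n z; rewrite ltnS leq_eqVlt => /orP[/eqP->|/hB h].
      by apply: le_trans (hC z) _; rewrite lerDr.
    by apply: le_trans (h z) _; rewrite lerDl.
  exists (B + 1); first by rewrite addr_ge0.
  move=> [t i]; rewrite /spread; have [h|h] := ltnP (block t) n0.
    by apply: le_trans (hB _ _ h) _; rewrite lerDl.
  by apply: le_trans (h0 _ _ h) _; rewrite lerDr.
- move=> t At; apply: (d_unsplit (f1 _)) => h; apply: At; by exists (block t).
- move=> t i e [n Nt] e0.
  have [y0 ty0 h0] := d_side (f1 n) i Nt e0.
  have [y ty hy] := side_shrink ty0 (@ltr01 R); exists (y + 4 * n%:R).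
    by move: ty; rewrite /side; case: (i); lra.
  move=> s j [m Ns] bs.
  have bs' : between i (t - 4 * n%:R) (s - 4 * n%:R) y.
    by move: bs; rewrite /between /side; case: (i) => /andP[? ?]; apply/andP; split; lra.
  have [b d] := hy _ bs'.
  have mn : m = n.
    apply: (block_uniq (t := s) Ns Nt erefl).
    by rewrite distrC.
  rewrite mn in Ns; rewrite (spreadE _ _ Ns) (spreadE _ _ Nt).
  exact: h0.
- move=> e e0; have [n0 h0] := f2 _ e0; exists (4 * n0%:R) => t i Bt.
  have [[n Nt]|Nt] := pselect (translates N t); last by rewrite spread0// normr0 ltW.
  rewrite (spreadE _ _ Nt); apply: h0.
  have /andP[t0 t3] := N03 Nt; have n_ge0 := ler0n R n.
  move: Bt; rewrite ger0_norm => [Bt|]; last by lra.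
  by rewrite -ltnS -(ltr_nat R) -natr1; lra.
Qed.

Definition gather (h : R * bool -> R) : nat * (R * bool) -> R :=
  fun z => res N (fun w => h (w.1 + 4 * z.1%:R, w.2)) z.2.

Lemma gather_mem h : dmem (translates N) (translates A) h ->
  fmem (gather h : dom (c0sum (dspace N A)) -> R).
Proof.
move=> [h1 [B B0 h2] h3 h4 h5].
have tN (t : R) (n : nat) : N t -> translates N (t + 4 * n%:R).
  by move=> Nt; exists n; rewrite addrK.
split=> [n|e e0].
- split.
  + by move=> t i Nt; rewrite /gather resE0.
  + by exists B => // -[t i]; rewrite /gather /res; case: ifP => // _; rewrite normr0.
  + move=> t At; rewrite /gather /res /=; case: asboolP => // Nt.
    apply: h3 => -[m Am]; apply: At.
    have mn : m = n.
      apply: (block_uniq (AN Am) Nt erefl).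
      by rewrite addrK subrr normr0.
    by move: Am; rewrite mn addrK.
  + move=> t i e Nt e0; have [y ty hy] := h4 _ i e (tN t n Nt) e0.
    exists (y - 4 * n%:R); first by move: ty; rewrite /side; case: (i); lra.
    move=> s j Ns bs; rewrite /gather !resE//=; apply: hy; first exact: tN.
    by move: bs; rewrite /between /side; case: (i) => /andP[? ?]; apply/andP; split; lra.
  + move=> e e0; exists 3 => t i t3; rewrite /gather resE0 ?normr0 ?ltW// => /N03 t03.
    by move: t3; rewrite ger0_norm => [?|]; lra.
- have [C hC] := h5 _ e0; exists (Num.bound `|C|) => n [t i] nC.
  rewrite /gather /res /=; case: asboolP => [/N03 t03|_]; last by rewrite normr0 ltW.
  apply: hC; apply: le_lt_trans (ler_norm _) _.
  apply: (lt_le_trans (archi_boundP (normr_ge0 C))).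
  move: nC; rewrite -(ler_nat R) => nC; have b0 := ler0n R (Num.bound `|C|).
  by rewrite [leRHS]ger0_norm; lra.
Qed.

(** Functions vanishing at infinity on the union of the translates correspond to
    sequences of functions on [N] that tend to zero uniformly. *)
Lemma complemented_translates :
  complemented (c0sum (dspace N A)) (dspace (translates N) (translates A)).
Proof.
exists spread, gather; split.
- split => [f|//|]; first exact: spread_dmem.
  by exists 1 => // f B _ _ fB y; rewrite mul1r; exact: fB.
- split => [f|a f g _ _|]; first exact: gather_mem.
    by apply/funext => z; rewrite /gather -[LHS]/(res N (lincomb a (fun w => f (w.1 + 4 * z.1%:R, w.2))
      (fun w => g (w.1 + 4 * z.1%:R, w.2))) z.2) res_lincomb.
  exists 1 => // f B _ B0 fB y; rewrite mul1r /gather /res.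
  by case: ifP => // _; rewrite normr0.
- move=> f [f1 _]; apply/funext => -[n [t i]]; have [Nt|Nt] := pselect (N t); last first.
    by rewrite /gather resE0//; apply/esym/(d_off (f1 n)).
  by rewrite /gather resE//= (@spreadE f _ i n) addrK.
Qed.

End translates.

(** * Pulling back along monotone maps *)

Section pullback.
Context {R : realType}.
Implicit Types (N A F : set R).

(** [p] and [q] describe a nondecreasing relation between two lines: the fibre
    over [t] is the interval from [p t] to [q t].  The fibres over distinct points are
    disjoint, and together they fill an order-convex set. *)
Record fibration (p q : R -> R) : Prop := Fibration {
  fib_le : forall t, p t <= q t;
  fib_lt : forall s t, s < t -> q s < p t;
  fib_left : forall t x, x < p t -> exists2 s, s < t & x < p s;
  fib_right : forall t x, q t < x -> exists2 s, t < s & q s < x }.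

Variables (p q : R -> R) (F A B : set R) (t0 : R).
Hypotheses (pq : fibration p q) (cF : closed F).
Hypotheses (Fp : forall t, F (p t)) (Fq : forall t, F (q t)).
Hypotheses (BE : forall t, B t <-> p t < q t \/ A (p t)) (Bt0 : B t0).

Let ple t := fib_le pq t.
Let plt s t (st : s < t) : p s < p t := le_lt_trans (ple s) (fib_lt pq st).
Let qlt s t (st : s < t) : q s < q t := lt_le_trans (fib_lt pq st) (ple t).

Lemma fib_ple s t : s <= t -> p s <= p t.
Proof. by rewrite le_eqVlt => /orP[/eqP->//|/plt/ltW]. Qed.

Lemma fib_qle s t : s <= t -> q s <= q t.
Proof. by rewrite le_eqVlt => /orP[/eqP->//|/qlt/ltW]. Qed.

Definition covers t x : bool := p t <= x <= q t.

Lemma covers_uniq s t x : covers s x -> covers t x -> s = t.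
Proof.
move=> /andP[s1 s2] /andP[t1 t2]; have [/(fib_lt pq)|/(fib_lt pq)|//] := ltgtP s t; lra.
Qed.

(** If [x] is neither above nor below all fibres, it lies in the fibre over the
    supremum of the [t] with [p t <= x], by the one-sided continuity of [p] and
    [q]. *)
Lemma covers_cases x : [\/ exists t, covers t x, forall t, q t < x | forall t, x < p t].
Proof.
have [h1|/existsNP[s /negP]] := pselect (forall t, q t < x); first by constructor 2.
rewrite -leNgt => xs.
have [h2|/existsNP[r /negP]] := pselect (forall t, x < p t); first by constructor 3.
rewrite -leNgt => rx; constructor 1.
pose S := [set t | p t <= x].
have Sub : ubound S s.
  by move=> t; rewrite /S/= leNgt => tx; rewrite leNgt; apply/negP => /(fib_lt pq); lra.
have hS : has_sup S by split; [exists r|exists s].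
have supS t : S t -> t <= sup S by apply: ub_le_sup; exists s.
exists (sup S); rewrite /covers !leNgt; apply/andP; split; apply/negP.
  move=> /(fib_left pq)[t tS xt].
  have [u Su] := @sup_adherent _ S (sup S - t) (ltac:(lra)) hS.
  rewrite opprB addrC subrK => /plt; move: Su; rewrite /S/=; lra.
move=> /(fib_right pq)[t tS xt]; have /supS : S t by have := ple t; rewrite /S/=; lra.
lra.
Qed.

(** Only the endpoints of fibres, and points outside the union of the fibres,
    remain after the open fibres are removed. *)
Definition ends : set R := [set x | F x /\ forall t, ~ (p t < x < q t)].

Lemma closed_ends : closed ends.
Proof.
apply: gap_closed => x /not_andP[Fx|].
  by have [e e0 he] := closed_gap cF Fx; exists e => // s /he Fs [].
move=> /existsNP[t /contrapT/andP[tx xt]].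
exists (Num.min (x - p t) (q t - x)); first by rewrite lt_min !subr_gt0 tx.
move=> s; rewrite lt_min => /andP[s1 s2] [_ /(_ t)]; apply; move: s1 s2.
by rewrite !ltr_distl; lra.
Qed.

Lemma ends_p t : ends (p t).
Proof.
split=> // s /andP[st ts].
by have [/(fib_lt pq)|/(fib_lt pq)|E] := ltgtP s t; [|have := ple t|move: st; rewrite E]; lra.
Qed.

Lemma ends_q t : ends (q t).
Proof.
split=> // s /andP[st ts].
by have [/(fib_lt pq)|/(fib_lt pq)|E] := ltgtP s t; [have := ple t| |move: ts; rewrite E]; lra.
Qed.

Lemma ends_covers t x : ends x -> covers t x -> x = p t \/ x = q t.
Proof.
move=> [_ /(_ t) h] /andP[]; rewrite le_eqVlt => /orP[/eqP->|tx]; first by left.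
by rewrite le_eqVlt => /orP[/eqP->|xt]; [right|exfalso; apply: h; rewrite tx].
Qed.

Definition base x : R := xget 0 [set t | covers t x].

Lemma baseE t x : covers t x -> base x = t.
Proof.
move=> tx; rewrite /base; case: xgetP => [s _ sx|/(_ t)//].
exact: covers_uniq sx tx.
Qed.

(** At a nondegenerate fibre both halves of [p t] carry the left value at [t]
    and both halves of [q t] the right value. *)
Definition half t x (i : bool) : bool := if p t < q t then x == q t else i.

Definition pull (f : R * bool -> R) : R * bool -> R := fun z =>
  if `[< ends z.1 /\ exists t, covers t z.1 >]
  then f (base z.1, half (base z.1) z.1 z.2) else 0.

Lemma pullE f t x i : ends x -> covers t x -> pull f (x, i) = f (t, half t x i).
Proof.
move=> ex tx; rewrite /pull/= asboolT ?(baseE tx)//; by split => //; exists t.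
Qed.

Lemma pullE0 f x i : (forall t, ~~ covers t x) -> pull f (x, i) = 0.
Proof.
move=> tx; rewrite /pull/= asboolF// => -[_ [t]]; exact/negP/tx.
Qed.

Lemma pull_close f x j (e c : R) : 0 < e ->
  (`|c| <= e \/ exists t, covers t x) ->
  (forall t j', covers t x -> `|f (t, j') - c| <= e) ->
  ends x -> `|pull f (x, j) - c| <= e.
Proof.
move=> e0 c0 h ex; have [[t tx]|nc] := pselect (exists t, covers t x).
  by rewrite (pullE _ _ ex tx); exact: h.
have nc' t : ~~ covers t x by apply/negP => tx; apply: nc; exists t.
by case: c0 => // c0; rewrite pullE0// sub0r normrN.
Qed.

Lemma pull_dmem f : dmem setT B f -> dmem ends A (pull f).
Proof.
move=> [_ [C C0 f2] f3 f4 f5]; split.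
- by move=> x i ex; rewrite /pull/= asboolF// => -[].
- by exists C => // -[x i]; rewrite /pull; case: ifP => // _; rewrite normr0.
- move=> x Ax; have [[ex [t tx]]|h] := pselect (ends x /\ exists t, covers t x); last first.
    by rewrite /pull/= asboolF.
  rewrite !(pullE _ _ ex tx) /half; case: ifPn => // pqt.
  apply: f3 => /BE[|]; first exact/negP.
  have E : p t = x.
    by apply/eqP; rewrite eq_le; move: tx pqt; rewrite /covers -leNgt => /andP[? ?] ?; lra.
  by rewrite E.
- move=> x i e ex e0; have [[t tx]|xhi|xlo] := covers_cases x.
  + rewrite (pullE _ _ ex tx).
    have [s ts hs] := f4 t (half t x i) e Logic.I e0.
    have [pqt|] := ltP (p t) (q t); last first.
      move=> qp; have Ep : x = p t by move: tx; rewrite /covers; lra.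
      have Eq : x = q t by have := ple t; lra.
      have Ei : half t x i = i by rewrite /half ltNge qp.
      rewrite Ei in ts hs *; exists (if i then p s else q s).
        by move: ts; rewrite /side; case: (i) => /(fib_lt pq); lra.
      move=> y j ey bs; apply: pull_close => //.
        right; have [//|h|h] := covers_cases y.
          by move: bs; rewrite /between /side; case: (i) => /andP[? ?];
            [have := h s|have := h t]; have := ple s; have := ple t; lra.
        by move: bs; rewrite /between /side; case: (i) => /andP[? ?];
          [have := h t|have := h s]; have := ple s; have := ple t; lra.
      move=> u j' /andP[u1 u2]; apply: hs => //; move: bs; rewrite /between /side.
      case: (i) => /andP[b1 b2]; apply/andP; split; rewrite ltNge; apply/negP => h.
      * by have := fib_qle h; lra.
      * by have := fib_ple h; lra.
      * by have := fib_ple h; lra.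
      * by have := fib_qle h; lra.
    have Eh : half t x i = (x == q t) by rewrite /half pqt.
    rewrite Eh in ts hs *.
    have [/eqP xi|xi] := boolP ((x == q t) == i); last first.
      exists (if i then q t else p t).
        have [Ex|Ex] := ends_covers ex tx.
          move: xi; rewrite Ex /side (lt_eqF pqt).
          by case: (i).
        by move: xi; rewrite Ex /side eqxx; case: (i).
      move=> y j [_ /(_ t) ey] bs; exfalso; apply: ey.
      have [Ex|Ex] := ends_covers ex tx; move: xi bs; rewrite Ex /between /side.
        by rewrite (lt_eqF pqt); case: (i) => // _ /andP[-> ->].
      by rewrite eqxx; case: (i) => // _ /andP[-> ->].
    rewrite xi in ts hs *.
    have Ex : x = if i then q t else p t.
      have [Ex|Ex] := ends_covers ex tx.
        by rewrite -xi Ex (lt_eqF pqt).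
      by rewrite -xi Ex eqxx.
    exists (if i then p s else q s).
      by move: ts; rewrite Ex /side; case: (i) => /(fib_lt pq).
    move=> y j ey bs; apply: pull_close => //.
      right; have [//|h|h] := covers_cases y.
        by move: bs; rewrite Ex /between /side; case: (i) => /andP[? ?];
          [have := h s|have := h t]; have := ple s; have := ple t; lra.
      by move: bs; rewrite Ex /between /side; case: (i) => /andP[? ?];
        [have := h t|have := h s]; have := ple s; have := ple t; lra.
    move=> u j' /andP[u1 u2]; apply: hs => //; move: bs; rewrite Ex /between /side.
    case: (i) => /andP[b1 b2]; apply/andP; split; rewrite ltNge; apply/negP => h.
    * by have := fib_qle h; lra.
    * by have := fib_ple h; lra.
    * by have := fib_ple h; lra.
    * by have := fib_qle h; lra.
  + have x0 : forall t, ~~ covers t x.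
      by move=> t; apply/negP => /andP[_]; have := xhi t; lra.
    have [C' hC'] := f5 _ e0; rewrite (pullE0 f i x0).
    exists (if i then x + 1 else q (`|C'| + 1)); first by rewrite /side; case: (i); rewrite ?ltrDl.
    move=> y j ey bs; apply: pull_close => //; first by left; rewrite normr0 ltW.
    move=> t j' /andP[t1 t2]; rewrite subr0; apply: hC'.
    move: bs; rewrite /between /side; case: (i) => /andP[b1 b2].
      by have := xhi t; lra.
    have : `|C'| + 1 < t by rewrite ltNge; apply/negP => /fib_qle; lra.
    by have := ler_norm C'; have := ler_norm t; lra.
  + have x0 : forall t, ~~ covers t x.
      by move=> t; apply/negP => /andP[+ _]; have := xlo t; lra.
    have [C' hC'] := f5 _ e0; rewrite (pullE0 f i x0).
    exists (if i then p (- (`|C'| + 1)) else x - 1); first by rewrite /side; case: (i); rewrite ?gtrBl.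
    move=> y j ey bs; apply: pull_close => //; first by left; rewrite normr0 ltW.
    move=> t j' /andP[t1 t2]; rewrite subr0; apply: hC'.
    move: bs; rewrite /between /side; case: (i) => /andP[b1 b2]; last first.
      by have := xlo t; lra.
    have : t < - (`|C'| + 1) by rewrite ltNge; apply/negP => /fib_ple; lra.
    by have := ler_norm C'; have := ler_norm (- t); rewrite normrN; lra.
- move=> e e0; have [C' hC'] := f5 _ e0.
  exists (Num.max `|p (- `|C'|)| `|q `|C'| |) => x i; rewrite gt_max => /andP[x1 x2].
  have [[ex [t tx]]|h] := pselect (ends x /\ exists t, covers t x); last first.
    by rewrite /pull/= asboolF// normr0 ltW.
  rewrite (pullE _ _ ex tx); apply: hC'; apply: le_lt_trans (ler_norm _) _.
  rewrite ltNge; apply/negP; rewrite ler_norml => /andP[/fib_ple h1 /fib_qle h2].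
  move: tx => /andP[t1 t2]; move: x1 x2 (ler_norm (q `|C'|)) (ler_norm (- p (- `|C'|))).
  by have [x0|x0] := leP 0 x; rewrite normrN ?(ger0_norm x0) ?(ltr0_norm x0); lra.
Qed.

(** The values at the two ends of the union of the fibres, which have to be
    subtracted to make a pulled back function vanish at infinity. *)
Definition hi_end (h : R * bool -> R) : R :=
  if `[< has_ubound (range p) >] then h (sup (range p), false) else 0.
Definition lo_end (h : R * bool -> R) : R :=
  if `[< has_lbound (range p) >] then h (inf (range p), true) else 0.

Lemma hi_end_lim h (e : R) : dmem F A h -> 0 < e ->
  exists r, forall t i, r < t -> `|h (if i then q t else p t, i) - hi_end h| <= e.
Proof.
move=> [h1 h2 h3 h4 h5] e0; rewrite /hi_end; case: asboolP => [ub|nub].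
  have hS : has_sup (range p) by split => //; exists (p 0), 0.
  have supS t : p t <= sup (range p) by apply: ub_le_sup => //; exists t.
  have FS : F (sup (range p)).
    apply: contrapT => /(closed_gap cF)[d d0 hd].
    have [_ [t _ <-] td] := sup_adherent d0 hS.
    by apply: (hd (p t)) => //; have := supS t; rewrite ltr_distl; lra.
  have [y yS hy] := h4 _ false e FS e0.
  have [_ [r _ <-]] := @sup_adherent _ (range p) (sup (range p) - y) (ltac:(rewrite subr_gt0; exact: yS)) hS.
  rewrite opprB addrC subrK => yr; exists r => t i rt; apply: hy.
    by case: (i).
  have h0 : t < t + 1 by rewrite ltrDl.
  have := plt rt; have := fib_lt pq h0; have := supS (t + 1); have := ple t.
  by move=> ? ? ? ?; rewrite /between /side; case: (i); apply/andP; split; lra.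
have [C hC] := h5 _ e0.
have [r Cr] : exists r, `|C| < p r.
  apply: contrapT => no; apply: nub; exists `|C| => _ [r _ <-].
  by rewrite leNgt; apply/negP => Cr; apply: no; exists r.
exists r => t i rt; rewrite subr0; apply: hC.
have := plt rt; have := ple t; have := ler_norm C; have := ler_norm (if i then q t else p t).
by case: (i); lra.
Qed.

Lemma lo_end_lim h (e : R) : dmem F A h -> 0 < e ->
  exists r, forall t i, t < r -> `|h (if i then q t else p t, i) - lo_end h| <= e.
Proof.
move=> [h1 h2 h3 h4 h5] e0; rewrite /lo_end; case: asboolP => [lb|nlb].
  have hS : has_inf (range p) by split => //; exists (p 0), 0.
  have infS t : inf (range p) <= p t by apply: ge_inf => //; exists t.
  have FS : F (inf (range p)).
    apply: contrapT => /(closed_gap cF)[d d0 hd].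
    have [_ [t _ <-] td] := inf_adherent d0 hS.
    by apply: (hd (p t)) => //; have := infS t; rewrite ltr_distl; lra.
  have [y yS hy] := h4 _ true e FS e0.
  have [_ [r _ <-]] := @inf_adherent _ (range p) (y - inf (range p)) (ltac:(rewrite subr_gt0; exact: yS)) hS.
  rewrite addrC subrK => yr; exists r => t i rt; apply: hy.
    by case: (i).
  have h0 : t - 1 < t by rewrite gtrBl.
  have := fib_lt pq rt; have := plt h0; have := infS (t - 1); have := ple t.
  by move=> ? ? ? ?; rewrite /between /side; case: (i); apply/andP; split; lra.
have [C hC] := h5 _ e0.
have [r Cr] : exists r, p r < - `|C|.
  apply: contrapT => no; apply: nlb; exists (- `|C|) => _ [r _ <-].
  by rewrite leNgt; apply/negP => Cr; apply: no; exists r.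
exists r => t i rt; rewrite subr0; apply: hC.
have := fib_lt pq rt; have := ple t; have := ler_norm C.
have := ler_norm (- if i then q t else p t); rewrite normrN.
by case: (i); lra.
Qed.

Definition below t (i : bool) : bool := (t < t0) || ((t == t0) && ~~ i).

(** The correction is a step function; its jump is at the split point [t0]. *)
Definition push (h : R * bool -> R) : R * bool -> R := fun z =>
  h (if z.2 then q z.1 else p z.1, z.2) -
  (if below z.1 z.2 then lo_end h else hi_end h).

Lemma push_dmem h : dmem F A h -> dmem setT B (push h).
Proof.
move=> hF; have [h1 [C C0 h2] h3 h4 h5] := hF.
have hiC : `|hi_end h| <= C by rewrite /hi_end; case: ifP => // _; rewrite normr0.
have loC : `|lo_end h| <= C by rewrite /lo_end; case: ifP => // _; rewrite normr0.
split.
- by move=> t i /(_ Logic.I).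
- exists (C + C); first exact: addr_ge0.
  move=> [t i]; apply: le_trans (ler_normB _ _) _; rewrite lerD//=; by case: ifP.
- move=> t Bt; have Et : p t = q t.
    apply/eqP; rewrite eq_le ple leNgt; apply/negP => pqt; apply: Bt; apply/BE; by left.
  have tt0 : t == t0 = false by apply/eqP => E; apply: Bt; rewrite E.
  rewrite /push/= /below tt0 -Et h3// => At; apply: Bt; apply/BE; by right.
- move=> t i e _ e0.
  have [y ty hy] := h4 (if i then q t else p t) i e (ltac:(by case: (i))) e0.
  have [s ts hs] : exists2 s, side i t s & forall r j, between i t r s ->
      between i (if i then q t else p t) (if j then q r else p r) y.
    move: ty; rewrite /between /side; case: (i).
      move=> /(fib_right pq)[s ts sy]; exists s => // r j /andP[tr rs].
      have := fib_lt pq tr; have := qlt rs; have := ple r.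
      by move=> ? ? ?; apply/andP; case: j; split; lra.
    move=> /(fib_left pq)[s ts sy]; exists s => // r j /andP[rt sr].
    have := fib_lt pq rt; have := plt sr; have := ple r.
    by move=> ? ? ?; apply/andP; case: j; split; lra.
  have [s' ts' hs'] : exists2 s, side i t s & forall r j, between i t r s -> below r j = below t i.
    rewrite /between /side /below; case: (i) => /=.
      have [tt0|tt0] := ltP t t0.
        by exists t0 => // r j /andP[_ ->].
      exists (t + 1); first by rewrite ltrDl.
      move=> r j /andP[tr _]; have t0r : t0 < r by lra.
      by rewrite (lt_gtF t0r) (gt_eqF t0r) andbF.
    rewrite andbT; have [tt0|tt0] := leP t t0.
      exists (t - 1); first by rewrite gtrBl.
      move=> r j /andP[rt _]; have -> : r < t0 by lra.
      by move: tt0; rewrite le_eqVlt orbC => ->.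
    exists t0 => // r j /andP[_ tr].
    by rewrite (lt_gtF tr) (gt_eqF tr) (lt_gtF tt0) (gt_eqF tt0).
  have [u tu hu] := side_meet ts ts'; exists u => // r j _ /hu[/(hs _ j) b1 /(hs' _ j) b2].
  rewrite /push/= b2.
  rewrite (_ : _ - _ - (_ - _) = h (if j then q r else p r, j) - h (if i then q t else p t, i)); last by ring.
  by apply: hy b1; case: (j).
- move=> e e0; have [r1 hr1] := hi_end_lim hF e0; have [r2 hr2] := lo_end_lim hF e0.
  exists (Num.max `|t0| (Num.max `|r1| `|r2|)) => t i; rewrite !gt_max => /and3P[b1 b2 b3].
  rewrite /push/= /below; have [tpos|tneg] := leP 0 t.
    move: b1 b2 b3; rewrite (ger0_norm tpos) => b1 b2 b3.
    have tt0 : t0 < t by apply: le_lt_trans (ler_norm _) b1.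
    rewrite ltNge (ltW tt0) gt_eqF//=; apply: hr1; exact: le_lt_trans (ler_norm _) b2.
  move: b1 b2 b3; rewrite (ltr0_norm tneg) => b1 b2 b3.
  have -> : t < t0 by have := ler_norm (- t0); rewrite normrN; lra.
  by apply: hr2; have := ler_norm (- r2); rewrite normrN; lra.
Qed.

(** A function on the base line is pulled back to the endpoints of the fibres and
    interpolated inside the fibres.  It is recovered at the left and right halves
    of [t] from the values at [p t] and [q t]. *)
Lemma complemented_pullback : complemented (dspace setT B) (dspace F A).
Proof.
have cE : closed ends := closed_ends.
have EF : ends `<=` F by move=> x [].
apply: (complemented_trans (W := dspace ends A)); last exact: complemented_closed.
pose X (h : R * bool -> R) := res F (interp ends h).
have oX : oper (V := dspace ends A) (W := dspace F A) X.
  exact: oper_comp (interp_oper A cE) (res_oper A (@subsetT _ F)).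
have XE h x i : ends x -> X h (x, i) = h (x, i).
  by move=> ex; rewrite /X resE ?interpE//; [left|exact: EF].
have oP : oper (V := dspace F A) (W := dspace setT B) push.
  split; first exact: push_dmem.
    move=> a f g _ _; apply/funext => z; rewrite /push /lincomb /hi_end /lo_end.
    by do ! case: ifP => _; ring.
  exists 2 => // h C _ C0 hC z; rewrite /push; apply: le_trans (ler_normB _ _) _.
  rewrite mulrDl mul1r lerD//; case: ifP => _; rewrite /hi_end /lo_end; case: ifP => _ //;
    by rewrite normr0.
exists pull, (push \o X); split.
- split; first exact: pull_dmem.
    move=> a f g _ _; apply/funext => z; rewrite /pull /lincomb.
    by case: ifP => // _; ring.
  exists 1 => // f C _ C0 fC z; rewrite mul1r /pull; case: ifP => // _.
  by rewrite normr0.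
- exact: oper_comp oX oP.
- move=> f fB; apply/funext => -[t i]; rewrite /push/=.
  have Z1 : hi_end (X (pull f)) = 0.
    rewrite /hi_end; case: asboolP => // ub.
    have supS t' : p t' <= sup (range p) by apply: ub_le_sup => //; exists t'.
    have E t' : q t' < sup (range p).
      by have h : t' < t' + 1 by [rewrite ltrDl]; have := fib_lt pq h; have := supS (t' + 1); lra.
    have hS : has_sup (range p) by split => //; exists (p 0), 0.
    have FS : F (sup (range p)).
      apply: contrapT => /(closed_gap cF)[d d0 hd].
      have [_ [r _ <-] td] := sup_adherent d0 hS.
      by apply: (hd (p r)) => //; have := supS r; rewrite ltr_distl; lra.
    rewrite XE; last by split => // t' /andP[_]; have := E t'; lra.
    by apply: pullE0 => t'; apply/negP => /andP[_]; have := E t'; lra.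
  have Z2 : lo_end (X (pull f)) = 0.
    rewrite /lo_end; case: asboolP => // lb.
    have infS t' : inf (range p) <= p t' by apply: ge_inf => //; exists t'.
    have E t' : inf (range p) < p t'.
      have h : t' - 1 < t' by rewrite gtrBl.
      by have := plt h; have := infS (t' - 1); lra.
    have hS : has_inf (range p) by split => //; exists (p 0), 0.
    have FS : F (inf (range p)).
      apply: contrapT => /(closed_gap cF)[d d0 hd].
      have [_ [r _ <-] td] := inf_adherent d0 hS.
      by apply: (hd (p r)) => //; have := infS r; rewrite ltr_distl; lra.
    rewrite XE; last by split => // t' /andP[+ _]; have := E t'; lra.
    by apply: pullE0 => t'; apply/negP => /andP[+ _]; have := E t'; lra.
  rewrite Z1 Z2 if_same subr0 XE; last by case: (i); [exact: ends_q|exact: ends_p].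
  rewrite (@pullE f t); last 2 first.
  + by case: (i); [exact: ends_q|exact: ends_p].
  + by rewrite /covers; case: (i); rewrite lexx ple.
  by rewrite /half; case: ltP => // pqt; case: (i); rewrite ?eqxx// lt_eqF.
Qed.

End pullback.

(** * Averaging from the Cantor set to the interval *)

Section cantor_codes.
Context {R : realType}.
Implicit Types (b c : nat -> bool) (r : R).

Definition agree n b c := forall i, (i < n)%N -> b i = c i.

Lemma agree_le n m b c : (m <= n)%N -> agree n b c -> agree m b c.
Proof. by move=> mn bc i im; apply: bc; exact: leq_trans im mn. Qed.

Lemma agree_sym n b c : agree n b c -> agree n c b.
Proof. by move=> bc i /bc. Qed.

Lemma agree_trans n b c d : agree n b c -> agree n c d -> agree n b d.
Proof. by move=> bc cd i ni; rewrite bc// cd. Qed.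

Lemma first_diff n b c : ~ agree n b c ->
  exists k, [/\ (k < n)%N, agree k b c & b k <> c k].
Proof.
move=> h.
have ex : exists k, (k < n)%N && (b k != c k).
  apply: contrapT => nex; apply: h => i ni; apply: contrapT => /eqP bc.
  by apply: nex; exists i; rewrite ni.
exists (ex_minn ex); case: ex_minnP => k /andP[kn /eqP bc] mink; split => //.
move=> i ik; apply: contrapT => /eqP bci.
by have := mink i; rewrite (ltn_trans ik kn) bci leqNgt ik => /(_ isT).
Qed.

(** A code selects at each step the left or the right of two subintervals of
    relative length [r] that share their outer endpoints with the current
    interval, whose left end is [low r b n] and whose length is [r ^+ n].  For
    [r = 1/3] the two are disjoint and for [r = 2/3] they overlap. *)
Fixpoint low r b n : R :=
  if n is m.+1 then low r b m + (if b m then (1 - r) * r ^+ m else 0) else 0.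

Lemma low_agree r n b c : agree n b c -> low r b n = low r c n.
Proof.
elim: n => //= n IH bc; rewrite IH ?bc// => i ni; exact/bc/ltnW.
Qed.

Definition point r b : R := sup (range (low r b)).

Section ratio.
Variable r : R.
Hypothesis r01 : 0 < r < 1.

Let rn0 n : 0 < r ^+ n.
Proof. by rewrite exprn_gt0; case/andP: r01. Qed.

Let step0 n b : 0 <= (if b n then (1 - r) * r ^+ n else 0).
Proof. by case: ifP => // _; apply: mulr_ge0; [have := r01; lra|exact: ltW]. Qed.

Lemma low_le n m b : (n <= m)%N -> low r b n <= low r b m.
Proof.
move=> /subnK <-; elim: (m - n)%N => // k IH; rewrite addSn /=.
by apply: le_trans IH _; rewrite lerDl; exact: step0.
Qed.

Lemma low_up n m b : (n <= m)%N -> low r b m + r ^+ m <= low r b n + r ^+ n.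
Proof.
move=> /subnK <-; elim: (m - n)%N => // k IH; rewrite addSn /=.
have h : r * r ^+ (k + n) <= r ^+ (k + n) by apply: ler_piMl; [exact: ltW|have := r01; lra].
rewrite exprS; case: ifP => _; have := rn0 (k + n); lra.
Qed.

Lemma pointP n b : low r b n <= point r b <= low r b n + r ^+ n.
Proof.
have ub : ubound (range (low r b)) (low r b n + r ^+ n).
  move=> _ [m _ <-]; have [nm|/ltnW mn] := leqP n m.
    by have := low_up b nm; have := rn0 m; lra.
  by have := low_le b mn; have := rn0 n; lra.
apply/andP; split; first by apply: ub_le_sup; [exists (low r b n + r ^+ n)|exists n].
by apply: ge_sup => //; exists (low r b 0), 0%N.
Qed.

Lemma point_agree n b c : agree n b c -> `|point r b - point r c| <= r ^+ n.
Proof.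
move=> bc; have := pointP n b; have := pointP n c; rewrite (low_agree r bc).
by rewrite ler_distl; lra.
Qed.

Lemma point01 b : 0 <= point r b <= 1.
Proof. by have := pointP 0 b; rewrite /= expr0 add0r. Qed.

Lemma pow_small (e : R) : 0 < e -> exists n, r ^+ n < e.
Proof.
move=> e0; have : (r ^+ n @[n --> \oo] --> (0 : R))%classic.
  by apply: cvg_expr; rewrite ger0_norm; have := r01; lra.
move=> /cvgrPdist_lt/(_ _ e0)[n _ /(_ n (leqnn n))]/=.
by rewrite sub0r normrN ger0_norm ?(ltW (rn0 n))//; exists n.
Qed.

Lemma pow_le n m : (n <= m)%N -> r ^+ m <= r ^+ n.
Proof. by move=> nm; apply: ler_wiXn2l => //; have := r01; lra. Qed.

End ratio.

(** ** The Cantor set *)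

Local Notation third := (3^-1 : R).
Let third01 : 0 < third < 1. Proof. by lra. Qed.

Lemma third_split n b c : agree n b c -> b n = false -> c n = true ->
  [/\ point third b <= low third b n + third ^+ n.+1,
      low third b n + 2 * third ^+ n.+1 <= point third c
    & point third b < point third c].
Proof.
move=> bc bn cn; have := pointP third01 n.+1 b; have := pointP third01 n.+1 c.
rewrite /= bn cn (low_agree third bc) exprS.
have : 0 < third ^+ n by rewrite exprn_gt0//; have := third01; lra.
by move=> ? ? ?; split; lra.
Qed.

Lemma third_sep n b c : `|point third b - point third c| < third ^+ n -> agree n b c.
Proof.
move=> d; apply: contrapT => /first_diff[k [kn bc bck]].
have := pow_le third01 kn; move: d; rewrite ltr_distl.
have p0 : 0 < third ^+ k.+1 by rewrite exprn_gt0//; have := third01; lra.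
case: (boolP (b k)) bck => bk; case: (boolP (c k)) => // ck _.
  have [h1 h2 _] := third_split (agree_sym bc) (negbTE ck) bk; lra.
have [h1 h2 _] := third_split bc (negbTE bk) ck; lra.
Qed.

Lemma third_inj : injective (point third).
Proof.
move=> b c E; apply/funext => i; apply: (@third_sep i.+1) => //.
by rewrite E subrr normr0 exprn_gt0//; have := third01; lra.
Qed.

Definition cantor_pt b : R := 2 + point third b.
Definition cantor_set : set R := range cantor_pt.

Lemma cantor_set23 t : cantor_set t -> 2 <= t <= 3.
Proof. by move=> [b _ <-]; rewrite /cantor_pt; have := point01 third01 b; lra. Qed.

(** The codes of points converging to [t] stabilize, by the separation of points
    whose codes differ, and the limit code is a code of [t]. *)
Lemma closed_cantor_set : closed cantor_set.
Proof.
apply: gap_closed => t Nt; apply: contrapT => ng; apply: Nt.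
have ap e : 0 < e -> exists b, `|cantor_pt b - t| < e.
  move=> e0; apply: contrapT => nex; apply: ng; exists e => // s st [b _ E].
  by apply: nex; exists b; rewrite E.
have p0 n : 0 < third ^+ n / 2 by rewrite divr_gt0// exprn_gt0//; have := third01; lra.
have [c hc] := choice (fun n => ap _ (p0 n)).
have cc n m : (n <= m)%N -> agree n (c n) (c m).
  move=> nm; apply: third_sep.
  have := hc n; have := hc m; have := pow_le third01 nm.
  by rewrite /cantor_pt !ltr_distl; lra.
pose b i := c i.+1 i; exists b => //; apply/eqP; rewrite -subr_eq0 -normr_le0.
have bc n : agree n b (c n) by move=> i ni; exact: (cc _ _ ni).
rewrite leNgt; apply/negP => d0.
have [n hn] := pow_small third01 (divr_gt0 d0 (ltr0n R 2)).
move: d0 hn; have := point_agree third01 (bc n); have := hc n.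
have := ler_distD (cantor_pt (c n)) (cantor_pt b) t.
have -> : cantor_pt b - cantor_pt (c n) = point third b - point third (c n).
  by rewrite /cantor_pt; ring.
by move=> *; lra.
Qed.

Definition nowhere_dense_line (A : set R) : Prop :=
  forall u v, u < v -> exists u' v', [/\ u <= u', u' < v', v' <= v &
    forall t, u' < t < v' -> ~ A t].

(** While a gap is sought, the set may be assumed to meet every subinterval. *)
Lemma nwd_by_contra (A : set R) :
  (forall u v, u < v ->
    (forall u' v', u <= u' -> u' < v' -> v' <= v -> exists2 t, u' < t < v' & A t) ->
    exists u' v', [/\ u <= u', u' < v', v' <= v & forall t, u' < t < v' -> ~ A t]) ->
  nowhere_dense_line A.
Proof.
move=> h u v uv; apply: contrapT => no.
have [|u' [v' [h1 h2 h3 h4]]] := h u v uv.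
  move=> u' v' h1 h2 h3; apply: contrapT => no'; apply: no.
  by exists u', v'; split => // t tu At; apply: no'; exists t.
by apply: no; exists u', v'.
Qed.

(** Two points of the set in an interval have codes with a first difference, and
    the middle third removed at that step lies between them. *)
Lemma nwd_cantor_set : nowhere_dense_line cantor_set.
Proof.
apply: nwd_by_contra => u v uv dense.
have [x1 /andP[b1 b2] [b _ E1]] := dense u ((u + v) / 2) (lexx _) (ltac:(lra)) (ltac:(lra)).
have [x2 /andP[c1 c2] [c _ E2]] := dense ((u + v) / 2) v (ltac:(lra)) (ltac:(lra)) (lexx _).
rewrite -{}E1 in b1 b2; rewrite -{}E2 in c1 c2; rewrite /cantor_pt in b1 b2 c1 c2.
have [n nbc] : exists n, ~ agree n b c.
  apply: contrapT => no; have E : b = c; last by move: b2; rewrite E; lra.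
  by apply/funext => i; apply: contrapT => bci; apply: no; exists i.+1 => /(_ i (ltnSn i)).
have [k [_ bc bck]] := first_diff nbc.
have [bk ck] : b k = false /\ c k = true.
  case: (boolP (b k)) bck => bk; case: (boolP (c k)) => // ck _.
  by have [_ _] := third_split (agree_sym bc) (negbTE ck) bk; lra.
have [h1 h2 h3] := third_split bc bk ck.
have p0 : 0 < third ^+ k.+1 by rewrite exprn_gt0//; have := third01; lra.
exists (2 + low third b k + third ^+ k.+1), (2 + low third b k + 2 * third ^+ k.+1).
split; [lra|lra|lra|].
move=> x dt [d _ E]; rewrite -{}E /cantor_pt in dt.
have [bd|/first_diff[j [jk bd bdj]]] := pselect (agree k b d).
  case: (boolP (d k)) => dk.
    by have [g1 g2 _] := third_split bd bk dk; lra.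
  have dc : agree k d c by exact: agree_trans (agree_sym bd) bc.
  have [g1 g2 _] := third_split dc (negbTE dk) ck.
  by rewrite (low_agree third (agree_sym bd)) in g1; lra.
have q0 : 0 < third ^+ j by rewrite exprn_gt0//; have := third01; lra.
case: (boolP (b j)) bdj => bj; case: (boolP (d j)) => // dj _.
  have [g1 _ _] := third_split (agree_sym bd) (negbTE dj) bj.
  have := low_le third01 b jk; rewrite /= bj (low_agree third bd).
  by move: g1 dt; rewrite exprS; lra.
have [_ g2 _] := third_split bd (negbTE bj) dj.
have := low_up third01 b jk; rewrite /= (negbTE bj) addr0.
have : third ^+ k.+1 <= third ^+ k by exact: pow_le.
have : third ^+ k = 3 * third ^+ k.+1 by rewrite exprS; lra.
by move: g2 dt; rewrite exprS; lra.
Qed.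

End cantor_codes.

Section averaging.
Context {R : realType}.
Implicit Types (b c : nat -> bool) (H : (nat -> bool) -> R).

(** Without split points, the two one-sided limits at [t] are both the common
    value of the two halves of [t]. *)
Lemma dmem_eps (N : set R) f t (e : R) : dmem N set0 f -> N t -> 0 < e ->
  exists2 d : R, 0 < d & forall s i j, N s -> `|s - t| < d -> `|f (s, i) - f (t, j)| <= e.
Proof.
move=> [f1 f2 f3 f4 f5] Nt e0.
have [y1 ty1 h1] := f4 t true e Nt e0; have [y2 ty2 h2] := f4 t false e Nt e0.
rewrite /between /side in ty1 h1 ty2 h2.
have ff s i j : f (s, i) = f (s, j).
  by have := f3 s id; case: i; case: j.
exists (Num.min (y1 - t) (t - y2)); first by rewrite lt_min !subr_gt0 ty1.
move=> s i j Ns; rewrite lt_min !ltr_distl => /andP[s1 s2].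
have [st|st|<-] := ltgtP s t; last by rewrite (ff s i j) subrr normr0 ltW.
- by rewrite (ff t j false); apply: h2 => //; rewrite st; lra.
- by rewrite (ff t j true); apply: h1 => //; rewrite st; lra.
Qed.

Lemma eps_dmem (N : set R) (g : R -> R) (a b C : R) :
  (forall t, N t -> a <= t <= b) -> (forall t, `|g t| <= C) ->
  (forall t, ~ N t -> g t = 0) ->
  (forall t (e : R), N t -> 0 < e -> exists2 d : R, 0 < d &
     forall s, N s -> `|s - t| < d -> `|g s - g t| <= e) ->
  dmem N set0 (fun z => g z.1).
Proof.
move=> Nab gC g0 ge; split => //=.
- by move=> t i /g0.
- exists C => [|[t i]]; last exact: gC.
  exact: le_trans (normr_ge0 _) (gC a).
- move=> t i e Nt e0; have [d d0 h] := ge t e Nt e0.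
  by have [y ty hy] := side_ball i t d0; exists y => // s _ Ns /hy; exact: h.
- move=> e e0; exists (`|a| + `|b|) => t i Bt; rewrite g0 ?normr0 ?ltW// => /Nab tab.
  have := ler_norm (- a); have := ler_norm b; rewrite normrN => h1 h2.
  have := normr_ge0 a; have := normr_ge0 b => h3 h4; move: Bt.
  by have [t0|t0] := leP 0 t; rewrite ?(ger0_norm t0) ?(ltr0_norm t0); lra.
Qed.

Local Notation third := (3^-1 : R).
Let third01 : 0 < third < 1. Proof. by lra. Qed.
Local Notation two3 := (2 / 3 : R).
Let two301 : 0 < two3 < 1. Proof. by lra. Qed.

(** ** Expected values *)

(** The identity clamped to the unit interval, written with absolute values to
    make its continuity evident. *)
Definition ramp (x : R) : R := (1 + `|x| - `|x - 1|) / 2.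

(** A point [t] of the interval of length [l] starting at [a] is sent to the
    right subinterval with probability [weight a l t]: surely to the left one in
    the first third, surely to the right one in the last third. *)
Definition weight (a l t : R) : R := ramp ((t - a - l / 3) / (l / 3)).

Lemma rampP x : [/\ 0 <= ramp x <= 1, x <= 0 -> ramp x = 0 & 1 <= x -> ramp x = 1].
Proof.
by rewrite /ramp; case: (ger0P x) => x0; case: (ger0P (x - 1)) => x1; split; lra.
Qed.

Lemma weightP (a l t : R) : 0 < l ->
  [/\ 0 <= weight a l t <= 1, t <= a + l / 3 -> weight a l t = 0 &
      a + 2 * l / 3 <= t -> weight a l t = 1].
Proof.
move=> l0; have [h1 h2 h3] := rampP ((t - a - l / 3) / (l / 3)).
have l3 : 0 < l / 3 by lra.
split => // ht; [apply: h2|apply: h3].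
  by rewrite ler_pdivrMr//; lra.
by rewrite ler_pdivlMr//; lra.
Qed.

Lemma weight_continuous a l : continuous (weight a l).
Proof.
move=> t; rewrite /weight /ramp.
have cx : ((s - a - l / 3) / (l / 3)) @[s --> t] --> (t - a - l / 3) / (l / 3).
  apply: cvgM; last exact: cvg_cst.
  apply: cvgB; last exact: cvg_cst.
  by apply: cvgB; [exact: cvg_id|exact: cvg_cst].
apply: cvgM; last exact: cvg_cst.
apply: cvgB; first by apply: cvgD; [exact: cvg_cst|exact: cvg_norm].
by apply: cvg_norm; apply: cvgB => //; exact: cvg_cst.
Qed.

Definition set_bit b k (x : bool) : nat -> bool := fun i => if i == k then x else b i.

Lemma set_bit_agree b k x : agree k b (set_bit b k x).
Proof. by move=> i ik; rewrite /set_bit ltn_eqF. Qed.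
Arguments set_bit_agree : clear implicits.

Definition node_weight b k t : R := weight (low two3 b k) (two3 ^+ k) t.

(** [expect H n b k t] is the expectation of [H] when the first [k] choices are
    those of [b], the next [n] are random and all others are those of [b]. *)
Fixpoint expect H n b k t : R :=
  if n is m.+1 then
    (1 - node_weight b k t) * expect H m (set_bit b k false) k.+1 t +
    node_weight b k t * expect H m (set_bit b k true) k.+1 t
  else H b.

Let pw k : 0 < two3 ^+ k. Proof. by rewrite exprn_gt0; case/andP: two301. Qed.

Let nw01 b k t : 0 <= node_weight b k t <= 1.
Proof. by have [] := weightP (low two3 b k) t (pw k). Qed.

Lemma average_close (w x y x' y' e : R) : 0 <= w <= 1 ->
  `|x - x'| <= e -> `|y - y'| <= e ->
  `|((1 - w) * x + w * y) - ((1 - w) * x' + w * y')| <= e.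
Proof.
move=> /andP[w0 w1] h1 h2.
rewrite (_ : _ - _ = (1 - w) * (x - x') + w * (y - y')); last by ring.
have v0 : 0 <= 1 - w by lra.
apply: le_trans (ler_normD _ _) _; rewrite !normrM (ger0_norm w0) (ger0_norm v0).
have -> : e = (1 - w) * e + w * e by ring.
by rewrite lerD// ler_wpM2l.
Qed.

Lemma expect_close H (c e : R) n b k t :
  (forall b', agree k b b' -> `|H b' - c| <= e) -> `|expect H n b k t - c| <= e.
Proof.
elim: n b k => [|n IH] b k h /=; first exact: h.
rewrite -[c in X in `|X|](_ : (1 - node_weight b k t) * c + node_weight b k t * c = c); last by ring.
have IH' x : `|expect H n (set_bit b k x) k.+1 t - c| <= e.
  apply: IH => b' bb'; apply: h.
  exact: (agree_trans (set_bit_agree b k x) (agree_le (leqnSn k) bb')).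
by apply: average_close => //; exact: nw01.
Qed.

Lemma expect_cauchy H (e : R) N n m b k t :
  (forall b' c', agree N b' c' -> `|H b' - H c'| <= e) -> (N <= k + n)%N ->
  `|expect H (n + m) b k t - expect H n b k t| <= e.
Proof.
move=> h; elim: n b k => [|n IH] b k Nk.
  apply: expect_close => b' bb'; apply: h.
  by rewrite addn0 in Nk; exact: agree_le Nk (agree_sym bb').
by rewrite addSn /=; apply: average_close; [exact: nw01|apply: IH; rewrite addSnnS..].
Qed.

(** Every code [b'] reached with positive probability satisfies
    [low b' j <= t <= low b' j + (2/3) ^+ j] at all the stages [j] passed, because
    the weights vanish outside the subintervals.  So the points averaged are all
    close to [t]. *)
Lemma expect_retract (f : R -> R) (d e : R) n b k t :
  (forall x, `|x - t| <= d -> 0 <= x <= 1 -> `|f x - f t| <= e) -> 0 <= e ->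
  low two3 b k <= t <= low two3 b k + two3 ^+ k -> two3 ^+ (k + n) <= d ->
  `|expect (f \o point two3) n b k t - f t| <= e.
Proof.
move=> h e0; elim: n b k => [|n IH] b k tb kd.
  apply: h; last exact: point01.
  rewrite addn0 in kd; have := pointP two301 k b.
  by rewrite ler_distl; lra.
rewrite /= -[f t](_ : (1 - node_weight b k t) * f t + node_weight b k t * f t = f t); last by ring.
have [_ w0 w1] := weightP (low two3 b k) t (pw k).
have E0 : low two3 (set_bit b k false) k.+1 = low two3 b k.
  by rewrite /= /set_bit eqxx addr0; apply/low_agree/agree_sym/set_bit_agree.
have E1 : low two3 (set_bit b k true) k.+1 = low two3 b k + two3 ^+ k / 3.
  rewrite /= {2}/set_bit eqxx -(low_agree _ (set_bit_agree b k true)).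
  by congr (_ + _); rewrite mulrC; congr (_ * _); lra.
have kd' : two3 ^+ (k.+1 + n) <= d by rewrite addSnnS.
have ES : two3 ^+ k.+1 = 2 * two3 ^+ k / 3 by rewrite exprS; lra.
have pk := pw k.
have [t1|t1] := leP t (low two3 b k + two3 ^+ k / 3).
  rewrite /node_weight (w0 t1) subr0 !mul1r !mul0r !addr0; apply: IH => //.
  by rewrite E0 ES; move: tb; lra.
have [t2|t2] := leP (low two3 b k + 2 * two3 ^+ k / 3) t.
  rewrite /node_weight (w1 t2) subrr !mul1r !mul0r !add0r; apply: IH => //.
  by rewrite E1 ES; move: tb; lra.
apply: average_close; [exact: nw01|apply: IH => //..].
  by rewrite E0 ES; move: tb; lra.
by rewrite E1 ES; move: tb; lra.
Qed.

Lemma expect_lin a H H' n b k t :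
  expect (fun b => a * H b + H' b) n b k t = a * expect H n b k t + expect H' n b k t.
Proof. by elim: n b k => [|n IH] b k //=; rewrite !IH; ring. Qed.

Lemma expect_continuous H n b k : continuous (expect H n b k).
Proof.
elim: n b k => [|n IH] b k t /=; first exact: cvg_cst.
have cw : node_weight b k s @[s --> t] --> node_weight b k t by exact: weight_continuous.
by apply: cvgD; apply: cvgM => //; [apply: cvgB => //; exact: cvg_cst|exact: IH|exact: IH].
Qed.

(** ** Uniform continuity on the Cantor set *)

(** If uniform continuity failed, it would fail on one half of the set, then on
    one quarter, and so on, contradicting continuity at the point selected by
    these choices. *)
Lemma cantor_uniform (f : R * bool -> R) (e : R) : dmem cantor_set set0 f -> 0 < e ->
  exists N, forall b c, agree N b c ->
    `|f (cantor_pt b, false) - f (cantor_pt c, false)| <= e.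
Proof.
move=> fC e0; pose H b := f (cantor_pt b, false).
pose bad k b := forall N, exists c c', [/\ agree k b c, agree k b c', agree N c c' &
  e < `|H c - H c'|].
apply: contrapT => no.
have bad0 : bad 0%N (fun=> false).
  move=> N; apply: contrapT => h; apply: no; exists N => b c bc.
  by rewrite leNgt; apply/negP => bce; apply: h; exists b, c.
have step k b : bad k b -> exists x, bad k.+1 (set_bit b k x).
  move=> bb; apply: contrapT => /forallNP nb.
  have [/existsNP[N0 h0] /existsNP[N1 h1]] := (nb false, nb true).
  have [c [c' [bc bc' cc' ecc']]] := bb (maxn k.+1 (maxn N0 N1)).
  have ck : c k = c' k by apply: cc'; rewrite leq_max ltnSn.
  have ag d : agree k b d -> agree k.+1 (set_bit b k (d k)) d.
    move=> bd i; rewrite ltnS leq_eqVlt /set_bit => /orP[/eqP->|ik]; first by rewrite eqxx.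
    by rewrite ltn_eqF//; exact: bd.
  have a1 := ag _ bc; have a2 := ag _ bc'; rewrite -ck in a2.
  have le0 : (N0 <= maxn k.+1 (maxn N0 N1))%N by rewrite !leq_max leqnn orbT.
  have le1 : (N1 <= maxn k.+1 (maxn N0 N1))%N by rewrite !leq_max leqnn !orbT.
  case: (c k) a1 a2 => a1 a2.
    by apply: h1; exists c, c'; split => //; exact: agree_le cc'.
  by apply: h0; exists c, c'; split => //; exact: agree_le cc'.
have [ch hch] : {ch : nat -> (nat -> bool) -> bool &
    forall k b, bad k b -> bad k.+1 (set_bit b k (ch k b))}.
  apply/cid; have := choice (fun kb : nat * (nat -> bool) =>
    _ : exists x, bad kb.1 kb.2 -> bad kb.1.+1 (set_bit kb.2 kb.1 x)).
  case=> [[k b]|g hg]; last by exists (fun k b => g (k, b)) => k b; exact: (hg (k, b)).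
  have [/step[x hx]|nb] := pselect (bad k b); first by exists x.
  by exists true => /nb.
pose path := fix path k := if k is m.+1 then set_bit (path m) m (ch m (path m)) else fun=> false.
have pbad k : bad k (path k) by elim: k => //= k /hch.
have pag k m : (k <= m)%N -> agree k (path k) (path m).
  move=> /subnK <-; elim: (m - k)%N => // j IH; rewrite addSn /=.
  by apply: agree_trans IH (agree_le _ (set_bit_agree _ _ _)); rewrite leq_addl.
pose b i := path i.+1 i.
have bp k : agree k b (path k) by move=> i ik; exact: (pag _ _ ik).
have [d d0 hd] := dmem_eps fC (ex_intro2 _ _ b Logic.I erefl : cantor_set (cantor_pt b)) (ltac:(lra) : 0 < e / 2).
have [N Nd] := pow_small third01 d0.
have near c : agree N b c -> `|H c - H b| <= e / 2.
  move=> bc; apply: hd; first by exists c.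
  rewrite (_ : _ - _ = point third c - point third b); last by rewrite /cantor_pt; ring.
  by apply: le_lt_trans Nd; apply: point_agree => //; exact: agree_sym.
have [c [c' [bc bc' _]]] := pbad N N.
have := near c (agree_trans (bp N) bc); have := near c' (agree_trans (bp N) bc').
have := ler_distD (H b) (H c) (H c'); rewrite (distrC (H b)) => ? ? ?.
by rewrite ltNge => /negP; apply; lra.
Qed.

End averaging.

Section miljutin.
Context {R : realType}.
Implicit Types (b c : nat -> bool).

Local Notation third := (3^-1 : R).
Let third01 : 0 < third < 1. Proof. by lra. Qed.
Local Notation two3 := (2 / 3 : R).
Let two301 : 0 < two3 < 1. Proof. by lra. Qed.

Lemma cauchy_limit (u : nat -> R) :
  (forall e : R, 0 < e -> exists N, forall m, `|u (N + m)%N - u N| <= e) ->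
  exists L, forall (e : R) N, (forall m, `|u (N + m)%N - u N| <= e) -> `|u N - L| <= e.
Proof.
move=> cu; have /cvg_ex[L uL] : cvg (u @ \oo).
  apply: cauchy_cvg; apply: cauchy_exP => e e0.
  have e2 : 0 < e / 2 by lra.
  have [N hN] := cu _ e2; exists (u N), N => // n /= Nn.
  rewrite /ball/= -(subnKC Nn) distrC; apply: le_lt_trans (hN _) _; lra.
exists L => e N hN; rewrite leNgt; apply/negP => he.
have d0 : 0 < `|u N - L| - e by lra.
move/cvgrPdist_lt: uL => /(_ _ d0)[M _ /(_ (N + M)%N)] /=.
rewrite leq_addl => /(_ isT); have := hN M.
by have := ler_distD (u (N + M)%N) (u N) L; rewrite (distrC (u N) (u _)) (distrC L (u _)); lra.
Qed.

Let b0 : nat -> bool := fun=> false.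

Definition is_average (h : R * bool -> R) t (L : R) : Prop :=
  forall e : R, 0 < e -> exists N, forall n, (N <= n)%N ->
    `|expect (fun b => h (cantor_pt b, false)) n b0 0 t - L| <= e.

Lemma is_average_uniq h t L L' : is_average h t L -> is_average h t L' -> L = L'.
Proof.
move=> h1 h2; apply/eqP; rewrite -subr_eq0 -normr_le0 leNgt; apply/negP => d0.
have e0 : 0 < `|L - L'| / 3 by lra.
have [N1 g1] := h1 _ e0; have [N2 g2] := h2 _ e0.
have := g1 _ (leq_maxl N1 N2); have := g2 _ (leq_maxr N1 N2).
by set u := expect _ _ _ _ _; have := ler_distD u L L'; rewrite (distrC L u); lra.
Qed.

Definition average (h : R * bool -> R) t : R := xget 0 (is_average h t).

Lemma averageE h t L : is_average h t L -> average h t = L.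
Proof.
move=> hL; rewrite /average; case: xgetP => [L' _ hL'|/(_ L)//].
exact: is_average_uniq hL' hL.
Qed.

(** The rate of convergence does not depend on [t], which makes the average
    continuous in [t]. *)
Lemma averageP h t : dmem cantor_set set0 h -> forall (e : R) N,
  (forall b c, agree N b c -> `|h (cantor_pt b, false) - h (cantor_pt c, false)| <= e) ->
  forall n, (N <= n)%N ->
  `|expect (fun b => h (cantor_pt b, false)) n b0 0 t - average h t| <= e.
Proof.
move=> hC; pose u n := expect (fun b => h (cantor_pt b, false)) n b0 0 t.
have uc (e : R) N : (forall b c, agree N b c ->
    `|h (cantor_pt b, false) - h (cantor_pt c, false)| <= e) ->
    forall n, (N <= n)%N -> forall m, `|u (n + m)%N - u n| <= e.
  by move=> hN n Nn m; apply: (expect_cauchy (N := N)) => //.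
have [L hL] : exists L, forall (e : R) N, (forall m, `|u (N + m)%N - u N| <= e) -> `|u N - L| <= e.
  apply: cauchy_limit => e e0; have [N hN] := cantor_uniform hC e0.
  by exists N => m; exact: uc hN _ _ _.
have -> : average h t = L.
  apply: averageE => e e0; have [N hN] := cantor_uniform hC e0.
  by exists N => n Nn; apply: hL; exact: uc hN _ Nn.
by move=> e N hN n Nn; apply: hL; exact: uc hN _ Nn.
Qed.

Lemma is_averageP h t : dmem cantor_set set0 h -> is_average h t (average h t).
Proof.
move=> hC e e0; have [N hN] := cantor_uniform hC e0; exists N.
exact: averageP hN.
Qed.

Lemma average_bound h t (C : R) : dmem cantor_set set0 h ->
  (forall z, `|h z| <= C) -> `|average h t| <= C.
Proof.
move=> hC hb; rewrite leNgt; apply/negP => Ca.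
have [N /(_ N (leqnn N))] := is_averageP t hC (ltac:(lra) : 0 < (`|average h t| - C) / 2).
have := expect_close (H := fun b => h (cantor_pt b, false)) (c := 0) N (k := 0) t
  (fun b' (_ : agree 0 b0 b') => (ltac:(rewrite subr0; exact: hb) : `|h (cantor_pt b', false) - 0| <= C)).
set u := expect _ _ _ _ _; rewrite subr0.
by have := ler_distD u (average h t) 0; rewrite !subr0 (distrC _ u); lra.
Qed.

Definition unit_itv : set R := [set t | 0 <= t <= 1].

Definition average_fun (h : R * bool -> R) : R * bool -> R := fun z =>
  if (0 <= z.1 <= 1) then average h z.1 else 0.

Lemma average_fun_dmem h : dmem cantor_set set0 h -> dmem unit_itv set0 (average_fun h).
Proof.
move=> hC; have [C C0 hb] := d_bdd hC.
apply: (@eps_dmem _ unit_itv (fun t => average_fun h (t, false)) 0 1 C) => //.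
- move=> t; rewrite /average_fun /=; case: ifP => _; last by rewrite normr0.
  exact: average_bound.
- by move=> t; rewrite /average_fun /unit_itv /=; case: ifP.
- move=> t e t01 e0; have [N hN] := cantor_uniform hC (ltac:(lra) : 0 < e / 3).
  have /cvgrPdist_lt/(_ (e / 3) (ltac:(lra)))/nbhs_ballP[d d0 hd] :=
    @expect_continuous R (fun b => h (cantor_pt b, false)) N b0 0 t.
  exists d => // s s01 st; rewrite /average_fun /= (_ : 0 <= s <= 1 = true) // (_ : 0 <= t <= 1 = true) //.
  have h1 := averageP s hC hN (leqnn N); have h2 := averageP t hC hN (leqnn N).
  have hs : ball t d s by rewrite /ball/= distrC.
  have {}h3 := hd s hs; rewrite /= in h3.
  set u := expect _ _ _ _ s in h1 h3; set v := expect _ _ _ _ t in h2 h3.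
  have := ler_distD u (average h s) (average h t); have := ler_distD v u (average h t).
  by rewrite (distrC _ u) (distrC u v); lra.
Qed.

Definition code (s : R) : nat -> bool := xget b0 [set b | cantor_pt b = s].

Lemma codeK b : code (cantor_pt b) = b.
Proof.
rewrite /code; case: xgetP => [c _ /= E|/(_ b)/(_ erefl)//]; rewrite /cantor_pt in E; apply: (@third_inj R).
by move: E => /addrI.
Qed.

Definition spread_cantor (f : R * bool -> R) : R * bool -> R := fun z =>
  if `[< cantor_set z.1 >] then f (point two3 (code z.1), false) else 0.

Lemma spread_cantorE f b i : spread_cantor f (cantor_pt b, i) = f (point two3 b, false).
Proof. by rewrite /spread_cantor /= asboolT ?codeK//; exists b. Qed.

Lemma spread_cantor_dmem f : dmem unit_itv set0 f -> dmem cantor_set set0 (spread_cantor f).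
Proof.
move=> fI; have [C C0 fb] := d_bdd fI.
apply: (@eps_dmem _ cantor_set (fun t => spread_cantor f (t, false)) 2 3 C) => //.
- exact: cantor_set23.
- by move=> t; rewrite /spread_cantor /=; case: ifP => // _; rewrite normr0.
- by move=> t h; rewrite /spread_cantor /= asboolF.
- move=> _ e [b _ <-] e0.
  have [d d0 hd] := dmem_eps fI (point01 two301 b : unit_itv _) e0.
  have [N hN] := pow_small two301 d0.
  exists (third ^+ N); first by rewrite exprn_gt0//; case/andP: third01.
  move=> _ [c _ <-] cb; rewrite !spread_cantorE; apply: hd.
    exact: (point01 two301 c).
  apply: le_lt_trans hN; apply: point_agree => //; apply: third_sep; move: cb.
  have -> : cantor_pt c - cantor_pt b = point third c - point third b.
    by rewrite /cantor_pt; ring.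
  by move=> cb; exact: cb.
Qed.

(** The average over the codes of [t] of a function that depends only on the
    point coded is its value at [t]. *)
Lemma average_spread f : dmem unit_itv set0 f -> average_fun (spread_cantor f) = f.
Proof.
move=> fI; apply/funext => -[t i]; rewrite /average_fun /=; case: ifPn => t01; last first.
  by rewrite (d_off fI)// /unit_itv /=; exact/negP.
have -> : f (t, i) = f (t, false) by case: i => //; rewrite (d_unsplit fI).
apply: averageE => e e0.
have [d d0 hd] := dmem_eps fI (t01 : unit_itv t) e0.
have [N hN] := pow_small two301 d0; exists N => n Nn.
have -> : (fun b => spread_cantor f (cantor_pt b, false)) = (fun x => f (x, false)) \o point two3.
  by apply/funext => b; rewrite spread_cantorE.
apply: (@expect_retract R (fun x => f (x, false)) (two3 ^+ N)).
- by move=> x xt x01; apply: hd => //; exact: le_lt_trans xt hN.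
- exact: ltW.
- by rewrite /= expr0 add0r.
- by rewrite add0n; exact: pow_le.
Qed.

(** Milutin's lemma: composition with the continuous surjection of the Cantor set
    onto the interval has the averaging operator as a left inverse. *)
Lemma complemented_unit_itv :
  complemented (dspace unit_itv set0) (dspace (@cantor_set R) set0).
Proof.
exists spread_cantor, average_fun; split.
- split; first exact: spread_cantor_dmem.
    move=> a f g _ _; apply/funext => z; rewrite /spread_cantor /lincomb.
    by case: ifP => // _; ring.
  exists 1 => // f C _ C0 fC z; rewrite mul1r /spread_cantor.
  by case: ifP => // _; rewrite normr0.
- split; first exact: average_fun_dmem.
    move=> a f g fC gC; apply/funext => -[t i]; rewrite /average_fun /lincomb /=.
    case: ifP => _; last by ring.
    apply: averageE => e e0; have [d d0 small] := lincomb_small a e0.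
    have [N1 h1] := is_averageP t fC d0; have [N2 h2] := is_averageP t gC d0.
    exists (maxn N1 N2) => n; rewrite geq_max => /andP[n1 n2].
    rewrite (expect_lin a (fun b => f (cantor_pt b, false)) (fun b => g (cantor_pt b, false))).
    have := small _ _ (h1 n n1) (h2 n n2).
    by set u := expect _ _ _ _ _; set v := expect _ _ _ _ _; congr (`|_| <= e); ring.
  exists 1 => // f C fC C0 fb [t i]; rewrite mul1r /average_fun; case: ifP => _.
    exact: average_bound.
  by rewrite normr0.
- by move=> f; exact: average_spread.
Qed.

End miljutin.

(** * Order embeddings without gaps *)

Section bisection.
Context {R : realType} {disp : Order.disp_t} {T : orderType disp}.
Variable en : nat -> T.

Definition pred_index n : option 'I_n :=
  [pick i : 'I_n | (en i < en n)%O && [forall k : 'I_n, (en k < en n)%O ==> (en k <= en i)%O]].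
Definition succ_index n : option 'I_n :=
  [pick i : 'I_n | (en n < en i)%O && [forall k : 'I_n, (en n < en k)%O ==> (en i <= en k)%O]].

(** A new element goes to the middle between its neighbours among the elements
    already placed; beyond the extreme elements, values move in unit steps. *)
Definition place (v : nat -> R) n : R :=
  if [pick i : 'I_n | en i == en n] is Some i then v i else
  match pred_index n, succ_index n with
  | Some i, Some j => (v i + v j) / 2
  | Some i, None => v i + 1
  | None, Some j => v j - 1
  | None, None => 0
  end.

Fixpoint places n : nat -> R :=
  if n is m.+1 then fun i => if i == m then place (places m) m else places m i
  else fun=> 0.

Definition embed n : R := places n.+1 n.

Lemma places_embed n i : (i < n)%N -> places n i = embed i.
Proof.
elim: n => // n IH; rewrite ltnS leq_eqVlt /= => /orP[/eqP->|ik].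
  by rewrite /embed /= eqxx.
by rewrite ltn_eqF// IH.
Qed.

Lemma embedE n : embed n = place embed n.
Proof.
rewrite {1}/embed /= eqxx /place.
case: pickP => [i _|_]; first exact: places_embed.
by case: (pred_index n) => [i|]; case: (succ_index n) => [j|] //; rewrite !places_embed.
Qed.

Lemma pred_indexP n : match pred_index n with
  | Some l => (en l < en n)%O /\ forall k, (k < n)%N -> (en k < en n)%O -> (en k <= en l)%O
  | None => forall k, (k < n)%N -> (en n <= en k)%O end.
Proof.
rewrite /pred_index; case: pickP => [l /andP[ln /forallP h]|h].
  by split => // k kn; have /implyP := h (Ordinal kn).
move=> k kn; rewrite leNgt; apply/negP => kn'.
have := h [arg max_(i > Ordinal kn | (en i < en n)%O) en i]%O.
case: arg_maxP => //= i ->/= mx /negP; apply; apply/forallP => j; apply/implyP.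
exact: mx.
Qed.

Lemma succ_indexP n : match succ_index n with
  | Some l => (en n < en l)%O /\ forall k, (k < n)%N -> (en n < en k)%O -> (en l <= en k)%O
  | None => forall k, (k < n)%N -> (en k <= en n)%O end.
Proof.
rewrite /succ_index; case: pickP => [l /andP[ln /forallP h]|h].
  by split => // k kn; have /implyP := h (Ordinal kn).
move=> k kn; rewrite leNgt; apply/negP => kn'.
have := h [arg min_(i < Ordinal kn | (en n < en i)%O) en i]%O.
case: arg_minP => //= i ->/= mx /negP; apply; apply/forallP => j; apply/implyP.
exact: mx.
Qed.

Lemma embed_mono_eq i j :
  ((en i < en j)%O -> embed i < embed j) /\ (en i = en j -> embed i = embed j).
Proof.
suff h n : forall i j, (i < n)%N -> (j < n)%N ->
    ((en i < en j)%O -> embed i < embed j) /\ (en i = en j -> embed i = embed j).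
  by apply: (h (maxn i j).+1); rewrite ltnS ?leq_maxl ?leq_maxr.
elim: n => // n IH {}i {}j.
have le k l : (k < n)%N -> (l < n)%N -> (en k <= en l)%O -> embed k <= embed l.
  move=> kn ln; rewrite le_eqVlt => /orP[/eqP E|kl].
    by rewrite (IH k l kn ln).2.
  by apply/ltW; rewrite (IH k l kn ln).1.
have key k : (k < n)%N -> [/\ (en k < en n)%O -> embed k < embed n,
    (en n < en k)%O -> embed n < embed k & en k = en n -> embed k = embed n].
  move=> kn; rewrite [embed n]embedE /place; case: pickP => [l /eqP ln|ne].
    have [h1 h2] := IH k l kn (ltn_ord l); have [h3 h4] := IH l k (ltn_ord l) kn.
    by rewrite -ln; split.
  have nek : en k <> en n by move=> E; have := ne (Ordinal kn); rewrite /= E eqxx.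
  have := pred_indexP n; have := succ_indexP n.
  case: (pred_index n) => [l|]; case: (succ_index n) => [u|].
  - move=> [un umin] [ln lmax].
    have lu : embed l < embed u by apply: (IH l u _ _).1 => //; exact: lt_trans un.
    split => // h; first by have := le k l kn (ltn_ord l) (lmax k kn h); lra.
    by have := le u k (ltn_ord u) kn (umin k kn h); lra.
  - move=> umin [ln lmax]; split => // h.
      by have := le k l kn (ltn_ord l) (lmax k kn h); lra.
    by have := umin k kn; rewrite leNgt h.
  - move=> [un umin] lmax; split => // h.
      by have := lmax k kn; rewrite leNgt h.
    by have := le u k (ltn_ord u) kn (umin k kn h); lra.
  - move=> h1 h2; exfalso; apply: nek; apply/eqP; rewrite eq_le.
    by rewrite h1// h2.
rewrite ltnS leq_eqVlt => /orP[/eqP->|ik]; rewrite ltnS leq_eqVlt => /orP[/eqP->|jk].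
- by rewrite ltxx.
- by have [h1 h2 h3] := key j jk; split => // /esym/h3.
- by have [h1 h2 h3] := key i ik; split.
- exact: IH.
Qed.

Lemma embed_lt i j : (en i < en j)%O -> embed i < embed j.
Proof. by case: (embed_mono_eq i j). Qed.

Lemma embed_le i j : (en i <= en j)%O -> embed i <= embed j.
Proof.
rewrite le_eqVlt => /orP[/eqP|/embed_lt/ltW//].
by case: (embed_mono_eq i j) => _ h /h ->.
Qed.

Lemma embed_eq i j : en i = en j -> embed i = embed j.
Proof. by case: (embed_mono_eq i j). Qed.

Lemma embed_mid m l u : (l < m)%N -> (u < m)%N -> (en l < en m)%O -> (en m < en u)%O ->
  (forall k, (k < m)%N -> (en k <= en l)%O || (en u <= en k)%O) ->
  embed m = (embed l + embed u) / 2.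
Proof.
move=> lm um elm emu h; rewrite embedE /place; case: pickP => [k /eqP km|_].
  have := h k (ltn_ord k); rewrite km => /orP[/(lt_le_trans elm)|/(lt_le_trans emu)];
    by rewrite ltxx.
have := pred_indexP m; have := succ_indexP m.
case: (pred_index m) => [l'|]; last by move=> _ /(_ l lm); rewrite leNgt elm.
case: (succ_index m) => [u'|]; last by move=> /(_ u um); rewrite leNgt emu.
move=> [um' umin] [lm' lmax].
have -> : embed l' = embed l.
  apply: embed_eq; apply/eqP; rewrite eq_le lmax// andbT.
  by have /orP[//|/(lt_le_trans emu)/(lt_trans lm')] := h l' (ltn_ord l'); rewrite ltxx.
have -> // : embed u' = embed u.
apply: embed_eq; apply/eqP; rewrite eq_le umin//=.
by have /orP[/(lt_le_trans um')/(lt_trans elm)|//] := h u' (ltn_ord u'); rewrite ltxx.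
Qed.

Lemma embed_top m l : (l < m)%N -> (en l < en m)%O ->
  (forall k, (k < m)%N -> (en k <= en l)%O) -> embed m = embed l + 1.
Proof.
move=> lm elm h; rewrite embedE /place; case: pickP => [k /eqP km|_].
  by have := h k (ltn_ord k); rewrite km leNgt elm.
have := pred_indexP m; have := succ_indexP m.
case: (pred_index m) => [l'|]; last by move=> _ /(_ l lm); rewrite leNgt elm.
case: (succ_index m) => [u'|].
  by move=> [um' _] _; have := h u' (ltn_ord u'); rewrite leNgt (lt_trans elm um').
move=> _ [lm' lmax]; congr (_ + _); apply: embed_eq; apply/eqP.
by rewrite eq_le lmax// h.
Qed.

Lemma embed_bot m u : (u < m)%N -> (en m < en u)%O ->
  (forall k, (k < m)%N -> (en u <= en k)%O) -> embed m = embed u - 1.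
Proof.
move=> um emu h; rewrite embedE /place; case: pickP => [k /eqP km|_].
  by have := h k (ltn_ord k); rewrite km leNgt emu.
have := pred_indexP m; have := succ_indexP m.
case: (succ_index m) => [u'|]; last by move=> /(_ u um); rewrite leNgt emu.
case: (pred_index m) => [l'|].
  by move=> _ [lm' _]; have := h l' (ltn_ord l'); rewrite leNgt (lt_trans lm' emu).
move=> [um' umin] _; congr (_ - _); apply: embed_eq; apply/eqP.
by rewrite eq_le umin// h.
Qed.

(** Without a maximum, [L] has a first element [en m] exceeding those of its
    members placed before stage [n]; until then [en l] remains the greatest. *)
Lemma record_up (L : set T) n i0 : (i0 < n)%N -> L (en i0) ->
  (forall i, L (en i) -> exists2 j, L (en j) & (en i < en j)%O) ->
  exists l m, [/\ (l < m)%N, (n <= m)%N, L (en l) /\ L (en m), (en l < en m)%O &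
    forall k, (k < m)%N -> L (en k) -> (en k <= en l)%O].
Proof.
move=> i0n Li0 nomax.
have [l Ll lmax] : exists2 l : 'I_n, L (en l) & forall k : 'I_n, L (en k) -> (en k <= en l)%O.
  case: (@arg_maxP _ _ _ (Ordinal i0n) (fun i : 'I_n => `[< L (en i) >]) (fun i => en i)) => /=.
    exact/asboolP.
  by move=> l /asboolP Ll mx; exists l => // k Lk; apply: mx; exact/asboolP.
have ex : exists j, `[< L (en j) >] && (en l < en j)%O.
  by have [j Lj lj] := nomax l Ll; exists j; rewrite lj andbT; exact/asboolP.
case: (ex_minnP ex) => m /andP[/asboolP Lm lm] mmin.
have nm : (n <= m)%N.
  rewrite leqNgt; apply/negP => mn.
  by have := lmax (Ordinal mn) Lm; rewrite /= leNgt lm.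
exists l, m; split => //; first exact: leq_trans (ltn_ord l) nm.
move=> k km Lk; rewrite leNgt; apply/negP => lk.
by have := mmin k; rewrite lk andbT leqNgt km => h; have := h (asboolT Lk).
Qed.

Lemma record_down (L : set T) n i0 : (i0 < n)%N -> L (en i0) ->
  (forall i, L (en i) -> exists2 j, L (en j) & (en j < en i)%O) ->
  exists l m, [/\ (l < m)%N, (n <= m)%N, L (en l) /\ L (en m), (en m < en l)%O &
    forall k, (k < m)%N -> L (en k) -> (en l <= en k)%O].
Proof.
move=> i0n Li0 nomin.
have [l Ll lmin] : exists2 l : 'I_n, L (en l) & forall k : 'I_n, L (en k) -> (en l <= en k)%O.
  case: (@arg_minP _ _ _ (Ordinal i0n) (fun i : 'I_n => `[< L (en i) >]) (fun i => en i)) => /=.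
    exact/asboolP.
  by move=> l /asboolP Ll mx; exists l => // k Lk; apply: mx; exact/asboolP.
have ex : exists j, `[< L (en j) >] && (en j < en l)%O.
  by have [j Lj lj] := nomin l Ll; exists j; rewrite lj andbT; exact/asboolP.
case: (ex_minnP ex) => m /andP[/asboolP Lm lm] mmin.
have nm : (n <= m)%N.
  rewrite leqNgt; apply/negP => mn.
  by have := lmin (Ordinal mn) Lm; rewrite /= leNgt lm.
exists l, m; split => //; first exact: leq_trans (ltn_ord l) nm.
move=> k km Lk; rewrite leNgt; apply/negP => lk.
by have := mmin k; rewrite lk andbT leqNgt km => h; have := h (asboolT Lk).
Qed.

Lemma best_below (L : set T) n i0 : (i0 < n)%N -> L (en i0) ->
  exists2 l, (l < n)%N /\ L (en l) & forall k, (k < n)%N -> L (en k) -> (en k <= en l)%O.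
Proof.
move=> i0n Li0.
case: (@arg_maxP _ _ _ (Ordinal i0n) (fun i : 'I_n => `[< L (en i) >]) (fun i => en i)) => /=.
  exact/asboolP.
move=> l /asboolP Ll mx; exists l => // k kn Lk; apply: (mx (Ordinal kn)); exact/asboolP.
Qed.

Lemma best_above (L : set T) n i0 : (i0 < n)%N -> L (en i0) ->
  exists2 l, (l < n)%N /\ L (en l) & forall k, (k < n)%N -> L (en k) -> (en l <= en k)%O.
Proof.
move=> i0n Li0.
case: (@arg_minP _ _ _ (Ordinal i0n) (fun i : 'I_n => `[< L (en i) >]) (fun i => en i)) => /=.
  exact/asboolP.
move=> l /asboolP Ll mx; exists l => // k kn Lk; apply: (mx (Ordinal kn)); exact/asboolP.
Qed.

(** Each new record of a lower set without maximum (or of an upper set without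
    minimum) halves the distance between the two sides of the cut. *)
Lemma embed_no_gap (L : set T) i0 j0 :
  (forall x y, L y -> (x <= y)%O -> L x) -> L (en i0) -> ~ L (en j0) ->
  (forall i, L (en i) -> exists2 j, L (en j) & (en i < en j)%O) \/
  (forall i, ~ L (en i) -> exists2 j, ~ L (en j) & (en j < en i)%O) ->
  forall e : R, 0 < e -> exists i j, [/\ L (en i), ~ L (en j) & embed j - embed i < e].
Proof.
move=> Ldown Li0 Lj0 open.
have LnL x y : L x -> ~ L y -> (x < y)%O.
  by move=> Lx Ly; rewrite ltNge; apply/negP => /(Ldown _ _ Lx).
have halve i j : L (en i) -> ~ L (en j) -> exists i' j', [/\ L (en i'), ~ L (en j') &
    embed j' - embed i' <= (embed j - embed i) / 2].
  move=> Li Lj; pose n := (maxn i j).+1.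
  have jn : (j < n)%N by rewrite ltnS leq_maxr.
  have in_ : (i < n)%N by rewrite ltnS leq_maxl.
  case: open => [nomax|nomin].
    have [l [m [lm nm [Ll Lm] elm lmax]]] := record_up in_ Li nomax.
    have [u [um Lu] umin] := @best_above (~` L) m j (leq_trans jn nm) Lj.
    exists m, u; split => //.
    rewrite (@embed_mid m l u)//; last 2 first.
    - exact: LnL.
    - move=> k km; have [Lk|Lk] := pselect (L (en k)); first by rewrite lmax.
      by rewrite umin ?orbT.
    have := embed_le (lmax i (leq_trans in_ nm) Li).
    by have := embed_le (umin j (leq_trans jn nm) Lj); lra.
  have [u [m [um nm [Lu Lm] emu umin]]] := record_down (L := ~` L) jn Lj nomin.
  have [l [lm Ll] lmax] := @best_below L m i (leq_trans in_ nm) Li.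
  exists l, m; split => //.
  rewrite (@embed_mid m l u)//; last 2 first.
  - exact: LnL.
  - move=> k km; have [Lk|Lk] := pselect (L (en k)); first by rewrite lmax.
    by rewrite umin ?orbT.
  have := embed_le (lmax i (leq_trans in_ nm) Li).
  by have := embed_le (umin j (leq_trans jn nm) Lj); lra.
have iter k : exists i j, [/\ L (en i), ~ L (en j) &
    embed j - embed i <= (embed j0 - embed i0) * (2^-1) ^+ k].
  elim: k => [|k [i [j [Li Lj h]]]]; first by exists i0, j0; rewrite expr0 mulr1.
  have [i' [j' [Li' Lj' h']]] := halve i j Li Lj; exists i', j'; split => //.
  by rewrite exprS; lra.
move=> e e0; have w0 : 0 < embed j0 - embed i0 by rewrite subr_gt0; exact/embed_lt/LnL.
have [k hk] := pow_small (ltac:(lra) : 0 < (2^-1 : R) < 1) (divr_gt0 e0 w0).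
have [i [j [Li Lj h]]] := iter k; exists i, j; split => //.
by apply: le_lt_trans h _; rewrite mulrC -ltr_pdivlMr.
Qed.

(** Each new greatest element increases the greatest value by one. *)
Lemma embed_unbounded_up : (forall i, exists j, (en i < en j)%O) ->
  forall B : R, exists i, B < embed i.
Proof.
move=> nomax B.
have up k : exists i, embed 0 + k%:R <= embed i.
  elim: k => [|k [i hi]]; first by exists 0%N; rewrite addr0.
  have [|l [m [lm im _ elm lmax]]] := @record_up setT i.+1 i (ltnSn i) Logic.I.
    by move=> j _; have [j' jj'] := nomax j; exists j'.
  exists m; rewrite (@embed_top m l)//; last by move=> k' km; exact: lmax.
  have := embed_le (lmax i im Logic.I); rewrite -natr1; lra.
have [i hi] := up (Num.bound (B - embed 0)).
exists i; apply: lt_le_trans hi.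
have h : (Num.bound (B - embed 0))%:R > B - embed 0.
  have [b0|b0] := leP 0 (B - embed 0); first exact: archi_boundP.
  exact: lt_le_trans b0 _.
by move: h; lra.
Qed.

Lemma embed_unbounded_down : (forall i, exists j, (en j < en i)%O) ->
  forall B : R, exists i, embed i < B.
Proof.
move=> nomin B.
have down k : exists i, embed i <= embed 0 - k%:R.
  elim: k => [|k [i hi]]; first by exists 0%N; rewrite subr0.
  have [|l [m [lm im _ elm lmin]]] := @record_down setT i.+1 i (ltnSn i) Logic.I.
    by move=> j _; have [j' jj'] := nomin j; exists j'.
  exists m; rewrite (@embed_bot m l)//; last by move=> k' km; exact: lmin.
  have := embed_le (lmin i im Logic.I); rewrite -natr1; lra.
have [i hi] := down (Num.bound (embed 0 - B)).
exists i; apply: le_lt_trans hi _.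
have h : (Num.bound (embed 0 - B))%:R > embed 0 - B.
  have [b0|b0] := leP 0 (embed 0 - B); first exact: archi_boundP.
  exact: lt_le_trans b0 _.
by move: h; lra.
Qed.

End bisection.

(** * Sets of cardinality at most omega_1 *)

Section small_sets.

(** The sets of cardinality at most the least uncountable cardinal. *)
Definition small (T : Type) (A : set T) : Prop :=
  forall (U : Type) (S : set U), ~ countable S -> A #<= S.

Lemma card_le_inj (T U : Type) (A : set T) (S : set U) (f : T -> U) :
  (forall x, A x -> S (f x)) -> (forall x y, A x -> A y -> f x = f y -> x = y) ->
  A #<= S.
Proof.
move=> fS fI; have fi : {in A &, injective f}.
  by move=> x y; rewrite !inE; exact: fI.
rewrite -(card_le_eql (inj_card_eq fi)); apply: subset_card_le.
by move=> _ [x Ax <-]; exact: fS.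
Qed.

Lemma card_le_ex (T U : Type) (A : set T) (S : set U) (x0 : T) : A x0 -> A #<= S ->
  exists f : T -> U, (forall x, A x -> S (f x)) /\
    (forall x y, A x -> A y -> f x = f y -> x = y).
Proof.
move=> Ax0; elim/Ppointed: U => U in S *.
  by rewrite !emptyE => h; move: Ax0; rewrite h.
move=> /pcard_leP[f]; exists f; split; first by move=> x Ax; exact: funS.
by move=> x y Ax Ay; apply: (@inj _ _ _ f); rewrite inE.
Qed.

Lemma small_le (T U : Type) (A : set T) (B : set U) : A #<= B -> small B -> small A.
Proof. by move=> AB sB V S uS; exact: card_le_trans AB (sB _ _ uS). Qed.

Lemma small_sub (T : Type) (A B : set T) : A `<=` B -> small B -> small A.
Proof. by move=> AB; apply: small_le; exact: subset_card_le. Qed.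

Lemma small_countable (T : Type) (A : set T) : countable A -> small A.
Proof.
move=> cA U S uS; apply: card_le_trans cA _; apply/infiniteP.
by move=> fS; apply: uS; exact: finite_set_countable.
Qed.

Lemma countable_setU (T : Type) (A B : set T) :
  countable A -> countable B -> countable (A `|` B).
Proof.
move=> cA cB; rewrite -bigcup2E; by apply: bigcup_countable => // -[|[|n]].
Qed.

Lemma countable_sub (T : Type) (A B : set T) : A `<=` B -> countable B -> countable A.
Proof. by move=> /subset_card_le; exact: sub_countable. Qed.

(** An uncountable set remains uncountable after a countably infinite set has
    been removed, which makes room for the countable part. *)
Lemma small_setU_countable (T : Type) (A D : set T) :
  small A -> countable D -> small (A `|` D).
Proof.
move=> sA cD U S uS.
have /infiniteP/(card_le_ex (x0 := 0%N) (Logic.I : [set: nat] 0%N))[f [fS fI]] : infinite_set S.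
  by move=> fS; apply: uS; exact: finite_set_countable.
have uS' : ~ countable (S `\` range f).
  move=> c; apply: uS; apply: countable_sub (countable_setU c (_ : countable (range f))).
    by move=> x Sx; have [?|?] := pselect (range f x); [right|left].
  exact: card_image_le.
have [[x0 Ax0]|A0] := pselect (A !=set0); last first.
  apply: (small_countable _ uS); apply: countable_sub cD => x [Ax|//].
  by exfalso; apply: A0; exists x.
have [g [gS gI]] := card_le_ex Ax0 (sA _ _ uS').
have Ef : D #<= range f.
  by apply: card_le_trans cD _; apply: (card_le_inj (f := f)) => [n _|n m _ _]; [exists n|exact: fI].
have [[y0 Ey0]|E0] := pselect (D !=set0); last first.
  apply: (small_le _ sA uS); apply: subset_card_le => x [//|Ex].
  by exfalso; apply: E0; exists x.
have [h [hS hI]] := card_le_ex Ey0 Ef.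
apply: (card_le_inj (f := fun x => if `[< A x >] then g x else h x)).
  move=> x; case: asboolP => [Ax _|Ax [//|Ex]]; first by have [] := gS x Ax.
  by have [n _ <-] := hS x Ex; exact: fS.
move=> x y; case: asboolP => Ax; case: asboolP => Ay Ax' Ay'.
- exact: gI.
- by case: Ay' => // Ey E; exfalso; apply: (gS x Ax).2; rewrite E; exact: hS.
- by case: Ax' => // Ex E; exfalso; apply: (gS y Ay).2; rewrite -E; exact: hS.
- by case: Ax' => // Ex; case: Ay' => // Ey; exact: hI.
Qed.

End small_sets.

Section real_sets.
Context {R : realType}.
Implicit Types (A B C N : set R) (x y : R).

Definition inside A x y : set R := [set t | A t /\ x < t < y].

Lemma inside_open x y : open [set t : R | x < t < y].
Proof.
rewrite (_ : [set t | _] = `]x, y[%classic); first exact: itv_open.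
by apply/seteqP; split => t /=; rewrite in_itv.
Qed.

Lemma open_inside (U : set R) x : open U -> U x ->
  exists2 d : R, 0 < d & forall t, x - d < t < x + d -> U t.
Proof.
move=> oU Ux; have /nbhs_ballP[d d0 hd] : nbhs x U by exact: open_nbhs_nbhs.
by exists d => // t td; apply: hd; rewrite /ball/= distrC ltr_distl.
Qed.

Lemma omega1_inside B x y : omega1_dense B -> x < y -> ~ countable (inside B x y).
Proof.
move=> dB xy c; have [|u _] := dB _ (@inside_open x y).
  by exists ((x + y) / 2) => /=; lra.
by apply: u; apply: countable_sub c => t [].
Qed.

Lemma omega1_small B : omega1_dense B -> small B.
Proof.
move=> dB; have [|_ s] := dB setT (@openT _); first by exists 0.
by apply: small_sub s => t.
Qed.

Lemma uncountable_ex (T : Type) (A : set T) : ~ countable A -> exists z, A z.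
Proof.
move=> u; apply: contrapT => h; apply: u; rewrite (_ : A = set0)//.
by apply/seteqP; split => // x Ax; exfalso; apply: h; exists x.
Qed.

Lemma omega1_meets B x y : omega1_dense B -> x < y -> exists2 b, B b & x < b < y.
Proof.
by move=> dB xy; have [t [Bt xty]] := uncountable_ex (omega1_inside dB xy); exists t.
Qed.

(** An [omega1_dense] set has uncountably many points in each of the countably
    many intervals between integers, which leaves room for a sequence of small
    sets. *)
Lemma small_bigcup (T : Type) B (A : nat -> set T) : omega1_dense B ->
  (forall n, small (A n)) -> small (\bigcup_n A n).
Proof.
move=> dB sA; apply: small_le (omega1_small dB).
have [[x0 Ax0]|A0] := pselect ((\bigcup_n A n) !=set0); last first.
  rewrite (_ : \bigcup_n A n = set0) ?card_ge0//.
  by apply/seteqP; split => // x Ax; exfalso; apply: A0; exists x.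
have ex n : exists f : T -> R, (forall z, A n z -> inside B n%:R n.+1%:R (f z)) /\
    (forall z w, A n z -> A n w -> f z = f w -> z = w).
  have [[x Ax]|An0] := pselect (A n !=set0); last first.
    by exists (fun=> 0); split => [x Ax|x y Ax]; exfalso; apply: An0; exists x.
  apply: card_le_ex Ax _; apply: sA; apply: omega1_inside => //.
  by rewrite ltr_nat.
have [f hf] := choice ex.
pose lv z := xget 0%N [set n | A n z].
have lvP z : (\bigcup_n A n) z -> A (lv z) z.
  by move=> [n _ Anx]; rewrite /lv; case: xgetP => [m -> //|/(_ n)].
apply: (card_le_inj (f := fun z => f (lv z) z)).
  by move=> x /lvP Ax; have [] := (hf _).1 _ Ax.
move=> x y /lvP Ax /lvP Ay E.
have [_ /andP[x1 x2]] := (hf _).1 _ Ax; have [_ /andP[y1 y2]] := (hf _).1 _ Ay.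
have Elv : lv x = lv y.
  rewrite E in x1 x2; apply/eqP; rewrite eqn_leq.
  by have := lt_trans x1 y2; have := lt_trans y1 x2; rewrite !ltr_nat !ltnS => -> ->.
by rewrite -Elv in E Ay; exact: (hf _).2 E.
Qed.

Lemma small_image (T U : Type) (f : T -> U) (A : set T) : small A -> small (f @` A).
Proof. by apply: small_le; exact: card_image_le. Qed.

Lemma small_translates A B : omega1_dense B -> small A -> small (translates A).
Proof.
move=> dB sA.
apply: (@small_sub _ _ (\bigcup_n ((fun t => t + 4 * n%:R) @` A))).
  by move=> t [n Ant]; exists n => //; exists (t - 4 * n%:R) => //; rewrite subrK.
by apply: small_bigcup dB _ => n; exact: small_image.
Qed.

(** This yields an [omega1_dense] set with a prescribed trace [A] on [N]. *)
Lemma omega1_dense_fill N A B : closed N -> nowhere_dense_line N -> A `<=` N ->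
  small A -> omega1_dense B -> omega1_dense (A `|` (B `\` N)).
Proof.
move=> cN nN AN sA dB U oU [x Ux]; split.
  have [d d0 hd] := open_inside oU Ux.
  have [u [v [xu uv vx h]]] := nN (x - d) (x + d) (ltac:(lra)).
  move=> c; apply: (omega1_inside dB uv); apply: countable_sub c.
  move=> t [Bt tuv]; split; first by apply: hd; lra.
  by right; split => //; exact: h.
apply: (@small_sub _ _ (A `|` B)); first by move=> t [_ [At|[Bt _]]]; [left|right].
rewrite -bigcup2E; apply: (small_bigcup dB) => -[|[|n]] //=.
exact: omega1_small.
Qed.

(** ** Condensation points *)

(** The two-sided condensation points of [A] that lie in [A]. *)
Definition thick A : set R := [set a | [/\ A a,
  forall x, x < a -> ~ countable (inside A x a) &
  forall y, a < y -> ~ countable (inside A a y)]].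

(** For a rational [r], let [Z r] be the set of the points [a] having only
    countably many points of [A] between [r] and [a].  Each of them, except a
    possible greatest one, lies in a countable set of points of [A] between two
    rationals. *)
Lemma countable_thin_left A :
  countable [set a | A a /\ exists2 x, x < a & countable (inside A x a)].
Proof.
pose Z (r : rat) := [set a | [/\ A a, ratr r < a & countable (inside A (ratr r) a)]].
apply: (@countable_sub _ _ (\bigcup_r Z r)).
  move=> a [Aa [x /rat_in_itvoo[r /itvP h] c]]; exists r => //; split => //.
    by rewrite h.
  by apply: countable_sub c => t [At /andP[rt ta]]; split => //; rewrite ta (lt_trans _ rt)// h.
apply: bigcup_countable => // r _.
pose W (s : rat) := if `[< countable (inside A (ratr r) (ratr s)) >]
  then inside A (ratr r) (ratr s) else set0.
have cW : countable (\bigcup_s W s).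
  by apply: bigcup_countable => // s _; rewrite /W; case: asboolP.
pose M := [set m | Z r m /\ forall a, Z r a -> a <= m].
have cM : countable M.
  have [[m Mm]|M0] := pselect (M !=set0).
    apply: (@countable_sub _ _ [set m]) => // a Ma /=; apply/eqP; rewrite eq_le.
    by rewrite (Mm.2 _ Ma.1) (Ma.2 _ Mm.1).
  by apply: (@countable_sub _ _ set0) => // a Ma; exfalso; apply: M0; exists a.
apply: countable_sub (countable_setU cM cW) => a Za.
have [|/existsNP[b /not_implyP[Zb /negP]]] := pselect (forall b, Z r b -> b <= a).
  by left.
rewrite -ltNge => /rat_in_itvoo[s /itvP h]; right; exists s => //.
have [Aa ra ca] := Za; have [Ab rb cb] := Zb.
rewrite /W asboolT; first by split => //; rewrite ra h.
by apply: countable_sub cb => t [At /andP[rt ts]]; split => //; rewrite rt (lt_trans ts)// h.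
Qed.

Lemma countable_thin_right A :
  countable [set a | A a /\ exists2 x, a < x & countable (inside A a x)].
Proof.
pose A' : set R := [set a | A (- a)].
apply: (@countable_sub _ _ (-%R @` [set a | A' a /\ exists2 x, x < a & countable (inside A' x a)])).
  move=> a [Aa [x ax c]]; exists (- a); last by rewrite opprK.
  split; first by rewrite /A' /= opprK.
  exists (- x); first by rewrite ltrN2.
  apply: sub_countable c; apply: (card_le_inj (f := -%R)).
    by move=> t [At h]; split => //; lra.
  by move=> t s _ _ /oppr_inj.
by apply: sub_countable (countable_thin_left A'); exact: card_image_le.
Qed.

Lemma countable_not_thick A : countable (A `\` thick A).
Proof.
apply: countable_sub (countable_setU (countable_thin_left A) (countable_thin_right A)).
move=> a [Aa ta].
have [[z za c]|hl] := pselect (exists2 z, z < a & countable (inside A z a)).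
  by left; split => //; exists z.
have [[z za c]|hr] := pselect (exists2 z, a < z & countable (inside A a z)).
  by right; split => //; exists z.
by exfalso; apply: ta; split => // z za c; [apply: hl|apply: hr]; exists z.
Qed.

Lemma thick_ex A B : ~ countable B -> B `<=` A -> exists2 a, thick A a & B a.
Proof.
move=> uB BA; apply: contrapT => h; apply: uB; apply: countable_sub (countable_not_thick A).
by move=> b Bb; split; [exact: BA|move=> tb; apply: h; exists b].
Qed.

Lemma thick_inside A x y : ~ countable (inside A x y) -> exists2 a, thick A a & x < a < y.
Proof. by move=> /(thick_ex (A := A))[t []//|a ta [_ axy]]; exists a. Qed.

(** One point between any two rationals, where there is one: this gives a
    countable subset meeting every interval that the whole set meets. *)
Definition skeleton A : set R := [set c | A c /\ exists r s : rat,
  c = xget 0 [set t | A t /\ ratr r < t < ratr s]].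

Lemma countable_skeleton A : countable (skeleton A).
Proof.
apply: (@countable_sub _ _ ((fun rs : rat * rat => xget 0 [set t | A t /\ ratr rs.1 < t < ratr rs.2])
  @` setT)); first by move=> c [_ [r [s ->]]]; exists (r, s).
by apply: sub_countable (card_image_le _ _) _; exact: countableP.
Qed.

Lemma skeleton_inside A a x y : A a -> x < a < y -> exists2 c, skeleton A c & x < c < y.
Proof.
move=> Aa /andP[/rat_in_itvoo[r /itvP hr] /rat_in_itvoo[s /itvP hs]].
have ars : A a /\ ratr r < a < ratr s by rewrite hr hs.
pose c := xget 0 [set t | A t /\ ratr r < t < ratr s].
have [Ac /andP[rc cs]] : A c /\ ratr r < c < ratr s.
  by rewrite /c; case: xgetP => [t -> //|/(_ a)].
exists c; first by split => //; exists r, s.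
by rewrite (lt_trans _ rc) ?hr// (lt_trans cs)// hs.
Qed.

End real_sets.

(** * Order embeddings into the line and Baumgartner's axiom *)

Section order_embeddings.
Context {R : realType}.
Implicit Types (A B C F : set R).

(** The two one-sided inverses of an increasing map with dense range. *)
Definition fib_lo C (th : R -> R) t : R := sup [set c | C c /\ th c < t].
Definition fib_hi C (th : R -> R) t : R := inf [set c | C c /\ t < th c].

Section fibration_of_embedding.
Variables (C : set R) (th : R -> R).
Hypothesis th_lt : forall c d, C c -> C d -> c < d -> th c < th d.
Hypothesis th_dense : forall x y, x < y -> exists2 c, C c & x < th c < y.

Local Notation p := (fib_lo C th).
Local Notation q := (fib_hi C th).

Lemma th_le c d : C c -> C d -> th c < th d -> c < d.
Proof.
move=> Cc Cd h; rewrite ltNge le_eqVlt; apply/negP => /orP[/eqP E|/(th_lt Cd Cc)]; last by lra.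
by move: h; rewrite E ltxx.
Qed.

Lemma lo_has_sup t : has_sup [set c | C c /\ th c < t].
Proof.
have [c Cc /andP[_ ct]] := th_dense (ltac:(lra) : t - 1 < t).
have [d Cd /andP[td _]] := th_dense (ltac:(lra) : t < t + 1).
split; first by exists c.
by exists d => c' [Cc' c't]; apply/ltW/(th_le Cc' Cd); lra.
Qed.

Lemma hi_has_inf t : has_inf [set c | C c /\ t < th c].
Proof.
have [c Cc /andP[_ ct]] := th_dense (ltac:(lra) : t - 1 < t).
have [d Cd /andP[td _]] := th_dense (ltac:(lra) : t < t + 1).
split; first by exists d.
by exists c => c' [Cc' c't]; apply/ltW/(th_le Cc Cc'); lra.
Qed.

Lemma lo_ge c t : C c -> th c < t -> c <= p t.
Proof. by move=> Cc ct; apply: ub_le_sup; [have [] := lo_has_sup t|]. Qed.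

Lemma hi_le c t : C c -> t < th c -> q t <= c.
Proof. by move=> Cc ct; apply: ge_inf; [have [] := hi_has_inf t|]. Qed.

Lemma lo_le c t : C c -> t <= th c -> p t <= c.
Proof.
move=> Cc tc; apply: ge_sup; first by have [] := lo_has_sup t.
by move=> d [Cd dt]; apply/ltW/(th_le Cd Cc); lra.
Qed.

Lemma hi_ge c t : C c -> th c <= t -> c <= q t.
Proof.
move=> Cc tc; apply: lb_le_inf; first by have [] := hi_has_inf t.
by move=> d [Cd dt]; apply/ltW/(th_le Cc Cd); lra.
Qed.

Lemma embedding_fibration : fibration p q.
Proof.
split.
- move=> t; apply: ge_sup; first by have [] := lo_has_sup t.
  by move=> c [Cc ct]; apply: hi_ge => //; exact: ltW.
- move=> s t st; have [c Cc /andP[sc cm]] := th_dense (ltac:(lra) : s < (s + t) / 2).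
  have [d Cd /andP[md dt]] := th_dense (ltac:(lra) : (s + t) / 2 < t).
  have cd : c < d by apply: th_le => //; lra.
  by have := hi_le Cc sc; have := lo_ge Cd dt; lra.
- move=> t x xt; have [c [Cc ct] xc] := sup_adherent (ltac:(lra) : 0 < p t - x) (lo_has_sup t).
  exists ((th c + t) / 2); first by lra.
  have : c <= p ((th c + t) / 2) by apply: lo_ge => //; lra.
  by move: xc; rewrite /p -/(p t); lra.
- move=> t x tx; have [c [Cc tc] cx] := inf_adherent (ltac:(lra) : 0 < x - q t) (hi_has_inf t).
  exists ((th c + t) / 2); first by lra.
  have : q ((th c + t) / 2) <= c by apply: hi_le => //; lra.
  by move: cx; rewrite /q -/(q t); lra.
Qed.

Lemma lo_adherent F : closed F -> C `<=` F -> forall t, F (p t).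
Proof.
move=> cF CF t; apply: contrapT => /(closed_gap cF)[e e0 he].
have [c [Cc ct] h] := sup_adherent e0 (lo_has_sup t).
by apply: (he c); [have := lo_ge Cc ct; rewrite ltr_distl; move: h; rewrite -/(p t); lra|exact: CF].
Qed.

Lemma hi_adherent F : closed F -> C `<=` F -> forall t, F (q t).
Proof.
move=> cF CF t; apply: contrapT => /(closed_gap cF)[e e0 he].
have [c [Cc ct] h] := inf_adherent e0 (hi_has_inf t).
by apply: (he c); [have := hi_le Cc ct; rewrite ltr_distl; move: h; rewrite -/(q t); lra|exact: CF].
Qed.

End fibration_of_embedding.

(** ** Order isomorphic sets of split points *)

(** An order isomorphism between dense sets of reals extends to the line: all
    fibres are points. *)
Lemma complemented_order_isomorphic B1 B2 : omega1_dense B1 -> omega1_dense B2 ->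
  order_isomorphic B2 B1 -> complemented (dspace setT B1) (dspace setT B2).
Proof.
move=> d1 d2 [th [thB _ thS] th_mono].
have th_lt c d : B2 c -> B2 d -> c < d -> th c < th d.
  by move=> Bc Bd cd; rewrite ltNge (th_mono _ _ Bd Bc) -ltNge.
have th_dense x y : x < y -> exists2 c, B2 c & x < th c < y.
  by move=> /(omega1_meets d1)[_ /thS[c Bc <-] h]; exists c.
have fib := embedding_fibration th_lt th_dense.
have pq t : fib_lo B2 th t = fib_hi B2 th t.
  apply/eqP; rewrite eq_le (fib_le fib) leNgt; apply/negP => h.
  have [c Bc /andP[c1 c2]] := omega1_meets d2 h.
  have [d Bd /andP[d1' d2']] := omega1_meets d2 c2.
  have [ct|tc] := ltP (th c) t; first by have := lo_ge th_lt th_dense Bc ct; lra.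
  have td : t < th d by apply: le_lt_trans tc _; exact: th_lt.
  by have := hi_le th_lt th_dense Bd td; lra.
have BE t : B1 t <-> fib_lo B2 th t < fib_hi B2 th t \/ B2 (fib_lo B2 th t).
  rewrite -pq ltxx; split.
    move=> /thS[c Bc <-]; right.
    have -> // : fib_lo B2 th (th c) = c.
    apply/eqP; rewrite eq_le (lo_le th_lt th_dense Bc (lexx _)) pq.
    by rewrite (hi_ge th_lt th_dense Bc (lexx _)).
  move=> [//|Bp]; have -> : t = th (fib_lo B2 th t); last exact: (thB _ Bp).
  have [tp|pt|//] := ltgtP t (th (fib_lo B2 th t)).
    have [d Bd /andP[d1' d2']] := th_dense _ _ tp.
    have := hi_le th_lt th_dense Bd d1'; rewrite -pq => h.
    by have := th_le th_lt Bd Bp d2'; lra.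
  have [d Bd /andP[d1' d2']] := th_dense _ _ pt.
  have := lo_ge th_lt th_dense Bd d2' => h.
  by have := th_le th_lt Bp Bd d1'; lra.
have [b Bb _] := omega1_meets d1 (@ltr01 R).
by apply: (complemented_pullback fib _ _ _ BE Bb) => //; exact: closedT.
Qed.

(** ** Collapsing to a dense set of split points *)

Lemma countable_enum (T : Type) (C : set T) c0 : countable C -> C c0 ->
  exists2 en : nat -> T, (forall n, C (en n)) & forall c, C c -> exists n, en n = c.
Proof.
move=> cC Cc0; have [f [_ fI]] := card_le_ex Cc0 cC.
exists (fun n => if pselect (exists2 c, C c & f c = n) is left e
  then projT1 (cid2 e) else c0).
  by move=> n; case: pselect => // e; case: cid2.
move=> c Cc; exists (f c); case: pselect => [e|[]]; last by exists c.
by case: cid2 => /= d Cd /(fI _ _ Cd Cc).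
Qed.

(** This is Cantor's theorem on countable dense orders, in the form that the
    embedding by bisection has no gaps and is unbounded on both sides. *)
Lemma cantor_embedding C c0 : countable C -> C c0 ->
  (forall c d, C c -> C d -> c < d -> exists2 e, C e & c < e < d) ->
  (forall c, C c -> exists2 d, C d & d < c) ->
  (forall c, C c -> exists2 d, C d & c < d) ->
  exists2 th : R -> R, (forall c d, C c -> C d -> c < d -> th c < th d) &
    forall x y, x < y -> exists2 c, C c & x < th c < y.
Proof.
move=> cC Cc0 Cd Cl Cr; have [en enC enS] := countable_enum cC Cc0.
pose v : nat -> R := embed en.
have up := @embed_unbounded_up R _ _ en (fun i => ltac:(have [d /enS[j <-] h] := Cr _ (enC i); by exists j)).
have down := @embed_unbounded_down R _ _ en (fun i => ltac:(have [d /enS[j <-] h] := Cl _ (enC i); by exists j)).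
have dense x y : x < y -> exists n, x < v n < y.
  move=> xy; apply: contrapT => no.
  have vy n : ~ (v n <= x) -> y <= v n.
    move=> /negP; rewrite -ltNge => xv; rewrite leNgt; apply/negP => vy.
    by apply: no; exists n; rewrite xv.
  pose L := [set z | exists2 n, z <= en n & v n <= x].
  have LE i : L (en i) -> v i <= x.
    by move=> [n /(embed_le (R := R)) h1 h2]; exact: le_trans h1 h2.
  have LE' i : v i <= x -> L (en i) by exists i.
  have [i0 hi0] := down x; have [j0 hj0] := up x.
  have Lj0 : ~ L (en j0) by move=> /LE; rewrite leNgt => /negP; apply.
  have Ldown a b : L b -> (a <= b)%O -> L a.
    by move=> [n bn nx] ab; exists n => //; exact: le_trans ab bn.
  have LnL a b : L a -> ~ L b -> (a < b)%O.
    by move=> La Lb; rewrite ltNge; apply/negP => /(Ldown _ _ La).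
  have yx : 0 < y - x by lra.
  have [|i [j [Li Lj]]] := embed_no_gap Ldown (LE' _ (ltW hi0)) Lj0 _ yx; last first.
    have := LE _ Li; have := vy j (contra_not (LE' j) Lj); rewrite -/(v i) -/(v j); lra.
  have [nomax|/existsNP[i /not_implyP[Li imax]]] :=
    pselect (forall i, L (en i) -> exists2 j, L (en j) & (en i < en j)%O); first by left.
  right=> j Lj; have [e Ce /andP[ie ej]] := Cd _ _ (enC i) (enC j) (LnL _ _ Li Lj).
  have [k ek] := enS _ Ce; exists k; last by rewrite ek.
  by move=> Lk; apply: imax; exists k => //; rewrite ek.
have ix c : C c -> exists n, en n = c := enS c.
pose th c := v (xget 0%N [set n | en n = c]).
have thE n : th (en n) = v n.
  by rewrite /th; case: xgetP => [m _ /embed_eq|/(_ n)/(_ erefl)//]; apply.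
exists th.
  by move=> c d /enS[n <-] /enS[m <-] nm; rewrite !thE; exact: embed_lt.
by move=> x y /dense[n h]; exists (en n) => //; rewrite thE.
Qed.

Lemma countable_disjoint_intervals (p q : R -> R) : fibration p q ->
  countable [set t | p t < q t].
Proof.
move=> fib.
pose r t : rat := xget 0 [set r : rat | p t < ratr r < q t].
have rP t : p t < q t -> p t < ratr (r t) < q t.
  move=> /rat_in_itvoo[s /itvP h]; rewrite /r; case: xgetP => [u -> //|/(_ s)].
  by rewrite /= !h => /(_ isT).
apply: (@sub_countable _ _ _ [set: rat]); last exact: countableP.
apply: (card_le_inj (f := r)) => // s t /rP/andP[s1 s2] /rP/andP[t1 t2] E.
rewrite E in s1 s2.
by have [/(fib_lt fib)|/(fib_lt fib)|//] := ltgtP s t; lra.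
Qed.

(** Let [C] be a countable order-dense set of two-sided condensation points of
    [A], embedded densely into the line.  The line becomes a quotient of [F], with
    fibres that contain at most countably many points of [A]; so the points over
    which the fibre is nondegenerate or meets [A] are uncountably many in every
    interval. *)
Lemma complemented_dense F A : closed F -> A `<=` F -> ~ countable A -> small A ->
  exists2 B, omega1_dense B & complemented (dspace setT B) (dspace F A).
Proof.
move=> cF AF uA sA.
pose C := skeleton (thick A).
have CA c : C c -> thick A c by case.
have C_inside x y : ~ countable (inside A x y) -> exists2 c, C c & x < c < y.
  by move=> /thick_inside[a ta axy]; exact: skeleton_inside ta axy.
have C_left x c : C c -> x < c -> exists2 d, C d & x < d < c.
  by move=> /CA[_ h _] xc; apply: C_inside; exact: h.
have C_right x c : C c -> c < x -> exists2 d, C d & c < d < x.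
  by move=> /CA[_ _ h] xc; apply: C_inside; exact: h.
have cC : countable C := countable_skeleton _.
have [c0 Cc0] : exists c, C c.
  have [a Aa _] := thick_ex uA (@subset_refl _ A).
  have [c Cc _] := @skeleton_inside _ _ a (a - 1) (a + 1) Aa (ltac:(lra)).
  by exists c.
have [||| th th_lt th_dense] := cantor_embedding cC Cc0.
- by move=> c d Cc Cd; exact: C_left.
- by move=> c Cc; have [d Cd /andP[_ h]] := C_left (c - 1) c Cc (ltac:(lra)); exists d.
- by move=> c Cc; have [d Cd /andP[h _]] := C_right (c + 1) c Cc (ltac:(lra)); exists d.
pose p := fib_lo C th; pose q := fib_hi C th.
have fib : fibration p q := embedding_fibration th_lt th_dense.
have CF : C `<=` F by move=> c /CA[/AF].
have Fp := lo_adherent th_lt th_dense cF CF; have Fq := hi_adherent th_lt th_dense cF CF.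
pose B := [set t | p t < q t \/ A (p t)].
have cfib t : countable [set a | A a /\ p t <= a <= q t].
  have noC c : C c -> p t < c < q t -> False.
    move=> Cc /andP[c1 c2]; have [d Cd /andP[d1 d2]] := C_left _ _ Cc c1.
    have [ct|tc] := ltP (th c) t; first by have := lo_ge th_lt th_dense Cc ct; rewrite -/p; lra.
    have [tc'|ct] := ltP t (th c); first by have := hi_le th_lt th_dense Cc tc'; rewrite -/q; lra.
    have dt : th d < t by have := th_lt _ _ Cd Cc d2; lra.
    by have := lo_ge th_lt th_dense Cd dt; rewrite -/p; lra.
  have ci : countable (inside A (p t) (q t)).
    by apply: contrapT => /C_inside[c Cc h]; exact: noC h.
  apply: countable_sub (countable_setU (countable_setU (countable1 (p t)) (countable1 (q t))) ci).
  move=> a [Aa /andP[]]; rewrite le_eqVlt => /orP[/eqP->|pa]; first by left; left.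
  by rewrite le_eqVlt => /orP[/eqP->|aq]; [left; right|right; split => //; rewrite pa].
have dB : omega1_dense B.
  move=> U oU [x Ux]; have [e e0 he] := open_inside oU Ux; split.
    have [c1 Cc1 /andP[h1 h1']] := th_dense _ _ (ltac:(lra) : x - e < x).
    have [c2 Cc2 /andP[h2 h2']] := th_dense _ _ (ltac:(lra) : x < x + e).
    have c12 : c1 < c2 by apply: (th_le th_lt) => //; lra.
    move=> cU; have [_ _ /(_ _ c12)] := CA _ Cc1; apply.
    apply: (@countable_sub _ _ (\bigcup_(t in U `&` B) [set a | A a /\ p t <= a <= q t])); last first.
      by apply: bigcup_countable.
    move=> a [Aa /andP[c1a ac2]].
    have [[t ta]|h|h] := covers_cases fib a.
    - exists t => //; split.
        have /andP[t1 t2] := ta; apply: he.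
        have : th c1 <= t.
          by rewrite leNgt; apply/negP => /(hi_le th_lt th_dense Cc1); rewrite -/q; lra.
        have : t <= th c2.
          by rewrite leNgt; apply/negP => /(lo_ge th_lt th_dense Cc2); rewrite -/p; lra.
        lra.
      have /andP[t1 t2] := ta; have [pq|qp] := ltP (p t) (q t); first by left.
      by right; rewrite (_ : p t = a)//; lra.
    - by have := h (th c2); have := hi_ge th_lt th_dense Cc2 (lexx _); rewrite -/q; lra.
    - by have := h (th c1); have := lo_le th_lt th_dense Cc1 (lexx _); rewrite -/p; lra.
  apply: (@small_sub _ _ ([set t | A (p t)] `|` [set t | p t < q t])).
    by move=> t [_ [h|h]]; [right|left].
  apply: small_setU_countable; last exact: countable_disjoint_intervals.
  apply: small_le sA; apply: (card_le_inj (f := p)) => // s t _ _ E.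
  have := fib_le fib s; have := fib_le fib t.
  by have [/(fib_lt fib)|/(fib_lt fib)|//] := ltgtP s t; lra.
have [b Bb _] := omega1_meets dB (@ltr01 R).
exists B => //; exact: (complemented_pullback fib cF Fp Fq _ Bb).
Qed.

End order_embeddings.

(** * Separable compact lines *)

Section order_topology_facts.
Context {R : realType} {d : Order.disp_t} {K : orderTopologicalType d}.
Implicit Types x y z a b : K.

Definition jump a b : Prop := (a < b)%O /\ forall z, ~ (a < z < b)%O.

Lemma jump_le_l a b z : jump a b -> (z < b)%O -> (z <= a)%O.
Proof. by move=> [_ h] zb; rewrite leNgt; apply/negP => az; apply: (h z); rewrite az. Qed.

Lemma jump_le_r a b z : jump a b -> (a < z)%O -> (b <= z)%O.
Proof. by move=> [_ h] az; rewrite leNgt; apply/negP => zb; apply: (h z); rewrite az. Qed.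

Lemma jump_uniq_r a b b' : jump a b -> jump a b' -> b = b'.
Proof.
move=> j j'; apply/eqP; rewrite eq_le.
by rewrite (jump_le_r j j'.1) (jump_le_r j' j.1).
Qed.

Lemma nbhs_left (O : set K) x : nbhs x O -> (forall z, (x <= z)%O) \/
  exists2 y, (y < x)%O & forall z, (y < z)%O -> (z <= x)%O -> O z.
Proof.
have [h|/existsNP[y0 /negP]] := pselect (forall z, (x <= z)%O); first by left.
rewrite -ltNge => y0x; rewrite itv_nbhsE => -[[l r] [oi xi] iO]; right.
case: l oi xi iO => [bl l|bl] oi; rewrite itv_boundlr => /andP[lx xr] iO; last first.
  exists y0 => // z _ zx; apply: iO; rewrite /= itv_boundlr.
  apply/andP; split; last by apply: le_trans xr; rewrite bnd_simp.
  by case: bl oi lx => //; case: (r) => [[]|[]].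
have bF : bl = false by case: bl oi {lx iO} => //; case: (r) => [[]|[]].
move: lx iO; rewrite bF bnd_simp => lx iO; exists l => // z lz zx; apply: iO.
rewrite /= itv_boundlr bnd_simp lz /=.
by apply: le_trans xr; rewrite bnd_simp.
Qed.

Lemma nbhs_right (O : set K) x : nbhs x O -> (forall z, (z <= x)%O) \/
  exists2 y, (x < y)%O & forall z, (x <= z)%O -> (z < y)%O -> O z.
Proof.
have [h|/existsNP[y0 /negP]] := pselect (forall z, (z <= x)%O); first by left.
rewrite -ltNge => y0x; rewrite itv_nbhsE => -[[l r] [oi xi] iO]; right.
case: r oi xi iO => [br r|br] oi; rewrite itv_boundlr => /andP[lx xr] iO; last first.
  exists y0 => // z zx _; apply: iO; rewrite /= itv_boundlr.
  apply/andP; split; first by apply: (le_trans lx); rewrite bnd_simp.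
  by case: br oi xr => //; case: (l) => [[]|[]].
have bF : br = true by case: br oi {xr iO} => //; case: (l) => [[]|[]].
move: xr iO; rewrite bF bnd_simp => xr iO; exists r => // z zx zr; apply: iO.
rewrite /= itv_boundlr bnd_simp zr andbT.
by apply: (le_trans lx); rewrite bnd_simp.
Qed.

Lemma continuous_sides (h : K -> R) :
  (forall x (e : R), 0 < e -> (forall z, (x <= z)%O) \/
    exists2 y, (y < x)%O & forall z, (y < z)%O -> (z < x)%O -> `|h z - h x| <= e) ->
  (forall x (e : R), 0 < e -> (forall z, (z <= x)%O) \/
    exists2 y, (x < y)%O & forall z, (x < z)%O -> (z < y)%O -> `|h z - h x| <= e) ->
  continuous h.
Proof.
move=> hl hr x; apply/cvgrPdist_le => e e0.
have [U [Ux hU]] : exists U : set K, nbhs x U /\ forall z, U z -> (z < x)%O -> `|h z - h x| <= e.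
  have [xmin|[y yx hy]] := hl x e e0.
    by exists setT; split; [exact: filterT|move=> z _; rewrite ltNge xmin].
  exists [set` `]y, +oo[%O]; split.
    by apply: open_nbhs_nbhs; split; [exact: rray_open|rewrite /= in_itv/= yx].
  by move=> z; rewrite /= in_itv/= andbT; exact: hy.
have [V [Vx hV]] : exists V : set K, nbhs x V /\ forall z, V z -> (x < z)%O -> `|h z - h x| <= e.
  have [xmax|[y xy hy]] := hr x e e0.
    by exists setT; split; [exact: filterT|move=> z _; rewrite ltNge xmax].
  exists [set` `]-oo, y[%O]; split.
    by apply: open_nbhs_nbhs; split; [exact: lray_open|rewrite /= in_itv/= xy].
  by move=> z; rewrite /= in_itv/= => zy xz; exact: hy.
apply: filterS (filterI Ux Vx) => z [Uz Vz]; rewrite distrC.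
have [zx|xz|->] := ltgtP z x; [exact: hU|exact: hV|by rewrite subrr normr0 ltW].
Qed.

(** The filter generated by the final segments has a cluster point. *)
Lemma compact_max (x0 : K) : compact [set: K] -> exists m, forall x, (x <= m)%O.
Proof.
move=> cK; pose F := filter_from [set: K] (fun x => [set y | (x <= y)%O]).
have FF : ProperFilter F.
  apply: filter_from_proper => [|x _]; last by exists x => /=.
  apply: filter_from_filter; first by exists x0.
  move=> x y _ _; exists (Order.max x y) => // z.
  by rewrite /= ge_max => /andP.
have [m [_ cm]] := cK F FF filterT; exists m => x; rewrite leNgt; apply/negP => mx.
have [||z [/= xz]] := cm [set y | (x <= y)%O] [set` `]-oo, x[%O].
- by exists x.
- by apply: open_nbhs_nbhs; split; [exact: lray_open|rewrite /= in_itv/= mx].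
by rewrite /= in_itv/= ltNge xz.
Qed.

(** The filter generated by the initial segments has a cluster point. *)
Lemma compact_min (x0 : K) : compact [set: K] -> exists m, forall x, (m <= x)%O.
Proof.
move=> cK; pose F := filter_from [set: K] (fun x => [set y | (y <= x)%O]).
have FF : ProperFilter F.
  apply: filter_from_proper => [|x _]; last by exists x => /=.
  apply: filter_from_filter; first by exists x0.
  move=> x y _ _; exists (Order.min x y) => // z.
  by rewrite /= le_min => /andP.
have [m [_ cm]] := cK F FF filterT; exists m => x; rewrite leNgt; apply/negP => mx.
have [||z [/= xz]] := cm [set y | (y <= x)%O] [set` `]x, +oo[%O].
- by exists x.
- by apply: open_nbhs_nbhs; split; [exact: rray_open|rewrite /= in_itv/= mx].
by rewrite /= in_itv/= andbT ltNge xz.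
Qed.

Lemma dense_between (D : set K) x y z : dense D -> (x < z < y)%O ->
  exists2 w, D w & (x < w < y)%O.
Proof.
move=> dD xzy; have [||w [wxy Dw]] := dD [set` `]x, y[%O].
- by exists z; rewrite /= in_itv.
- exact: itv_open.
by exists w => //; move: wxy; rewrite /= in_itv.
Qed.

(** ** Weight and jumps *)

Definition lower_jumps : set K := [set a | exists b, jump a b].

(** Rays and intervals bounded by points of a countable dense set and by endpoints
    of jumps form a base. *)
Lemma uncountable_jumps : separable K -> weight_omega1 K -> ~ countable lower_jumps.
Proof.
move=> [D cD dD] [B0 [bB0 minB0 [uB0 _]]] cJ.
suff [B cB bB] : exists2 B : set (set K), countable B & basis B.
  by apply: uB0; exact: sub_countable (minB0 _ bB) cB.
pose up a := xget a [set b | jump a b].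
have upE a b : jump a b -> up a = b.
  move=> ab; rewrite /up; case: xgetP => [c _ ac|/(_ b)//].
  exact: jump_uniq_r ac ab.
pose E : set K := D `|` lower_jumps `|` up @` lower_jumps.
have cE : countable E.
  apply: countable_setU; first exact: countable_setU.
  exact: sub_countable (card_image_le _ _) cJ.
pose O : set (option K) := [set None] `|` some @` E.
have cO : countable O.
  by apply: countable_setU => //; exact: sub_countable (card_image_le _ _) cE.
pose above (o : option K) : set K := [set z | if o is Some e then (e < z)%O else true].
pose below (o : option K) : set K := [set z | if o is Some e then (z < e)%O else true].
have above_open o : open (above o).
  case: o => [e|]; last first.
    have -> : above None = setT by apply/seteqP; split.
    exact: openT.
  rewrite (_ : above _ = [set` `]e, +oo[%O]); first exact: rray_open.
  by apply/seteqP; split => z; rewrite /above /= in_itv/= andbT.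
have below_open o : open (below o).
  case: o => [e|]; last first.
    have -> : below None = setT by apply/seteqP; split.
    exact: openT.
  rewrite (_ : below _ = [set` `]-oo, e[%O]); first exact: lray_open.
  by apply/seteqP; split => z; rewrite /below /= in_itv.
pose I (o : option K * option K) : set K := above o.1 `&` below o.2.
exists (I @` (O `*` O)).
  by apply: sub_countable (card_image_le _ _) _; exact: countableX.
split.
  move=> _ [ [ o1 o2] _ <-].
  by apply: openI; [exact: above_open|exact: below_open].
move=> x U xU.
have [u1 [v1 x1 h1]] : exists o, [/\ O o, above o x &
    forall z, above o z -> (z <= x)%O -> U z].
  have [xmin|[y yx hy]] := nbhs_left xU.
    exists None; split => //; first by left.
    move=> z _ zx; rewrite (_ : z = x); first exact: nbhs_singleton.
    by apply/eqP; rewrite eq_le zx xmin.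
  have [[z yzx]|no] := pselect (exists z, (y < z < x)%O).
    have [e De /andP[ye ex]] := dense_between dD yzx.
    exists (Some e); split => //; first by right; exists e => //; left; left.
    by move=> w ew; apply: hy; exact: lt_trans ew.
  have yj : jump y x by split => // z yzx; apply: no; exists z.
  by exists (Some y); split => //; right; exists y => //; left; right; exists x.
have [u2 [v2 x2 h2]] : exists o, [/\ O o, below o x &
    forall z, below o z -> (x <= z)%O -> U z].
  have [xmax|[y xy hy]] := nbhs_right xU.
    exists None; split => //; first by left.
    move=> z _ xz; rewrite (_ : z = x); first exact: nbhs_singleton.
    by apply/eqP; rewrite eq_le xz xmax.
  have [[z xzy]|no] := pselect (exists z, (x < z < y)%O).
    have [e De /andP[xe ey]] := dense_between dD xzy.
    exists (Some e); split => //; first by right; exists e => //; left; left.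
    by move=> w we xw; apply: hy => //; exact: lt_trans ey.
  have yj : jump x y by split => // z yzx; apply: no; exists z.
  exists (Some y); split => //; last by move=> w wy xw; exact: hy.
  by right; exists y => //; right; exists x; [exists y|exact: upE].
exists (I (u1, u2)) => /=; first by split; [exists (u1, u2)|].
by move=> z [z1 z2]; have [zx|/ltW xz] := leP z x; [exact: h1|exact: h2].
Qed.

(** Each jump [a < b] is witnessed in every base by a set with greatest element
    [a]. *)
Lemma small_jumps : weight_omega1 K -> small lower_jumps.
Proof.
move=> [B [[Bo Bb] _ [_ sB]]]; apply: small_le sB.
have ex a : exists U, lower_jumps a -> [/\ B U, U a & forall z, U z -> (z <= a)%O].
  have [[b ab]|n] := pselect (lower_jumps a); last by exists set0 => /n.
  have [|U [BU Ua] h] := Bb a [set` `]-oo, b[%O].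
    by apply: open_nbhs_nbhs; split; [exact: lray_open|rewrite /= in_itv; exact: ab.1].
  exists U => _; split => // z /h; rewrite /= in_itv/=; exact: jump_le_l.
have [f hf] := choice ex.
apply: (card_le_inj (f := f)) => [a /hf[]//|a a' /hf[_ h1 h2] /hf[_ h1' h2'] E].
by apply/eqP; rewrite eq_le h2' -?E// h2// E.
Qed.

End order_topology_facts.

(** ** A coordinate collapsing most jumps *)

Section coordinate.
Context {R : realType} {d : Order.disp_t} {K : orderTopologicalType d}.
Implicit Types x y a b : K.

(** A continuous nondecreasing map that identifies only the endpoints of jumps;
    the last condition will make its set of identified jumps nowhere dense. *)
Record coordinate (g : K -> R) : Prop := Coordinate {
  coord_cont : continuous g;
  coord_mono : forall x y, (x <= y)%O -> g x <= g y;
  coord_jump : forall x y, (x < y)%O -> g x = g y -> jump x y;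
  coord_gap : forall x y a b, jump a b ->
    (exists z, (x < z < a)%O) -> (exists z, (b < z < y)%O) ->
    exists a' b', [/\ (x <= a')%O, jump a' b', (b' <= y)%O & g a' < g b'] }.

Section construction.
Variable en : nat -> K.
Hypotheses (en_min : exists n, forall x, (en n <= x)%O)
  (en_max : exists n, forall x, (x <= en n)%O).
Hypothesis en_dense : forall x y, (exists z, (x < z < y)%O) -> exists n, (x < en n < y)%O.
Hypothesis en_isolated : forall x y z, jump x y -> jump y z -> exists n, en n = z.
Hypothesis en_jump : forall x y a b, jump a b ->
  (exists z, (x < z < a)%O) -> (exists z, (b < z < y)%O) ->
  exists i j, [/\ (x <= en i)%O, jump (en i) (en j) & (en j <= y)%O].

Local Notation v := (embed (R := R) en).
Let values x : set R := [set t | exists2 n, (en n <= x)%O & t = v n].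
(** Continuity rests on the absence of gaps in the bisection embedding.  On the
    other hand an interval with two points of the enumeration is not collapsed,
    so the isolated points need the hypothesis [en_isolated]: a collapsed interval
    could otherwise consist of an isolated point and its two neighbours. *)
Definition embed_sup x : R := sup (values x).
Local Notation g := embed_sup.

Let has_values x : has_sup (values x).
Proof.
have [m hm] := en_min; have [M hM] := en_max; split; first by exists (v m), m.
by exists (v M) => _ [n _ ->]; exact: embed_le.
Qed.

Lemma embed_sup_ge n x : (en n <= x)%O -> v n <= g x.
Proof. by move=> nx; apply: ub_le_sup; [have [] := has_values x|exists n]. Qed.

Lemma embed_sup_le n x : (x <= en n)%O -> g x <= v n.
Proof.
move=> xn; apply: ge_sup; first by have [] := has_values x.
by move=> _ [m mx ->]; apply: embed_le; exact: le_trans mx xn.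
Qed.

Lemma embed_supE n : g (en n) = v n.
Proof. by apply/eqP; rewrite eq_le embed_sup_le// embed_sup_ge. Qed.

Lemma embed_sup_mono x y : (x <= y)%O -> g x <= g y.
Proof.
move=> xy; apply: ge_sup; first by have [] := has_values x.
by move=> _ [m mx ->]; apply: embed_sup_ge; exact: le_trans mx xy.
Qed.

Lemma embed_sup_left x (e : R) : 0 < e -> (forall z, (x <= z)%O) \/
  exists2 y, (y < x)%O & forall z, (y < z)%O -> (z < x)%O -> `|g z - g x| <= e.
Proof.
move=> e0.
suff [h|[h|[n nx h]]] : (forall z, (x <= z)%O) \/ (exists y, jump y x) \/
    exists2 n, (en n < x)%O & g x - e < v n.
- by left.
- by have [y [yx h']] := h; right; exists y => // z yz zx; exfalso; apply: (h' z); rewrite yz.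
- right; exists (en n) => // z nz zx; rewrite distrC ger0_norm.
    by have := embed_sup_ge (ltW nz); lra.
  by have := embed_sup_mono (ltW zx); lra.
have [h|/existsNP[y0 /negP]] := pselect (forall z, (x <= z)%O); first by left.
rewrite -ltNge => y0x; right.
have [h|nj] := pselect (exists y, jump y x); first by left.
right.
have open y : (y < x)%O -> exists n, (y < en n < x)%O.
  move=> yx; apply: en_dense; apply: contrapT => h; apply: nj; exists y.
  by split => // z yzx; apply: h; exists z.
have [[m mx]|nx] := pselect (exists m, en m = x).
  have [i0 /andP[_ i0x]] := open _ y0x.
  have [||||i [j [ix jx h]]] := @embed_no_gap R _ _ en [set z | (z < x)%O] i0 m _ _ _ _ _ e0.
  - by move=> a b /= bx ab; exact: le_lt_trans ab bx.
  - by [].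
  - by rewrite /= mx ltxx.
  - left=> i /= /open[j /andP[ij jx]]; by exists j.
  exists i => //; have := embed_sup_le (n := j) (x := x); rewrite leNgt.
  by move/negP: jx => /= -> /(_ isT); lra.
have [_ [n nx' ->] h] := sup_adherent e0 (has_values x).
exists n => //; rewrite lt_neqAle nx' andbT; apply/eqP => E; apply: nx; by exists n.
Qed.

Lemma embed_sup_right x (e : R) : 0 < e -> (forall z, (z <= x)%O) \/
  exists2 y, (x < y)%O & forall z, (x < z)%O -> (z < y)%O -> `|g z - g x| <= e.
Proof.
move=> e0; have [h|/existsNP[y0 /negP]] := pselect (forall z, (z <= x)%O); first by left.
rewrite -ltNge => xy0; right.
have [[y [xy h]]|nj] := pselect (exists y, jump x y).
  by exists y => // z xz zy; exfalso; apply: (h z); rewrite xz.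
have open y : (x < y)%O -> exists n, (x < en n < y)%O.
  move=> xy; apply: en_dense; apply: contrapT => h; apply: nj; exists y.
  by split => // z xzy; apply: h; exists z.
have [m hm] := en_min; have [j0 /andP[xj0 _]] := open _ xy0.
have [||||i [j [ix jx h]]] := @embed_no_gap R _ _ en [set z | (z <= x)%O] m j0 _ _ _ _ _ e0.
- by move=> a b /= bx ab; exact: le_trans ab bx.
- exact: hm.
- by rewrite /= leNgt xj0.
- right=> i /= /negP; rewrite -ltNge => /open[j /andP[xj ji]].
  by exists j => //; apply/negP; rewrite -ltNge.
move/negP: jx; rewrite /= -ltNge => xj; exists (en j) => // z xz zj.
rewrite ger0_norm; last by have := embed_sup_mono (ltW xz); lra.
by have := embed_sup_le (ltW zj); have := embed_sup_ge ix; lra.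
Qed.

Lemma embed_sup_jump x y : (x < y)%O -> g x = g y -> jump x y.
Proof.
move=> xy E; split => // z xzy.
have [n /andP[xn ny]] := en_dense (ex_intro _ z xzy).
have uniq m : (x < en m)%O -> (en m <= y)%O -> en m = en n.
  have low k : (x < en k)%O -> g x <= v k by move=> /ltW; exact: embed_sup_le.
  move=> xm my; have [mn|nm|//] := ltgtP (en m) (en n); exfalso.
    have := embed_lt (R := R) mn; have := low _ xm; have := embed_sup_ge (ltW ny).
    by rewrite -E; lra.
  have := embed_lt (R := R) nm; have := low _ xn; have := embed_sup_ge my.
  by rewrite -E; lra.
have j1 : jump x (en n).
  split => // w /andP[xw wn]; have [m /andP[xm mn]] := en_dense (ex_intro _ w (introT andP (conj xw wn))).
  by have := uniq m xm (ltW (lt_trans mn ny)) => F; move: mn; rewrite F ltxx.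
have j2 : jump (en n) y.
  split => // w /andP[nw wy]; have [m /andP[nm my]] := en_dense (ex_intro _ w (introT andP (conj nw wy))).
  by have := uniq m (lt_trans xn nm) (ltW my) => F; move: nm; rewrite F ltxx.
have [k ky] := en_isolated j1 j2.
by have := uniq k; rewrite ky => /(_ xy (lexx _)) F; move: ny; rewrite F ltxx.
Qed.

Lemma embed_sup_coordinate : coordinate embed_sup.
Proof.
split.
- exact: continuous_sides embed_sup_left embed_sup_right.
- exact: embed_sup_mono.
- exact: embed_sup_jump.
- move=> x y a b jab xa byy; have [i [j [xi ij jy]]] := en_jump jab xa byy.
  by exists (en i), (en j); split => //; rewrite !embed_supE; apply: embed_lt; case: ij.
Qed.

End construction.

Lemma coordinate_affine (g : K -> R) (al ka : R) : 0 < ka -> coordinate g ->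
  coordinate (fun x => (g x - al) * ka).
Proof.
move=> ka0 [g1 g2 g3 g4]; split.
- move=> x; apply: cvgM; last exact: cvg_cst.
  by apply: cvgB; [exact: g1|exact: cvg_cst].
- by move=> x y /g2 h; rewrite ler_pM2r// lerD2r.
- by move=> x y xy /(mulIf (lt0r_neq0 ka0))/addIr; exact: g3.
- move=> x y a b ab h1 h2; have [a' [b' [h3 h4 h5 h6]]] := g4 _ _ _ _ ab h1 h2.
  by exists a', b'; split => //; rewrite ltr_pM2r// ltrD2r.
Qed.

Lemma exists_coordinate (x0 : K) : compact [set: K] -> separable K ->
  exists2 g : K -> R, coordinate g & forall x, 0 <= g x <= 1.
Proof.
move=> cK [D cD dD]; have [m hm] := compact_min x0 cK; have [M hM] := compact_max x0 cK.
(* [pick] selects a jump between any two points of [D] that enclose one, and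
   [succ] the upper neighbour of an isolated point *)
pose pick (u : K * K) := xget u
  [set w | [/\ (u.1 <= w.1)%O, jump w.1 w.2 & (w.2 <= u.2)%O]].
pose succ a := xget a [set b | jump a b].
pose D1 := D `|` (fst \o pick) @` (D `*` D) `|` (snd \o pick) @` (D `*` D).
pose E := [set m] `|` [set M] `|` D1 `|` succ @` D.
have cD1 : countable D1.
  by apply: countable_setU; [apply: countable_setU => //|];
    apply: sub_countable (card_image_le _ _) _; exact: countableX.
have cE : countable E.
  apply: countable_setU; last exact: sub_countable (card_image_le _ _) cD.
  by apply: countable_setU => //; exact: countable_setU.
have [en enE enS] := countable_enum cE (or_introl (or_introl (or_introl erefl)) : E m).
have inD w : D w -> E w by left; right; left; left.
have cg : coordinate (embed_sup en).
  apply: embed_sup_coordinate.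
  - by have [|n nm] := enS m; [do 3 left|exists n; rewrite nm].
  - by have [|n nm] := enS M; [left; left; right|exists n; rewrite nm].
  - move=> x y [z xzy]; have [w Dw xwy] := dense_between dD xzy.
    by have [n nw] := enS _ (inD _ Dw); exists n; rewrite nw.
  - move=> x y z xy yz; apply: enS.
    have [w Dw /andP[xw wz]] := dense_between dD (introT andP (conj xy.1 yz.1) : (x < y < z)%O).
    have wy : w = y.
      by apply/eqP; rewrite eq_le (jump_le_l yz wz) (jump_le_r xy xw).
    right; exists w => //; rewrite wy /succ; case: xgetP => [u _ yu|/(_ z)//].
    exact: jump_uniq_r yu yz.
  - move=> x y a b ab [z1 h1] [z2 h2].
    have [w1 Dw1 /andP[xw1 w1a]] := dense_between dD h1.
    have [w2 Dw2 /andP[bw2 w2y]] := dense_between dD h2.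
    have [p1 p2 p3] : [/\ (w1 <= (pick (w1, w2)).1)%O, jump (pick (w1, w2)).1 (pick (w1, w2)).2
        & ((pick (w1, w2)).2 <= w2)%O].
      rewrite /pick; case: xgetP => [u -> //|/(_ (a, b)) /=]; case.
      by split => //; exact: ltW.
    have [i hi] := enS (pick (w1, w2)).1 (ltac:(left; right; left; right; by exists (w1, w2))).
    have [j hj] := enS (pick (w1, w2)).2 (ltac:(left; right; right; by exists (w1, w2))).
    exists i, j; rewrite hi hj; split => //.
      exact: le_trans (ltW xw1) p1.
    exact: le_trans p3 (ltW w2y).
pose g := embed_sup en.
have ka0 : 0 < (g M - g m + 1)^-1.
  by rewrite invr_gt0; have := coord_mono cg (hm M); rewrite -/g; lra.
exists (fun x => (g x - g m) * (g M - g m + 1)^-1); first exact: coordinate_affine.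
move=> x; have := coord_mono cg (hm x); have := coord_mono cg (hM x); rewrite -/g => h1 h2.
apply/andP; split; first by apply: mulr_ge0; [lra|exact: ltW].
by rewrite ler_pdivrMr ?mul1r; lra.
Qed.

End coordinate.

(** ** Continuous functions on a line in coordinates *)

Section coordinate_space.
Context {R : realType} {d : Order.disp_t} {K : orderTopologicalType d}.
Hypothesis cK : compact [set: K].
Implicit Types x y a b : K.

Lemma cts_mem0 : [set f : K -> R | continuous f] (fun _ => 0).
Proof. by move=> x; exact: cvg_cst. Qed.

Lemma cts_mem_lin (a : R) (f g : K -> R) : continuous f -> continuous g ->
  continuous (lincomb a f g).
Proof.
by move=> cf cg x; apply: cvgD; [apply: cvgM; [exact: cvg_cst|exact: cf]|exact: cg].
Qed.

Definition cspace : fspace R := @FSpace R K [set f | continuous f] cts_mem0 cts_mem_lin.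

Lemma cts_bounded (f : K -> R) : continuous f -> exists2 C, 0 <= C & forall x, `|f x| <= C.
Proof.
move=> cf; exists (sup_norm (mkcts cf : continuous_space R cK)); first exact: sup_norm_ge0.
by move=> x; exact: (sup_norm_ub (mkcts cf : continuous_space R cK)).
Qed.

Variable g : K -> R.
Hypotheses (cg : coordinate g) (g01 : forall x, 0 <= g x <= 1).

Definition coord_range : set R := range g.

(** The coordinates of the identified jumps. *)
Definition coord_split : set R := [set t | exists x y, [/\ (x < y)%O, g x = t & g y = t]].

Let glt x y : g x < g y -> (x < y)%O.
Proof. by move=> xy; rewrite ltNge; apply/negP => /(coord_mono cg); lra. Qed.

Lemma coord_split_sub : coord_split `<=` coord_range.
Proof. by move=> t [x [_ [_ <- _]]]; exists x. Qed.

Lemma coord_range01 t : coord_range t -> 0 <= t <= 1.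
Proof. by move=> [x _ <-]. Qed.

Lemma closed_coord_range : closed coord_range.
Proof.
apply: compact_closed; first exact: Rhausdorff.
apply: continuous_compact => //; apply: continuous_subspaceT.
exact: (coord_cont cg).
Qed.

(** An interval of coordinates dense in split points contains a jump that the
    coordinate does not collapse, by [coord_gap]; its image is a gap. *)
Lemma nwd_coord_split : nowhere_dense_line coord_split.
Proof.
apply: nwd_by_contra => u v uv dense; pose w := (v - u) / 5.
have pick (k : R) : 0 <= k <= 4 -> exists x y, [/\ (x < y)%O, g x = g y,
    u + k * w < g x & g x < u + (k + 1) * w].
  move=> k04; have [||| t /andP[t1 t2] [x [y [xy Ex Ey]]]] := dense (u + k * w) (u + (k + 1) * w).
  - by rewrite /w; nra.
  - by rewrite /w; nra.
  - by rewrite /w; nra.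
  by exists x, y; rewrite Ex Ey.
(* split points in five consecutive pieces: the third is the enclosed jump, the
   second and the fourth make the intervals around it nonempty *)
have [x1 [y1 [xy1 E1 l1 r1]]] := pick 0 (ltac:(lra)).
have [z1 [_ [_ _ lz1 rz1]]] := pick 1 (ltac:(lra)).
have [x2 [y2 [xy2 E2 l2 r2]]] := pick 2 (ltac:(lra)).
have [z2 [_ [_ _ lz2 rz2]]] := pick 3 (ltac:(lra)).
have [x3 [y3 [xy3 E3 l3 r3]]] := pick 4 (ltac:(lra)).
have [||a [b [h1 h2 h3 h4]]] := coord_gap cg (x := y1) (y := x3) (coord_jump cg xy2 E2).
- by exists z1; rewrite !glt//; lra.
- by exists z2; rewrite !glt//; lra.
have := coord_mono cg h1; have := coord_mono cg h3 => k3 k1.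
exists (g a), (g b); split => //; [by move: l1; rewrite E1; lra|by rewrite /w in r3; lra|].
move=> t /andP[at_ tb] [z [_ [_ Ez _]]]; rewrite -Ez in at_ tb.
by have := h2.2 z; rewrite !glt//; apply.
Qed.

Lemma fibre3 x y z : (x < y)%O -> g x = g y -> g z = g x -> z = x \/ z = y.
Proof.
move=> xy E Ez; have [zx|xz|->] := ltgtP z x; [|right|by left].
  by have [_ /(_ x)] := coord_jump cg (lt_trans zx xy) (etrans Ez E); rewrite zx xy => /(_ isT).
have [zy|yz|//] := ltgtP z y.
  by have [_ /(_ z)] := coord_jump cg xy E; rewrite xz zy => /(_ isT).
by have [_ /(_ y)] := coord_jump cg xz (esym Ez); rewrite xy yz => /(_ isT).
Qed.

(** The least point of a fibre is the left half of its coordinate and the greatest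
    one the right half; [x0] is a default value for empty fibres. *)
Definition fibre_end x0 t (i : bool) : K := xget x0
  [set x | g x = t /\ forall y, g y = t -> if i then (y <= x)%O else (x <= y)%O].

Lemma fibre_endP x0 t i : coord_range t -> g (fibre_end x0 t i) = t /\
  forall y, g y = t -> if i then (y <= fibre_end x0 t i)%O else (fibre_end x0 t i <= y)%O.
Proof.
move=> [x _ <-]; rewrite /fibre_end; case: xgetP => [z -> //|h]; exfalso.
have [[y [xy yx]]|nup] := pselect (exists y, (x < y)%O /\ g y = g x).
  case: i h => h.
    apply: (h y); split => // z Ez.
    by have [->|->] := fibre3 xy (esym yx) Ez; rewrite ?lexx ?(ltW xy).
  apply: (h x); split => // z Ez.
  by have [->|->] := fibre3 xy (esym yx) Ez; rewrite ?lexx ?(ltW xy).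
have [[y [yx xy]]|ndown] := pselect (exists y, (y < x)%O /\ g y = g x).
  case: i h => h.
    apply: (h x); split => // z Ez.
    by have [->|->] := fibre3 yx xy (etrans Ez (esym xy)); rewrite ?lexx ?(ltW yx).
  apply: (h y); split => // z Ez.
  by have [->|->] := fibre3 yx xy (etrans Ez (esym xy)); rewrite ?lexx ?(ltW yx).
apply: (h x); split => // z Ez.
have -> : z = x; last by case: (i).
by have [zx|xz|//] := ltgtP z x; exfalso; [apply: ndown|apply: nup]; exists z.
Qed.

Definition upper x : bool := `[< exists2 y, (y < x)%O & g y = g x >].

Lemma fibre_end_upper x0 x : fibre_end x0 (g x) (upper x) = x.
Proof.
have [Ez h] := fibre_endP x0 (upper x) (ex_intro2 _ _ x Logic.I erefl : coord_range (g x)).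
apply: contrapT => /eqP ne; move: Ez h ne; rewrite /upper; case: asboolP => [[y yx Ey]|nu].
  set z := fibre_end _ _ _ => Ez h ne.
  have zx : (x < z)%O by rewrite lt_neqAle eq_sym ne h.
  have [_ /(_ x)] := coord_jump cg (lt_trans yx zx) (etrans Ey (esym Ez)).
  by rewrite yx zx => /(_ isT).
set z := fibre_end _ _ _ => Ez h ne; apply: nu; exists z => //.
by rewrite lt_neqAle ne h.
Qed.

Lemma upper_fibre_end x0 t i : coord_range t -> coord_split t -> upper (fibre_end x0 t i) = i.
Proof.
move=> Ft [x [y [xy Ex Ey]]]; have [Ez h] := fibre_endP x0 i Ft.
rewrite /upper; apply/asboolP/idP; last first.
  move=> it; rewrite it in Ez h *; exists x; last by rewrite Ez.
  by apply: lt_le_trans xy (h y Ey).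
case: i Ez h => // Ez h [w wz Ew]; have := h w; rewrite Ew Ez => /(_ erefl).
by rewrite leNgt wz.
Qed.

Lemma fibre_end_unsplit x0 t i j : coord_range t -> ~ coord_split t ->
  fibre_end x0 t i = fibre_end x0 t j.
Proof.
move=> Ft Nt; have [Ei _] := fibre_endP x0 i Ft; have [Ej _] := fibre_endP x0 j Ft.
by have [h|h|//] := ltgtP (fibre_end x0 t i) (fibre_end x0 t j); exfalso; apply: Nt;
  [exists (fibre_end x0 t i), (fibre_end x0 t j)|exists (fibre_end x0 t j), (fibre_end x0 t i)].
Qed.

Variable x0 : K.
Local Notation pt := (fibre_end x0).

Definition to_coord (f : K -> R) : R * bool -> R := fun z =>
  if `[< coord_range z.1 >] then f (pt z.1 z.2) else 0.

Definition of_coord (h : R * bool -> R) : K -> R := fun x => h (g x, upper x).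

Lemma to_coordE f t i : coord_range t -> to_coord f (t, i) = f (pt t i).
Proof. by move=> Ft; rewrite /to_coord /= asboolT. Qed.

Lemma to_coord_dmem f : continuous f -> dmem coord_range coord_split (to_coord f).
Proof.
move=> cf; split.
- by move=> t i Ft; rewrite /to_coord /= asboolF.
- have [C C0 fC] := cts_bounded cf; exists C => // -[t i].
  by rewrite /to_coord; case: ifP => // _; rewrite normr0.
- move=> t At; rewrite /to_coord /=; case: asboolP => // Ft.
  by rewrite (fibre_end_unsplit x0 _ true Ft At).
- move=> t i e Ft e0; rewrite (to_coordE _ _ Ft); have [Et ht] := fibre_endP x0 i Ft.
  have nb : nbhs (pt t i) [set z | `|f (pt t i) - f z| <= e].
    by have /cvgrPdist_le := cf (pt t i); apply.
  case: i Et ht nb => Et ht nb.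
    have [xmax|[y xy hy]] := nbhs_right nb.
      exists (t + 1); first by rewrite /side ltrDl.
      move=> s j Fs /andP[ts _]; exfalso; have [Es _] := fibre_endP x0 j Fs.
      by have := coord_mono cg (xmax (pt s j)); rewrite Es Et; move: ts; rewrite /side; lra.
    exists (g y).
      rewrite /side lt_neqAle -{2}Et (coord_mono cg (ltW xy)) andbT; apply/eqP => E.
      by have := ht y (esym E); rewrite leNgt xy.
    move=> s j Fs /andP[ts sy]; rewrite (to_coordE _ _ Fs) distrC.
    have [Es _] := fibre_endP x0 j Fs; apply: hy.
      by apply/ltW/glt; rewrite Es Et.
    by apply: glt; rewrite Es.
  have [xmin|[y xy hy]] := nbhs_left nb.
    exists (t - 1); first by rewrite /side gtrBl.
    move=> s j Fs /andP[ts _]; exfalso; have [Es _] := fibre_endP x0 j Fs.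
    by have := coord_mono cg (xmin (pt s j)); rewrite Es Et; move: ts; rewrite /side; lra.
  exists (g y).
    rewrite /side lt_neqAle -{2}Et (coord_mono cg (ltW xy)) andbT; apply/eqP => E.
    by have := ht y E; rewrite leNgt xy.
  move=> s j Fs /andP[ts sy]; rewrite (to_coordE _ _ Fs) distrC.
  have [Es _] := fibre_endP x0 j Fs; apply: hy.
    by apply: glt; rewrite Es.
  by apply/ltW/glt; rewrite Es Et.
- move=> e e0; exists 1 => t i t1; rewrite /to_coord /= asboolF ?normr0 ?ltW//.
  by move=> /coord_range01 t01; move: t1; rewrite ger0_norm; lra.
Qed.

Lemma of_coord_continuous h : dmem coord_range coord_split h -> continuous (of_coord h).
Proof.
move=> [h1 h2 h3 h4 h5]; apply: continuous_sides => x e e0.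
  have Fx : coord_range (g x) by exists x.
  have [[y yx Ey]|nu] := pselect (exists2 y, (y < x)%O & g y = g x).
    have [_ nb] := coord_jump cg yx Ey.
    by right; exists y => // z yz zx; exfalso; apply: (nb z); rewrite yz.
  have ux : upper x = false by rewrite /upper asboolF.
  have [y yx hy] := h4 (g x) false e Fx e0.
  have nb : nbhs x [set z | y < g z].
    have /cvgrPdist_lt/(_ (g x - y)) := @coord_cont _ _ _ _ cg x; rewrite subr_gt0 => /(_ yx).
    apply: filterS => z /=; rewrite ltr_distl; lra.
  have [xmin|[w wx hw]] := nbhs_left nb; first by left.
  right; exists w => // z wz zx; rewrite /of_coord ux; apply: hy; first by exists z.
  rewrite /between /side (hw z wz (ltW zx)) andbT lt_neqAle (coord_mono cg (ltW zx)) andbT.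
  by apply/eqP => E; apply: nu; exists z.
have Fx : coord_range (g x) by exists x.
have [[y xy Ey]|nu] := pselect (exists2 y, (x < y)%O & g y = g x).
  have [_ nb] := coord_jump cg xy (esym Ey).
  by right; exists y => // z xz zy; exfalso; apply: (nb z); rewrite xz.
have hx : h (g x, upper x) = h (g x, true).
  case: (boolP (upper x)) => // ux; apply: h3 => -[a [b [ab Ea Eb]]].
  have [xa|xb] := fibre3 ab (etrans Ea (esym Eb)) (esym Ea).
    by apply: nu; exists b; rewrite ?xa// -?xa.
  by move: ux; rewrite /upper => /asboolP; apply; exists a; rewrite ?xb// -?xb Ea.
have [y xy hy] := h4 (g x) true e Fx e0.
have nb : nbhs x [set z | g z < y].
  have /cvgrPdist_lt/(_ (y - g x)) := @coord_cont _ _ _ _ cg x; rewrite subr_gt0 => /(_ xy).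
  apply: filterS => z /=; rewrite ltr_distl; lra.
have [xmax|[w xw hw]] := nbhs_right nb; first by left.
right; exists w => // z xz zw; rewrite /of_coord hx; apply: hy; first by exists z.
rewrite /between /side (hw z (ltW xz) zw) andbT lt_neqAle (coord_mono cg (ltW xz)) andbT.
by apply/eqP => E; apply: nu; exists z.
Qed.

(** The halves of a split coordinate are the endpoints of the collapsed jump, and
    the order topology of [K] is given by one-sided limits. *)
Lemma coord_isom : isom cspace (dspace coord_range coord_split).
Proof.
exists to_coord, of_coord; split.
- split; first exact: to_coord_dmem.
    by move=> a f h _ _; apply/funext => z; rewrite /to_coord /lincomb; case: ifP => // _; ring.
  exists 1 => // f C _ C0 fC z; rewrite mul1r /to_coord; case: ifP => // _.
  by rewrite normr0.
- split; [exact: of_coord_continuous|by []|].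
  by exists 1 => // f C _ C0 fC z; rewrite mul1r; exact: fC.
- move=> f _; apply/funext => x; rewrite /of_coord to_coordE; last by exists x.
  by rewrite fibre_end_upper.
- move=> h hF; apply/funext => -[t i]; rewrite /to_coord /=; case: asboolP => Ft; last first.
    by rewrite (d_off hF).
  rewrite /of_coord (fibre_endP x0 i Ft).1.
  have [St|St] := pselect (coord_split t); first by rewrite upper_fibre_end.
  by have := d_unsplit hF St; case: i; case: (upper _).
Qed.

Lemma split_jumps_image : coord_split = g @` [set a | exists2 b, jump a b & g a = g b].
Proof.
apply/seteqP; split => [t [x [y [xy Ex Ey]]]|_ [a [b [ab _] E] <-]].
  by exists x => //; exists y; [apply: (coord_jump cg xy)|]; rewrite Ex Ey.
by exists a, b.
Qed.

(** A jump that is not collapsed is mapped to a gap containing a rational, so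
    there are only countably many of those. *)
Lemma uncountable_coord_split : separable K -> weight_omega1 K -> ~ countable coord_split.
Proof.
move=> sK wK cS; apply: (uncountable_jumps sK wK).
pose J1 := [set a | exists2 b, jump a b & g a = g b].
pose J2 := [set a | exists2 b, jump a b & g a < g b].
apply: (@countable_sub _ _ (J1 `|` J2)).
  move=> a [b ab]; have := coord_mono cg (ltW ab.1).
  by rewrite le_eqVlt => /orP[/eqP E|h]; [left|right]; exists b.
apply: countable_setU.
  apply: (sub_countable (B := coord_split)) => //.
  apply: (card_le_inj (f := g)).
    by move=> a Ja; rewrite split_jumps_image; exists a.
  move=> a a' [b ab E] [b' ab' E'] Ea.
  have [Eaa|Eab] := fibre3 ab.1 E (esym Ea); first by rewrite Eaa.
  exfalso; have [F|F] := fibre3 ab'.1 E' Ea.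
    by move: ab.1; rewrite F -Eab ltxx.
  by have := lt_trans ab.1 (_ : b < b')%O; rewrite -{1}Eab F ltxx => h; have := h ab'.1.
have rP a : J2 a -> exists r : rat, g a < ratr r /\ forall b, jump a b -> ratr r < g b.
  move=> [b ab /rat_in_itvoo[r /itvP h]]; exists r; split; first by rewrite h.
  by move=> c ac; rewrite (jump_uniq_r ac ab) h.
pose r a : rat := xget 0 [set r : rat | g a < ratr r /\ forall b, jump a b -> ratr r < g b].
have {}rP a : J2 a -> g a < ratr (r a) /\ forall b, jump a b -> ratr (r a) < g b.
  by move=> /rP[s hs]; rewrite /r; case: xgetP => [u -> //|/(_ s)].
apply: (@sub_countable _ _ _ [set: rat]); last exact: countableP.
apply: (card_le_inj (f := r)) => // a a' Ja Ja' E.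
have [ra rb] := rP a Ja; have [ra' rb'] := rP a' Ja'.
have [b ab _] := Ja; have [b' ab' _] := Ja'.
have := rb _ ab; have := rb' _ ab'; rewrite -E in ra' * => h' h.
have [aa'|a'a|//] := ltgtP a a'; exfalso.
  by have := coord_mono cg (jump_le_r ab aa'); lra.
by have := coord_mono cg (jump_le_r ab' a'a); lra.
Qed.

Lemma small_coord_split : weight_omega1 K -> small coord_split.
Proof.
move=> wK; rewrite split_jumps_image; apply: small_image.
by apply: small_sub (small_jumps wK) => a [b ab _]; exists b.
Qed.

End coordinate_space.

(** * The isomorphism *)

Section closed_nowhere_dense.
Context {R : realType}.
Implicit Types (A N : set R).

Lemma nwd_closure A : nowhere_dense_line A -> nowhere_dense_line (closure A).
Proof.
move=> nA u v uv; have [u' [v' [h1 h2 h3 h4]]] := nA u v uv.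
exists u', v'; split => // t tuv cl.
have [|s [As suv]] := cl [set s | u' < s < v'].
  by apply: open_nbhs_nbhs; split => //; exact: inside_open.
exact: h4 suv As.
Qed.

Lemma nwd_setU A N : nowhere_dense_line A -> nowhere_dense_line N ->
  nowhere_dense_line (A `|` N).
Proof.
move=> nA nN u v uv; have [u1 [v1 [h1 h2 h3 h4]]] := nA u v uv.
have [u2 [v2 [k1 k2 k3 k4]]] := nN u1 v1 h2; exists u2, v2.
split; [exact: le_trans k1|by []|exact: le_trans h3|].
by move=> t tuv [/h4|/k4]; apply; lra.
Qed.

Lemma translates_near N s (n : nat) : (forall t, N t -> 0 <= t <= 3) ->
  4 * n%:R - 2^-1 < s < 4 * n%:R + 7 / 2 -> translates N s -> N (s - 4 * n%:R).
Proof.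
move=> N03 sn [m Nm]; suff -> : n = m by [].
have := N03 _ Nm => sm.
have h1 : (n < m.+1)%N by rewrite -(ltr_nat R) -natr1; lra.
have h2 : (m < n.+1)%N by rewrite -(ltr_nat R) -natr1; lra.
by apply/eqP; rewrite eqn_leq -ltnS h1 -ltnS h2.
Qed.

Lemma closed_translates N : (forall t, N t -> 0 <= t <= 3) -> closed N ->
  closed (translates N).
Proof.
move=> N03 cN; apply: gap_closed => t Nt.
have [[s [[n Ns] st]]|far] := pselect (exists s, translates N s /\ `|s - t| < 2^-1); last first.
  by exists 2^-1 => // s st Ns; apply: far; exists s.
have [e e0 he] := closed_gap cN (fun h : N (t - 4 * n%:R) => Nt (ex_intro _ n h)).
have := N03 _ Ns; move: st; rewrite ltr_distl => st sn.
exists (Num.min e (Num.min (t - (4 * n%:R - 2^-1)) (4 * n%:R + 7 / 2 - t))).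
  by rewrite !lt_min e0; lra.
move=> r; rewrite !lt_min => /and3P[r1 r2 r3] Nr.
apply: (he (r - 4 * n%:R)).
  by rewrite (_ : _ - _ = r - t)//; ring.
apply: translates_near => //; move: r2 r3; rewrite !ltr_distl; lra.
Qed.

Lemma nwd_translates N : (forall t, N t -> 0 <= t <= 3) -> nowhere_dense_line N ->
  nowhere_dense_line (translates N).
Proof.
move=> N03 nN; apply: nwd_by_contra => u v uv dense.
have [t tuv [n Nt]] := dense u v (lexx _) uv (lexx _); have := N03 _ Nt => tn.
pose lo := Num.max u (4 * n%:R - 2^-1); pose hi := Num.min v (4 * n%:R + 7 / 2).
have lohi : lo < hi by rewrite /lo /hi lt_min !gt_max; lra.
have [u' [v' [h1 h2 h3 h4]]] := nN (lo - 4 * n%:R) (hi - 4 * n%:R) (ltac:(lra)).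
have : u <= lo /\ 4 * n%:R - 2^-1 <= lo by rewrite /lo !le_max !lexx orbT.
have : hi <= v /\ hi <= 4 * n%:R + 7 / 2 by rewrite /hi !ge_min !lexx orbT.
move=> [g1 g2] [g3 g4].
exists (u' + 4 * n%:R), (v' + 4 * n%:R); split; [lra|lra|lra|] => s suv Ns.
by apply: (h4 (s - 4 * n%:R)); [lra|apply: translates_near => //; lra].
Qed.

End closed_nowhere_dense.

Section key.
Context {R : realType}.

Lemma compact_line_coordinate (d : Order.disp_t) (K : orderTopologicalType d) :
  compact [set: K] -> separable K -> weight_omega1 K ->
  exists F A : set R, [/\ closed F, A `<=` F & forall t, F t -> 0 <= t <= 1] /\
    [/\ nowhere_dense_line A, ~ countable A, small A & isom (cspace (R := R) (K := K)) (dspace F A)].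
Proof.
move=> cK sK wK; have [x0 _] := uncountable_ex (uncountable_jumps sK wK).
have [g cg g01] := exists_coordinate (R := R) x0 cK sK.
exists (coord_range g), (coord_split g); split; split.
- exact: closed_coord_range.
- exact: coord_split_sub.
- exact: coord_range01.
- exact: nwd_coord_split.
- exact: uncountable_coord_split.
- exact: small_coord_split.
- exact: (coord_isom cK cg g01 x0).
Qed.

(** In coordinates for [L] the split points are nowhere dense.  Separating the
    continuous part and moving it to the Cantor set represents [C(L)] on a closed
    nowhere dense set, whose translates carry [c0(C(L))].  The gaps of their union
    leave room to complete the split points to an [omega1_dense] set, which the
    axiom compares with the one obtained from [K]. *)
Lemma c0_cspace_complemented (BA : baumgartner_axiom R)
  (dK dL : Order.disp_t) (K : orderTopologicalType dK) (L : orderTopologicalType dL) :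
  compact [set: K] -> compact [set: L] -> separable K -> separable L ->
  weight_omega1 K -> weight_omega1 L ->
  complemented (c0sum (cspace (R := R) (K := L))) (cspace (R := R) (K := K)).
Proof.
move=> cK cL sK sL wK wL.
have [FK [AK [[cFK AFK _] [_ uAK sAK iK]]]] := compact_line_coordinate cK sK wK.
have [F [A [[cF AF F01] [nA _ sA iL]]]] := compact_line_coordinate cL sL wL.
have [B dB BK] := complemented_dense cFK AFK uAK sAK.
have cI : closed (@unit_itv R).
  rewrite (_ : unit_itv = `[0, 1]%classic); first exact: itv_closed.
  by apply/seteqP; split => t; rewrite /unit_itv /= in_itv.
have N01 t : closure A t -> 0 <= t <= 1.
  move=> clt; have : closure (@unit_itv R) t.
    by apply: closureS clt => s /AF/F01.
  by move/closure_id: cI => <-.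
pose C : set R := cantor_set; pose N := closure A `|` C; pose A0 := A `|` (@set0 R).
have N03 t : N t -> 0 <= t <= 3.
  by move=> [/N01|/cantor_set23]; lra.
have AN : A0 `<=` N by move=> t [At|//]; left; exact: subset_closure.
have cN : closed N by apply: closedU; [exact: closed_closure|exact: closed_cantor_set].
have nN : nowhere_dense_line N.
  by apply: nwd_setU; [exact: nwd_closure|exact: nwd_cantor_set].
have LN : complemented (cspace (R := R) (K := L)) (dspace N A0).
  apply: complemented_trans (isom_complemented iL) _.
  apply: complemented_trans (complemented_closed A cF (F01 : F `<=` unit_itv)) _.
  have AA : A `<=` closure A by exact: subset_closure.
  have h := complemented_unsplit (@closed_closure _ A) (N01 : closure A `<=` unit_itv) AA.
  apply: complemented_trans h _.
  apply: complemented_trans (complemented_fsum (complemented_refl _) complemented_unit_itv) _.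
  apply: (@dspace_sum _ (closure A) A C set0 (3 / 2)) => //.
  - by move=> t /N01; lra.
  - by move=> t /cantor_set23; lra.
pose N' := translates N; pose A' := translates A0.
have A'N' : A' `<=` N' by move=> t [n /AN]; exists n.
pose B' := A' `|` (B `\` N').
have cN' : closed N' by exact: closed_translates.
have dB' : omega1_dense B'.
  apply: (omega1_dense_fill _ _ _ _ dB) => //; first exact: nwd_translates.
  by apply: small_translates dB _; apply: small_sub sA => t [].
apply: complemented_trans (complemented_c0 LN) _.
apply: complemented_trans (complemented_translates N03 AN) _.
apply: complemented_trans (dspace_eqA (A' := B') _) _.
  by move=> t N't; split => [|[|[_]]//]; left.
apply: complemented_trans (complemented_closed B' cN' (@subsetT _ N')) _.
apply: complemented_trans (complemented_order_isomorphic dB' dB (BA _ _ dB dB')) _.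
exact: complemented_trans BK (isom_complemented (isom_sym iK)).
Qed.

Lemma oper_banach (dK dL : Order.disp_t) (K : orderTopologicalType dK)
  (L : orderTopologicalType dL) (cK : compact [set: K]) (cL : compact [set: L])
  (F : (K -> R) -> (L -> R)) :
  oper (V := cspace (R := R) (K := K)) (W := cspace (R := R) (K := L)) F ->
  exists2 f : {linear continuous_space R cK -> continuous_space R cL},
    (forall u, f u = F u :> (L -> R)) & bounded_fun_norm f.
Proof.
move=> [F1 F2 [C C0 F3]].
pose f (u : continuous_space R cK) : continuous_space R cL := mkcts (F1 u (@cts_fun _ _ u)).
have f_lin : linear f.
  move=> a u v; apply: val_inj.
  exact: (F2 a u v (@cts_fun _ _ u) (@cts_fun _ _ v)).
pose fL := GRing.isLinear.Build R _ _ _ f f_lin.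
pose fl : {linear continuous_space R cK -> continuous_space R cL} := HB.pack f fL.
exists fl => // r; exists (C * `|r|) => u ur.
apply: sup_norm_le => [|x]; first exact: mulr_ge0.
apply: F3 => //; first exact: cts_fun.
by move=> y; apply: le_trans (sup_norm_ub u y) _; exact: le_trans ur (ler_norm r).
Qed.

Lemma isom_banach (dK dL : Order.disp_t) (K : orderTopologicalType dK)
  (L : orderTopologicalType dL) (cK : compact [set: K]) (cL : compact [set: L]) :
  isom (cspace (R := R) (K := K)) (cspace (R := R) (K := L)) ->
  banach_isomorphic (continuous_space R cK) (continuous_space R cL).
Proof.
move=> [F [G [oF oG FG GF]]].
have [f fE bf] := oper_banach cK cL oF; have [g gE bg] := oper_banach cL cK oG.
exists f, g; split => // u; apply: val_inj.
  by rewrite [LHS]gE [X in G X]fE FG//; exact: cts_fun.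
by rewrite [LHS]fE [X in F X]gE GF//; exact: cts_fun.
Qed.

End key.

Theorem theorem1p3 (R : realType) (BA : baumgartner_axiom R)
  (dK dL : Order.disp_t)
  (K : orderTopologicalType dK) (L : orderTopologicalType dL)
  (cK : compact [set: K]) (cL : compact [set: L])
  (sK : separable K) (sL : separable L)
  (wK : weight_omega1 K) (wL : weight_omega1 L) :
  banach_isomorphic (continuous_space R cK) (continuous_space R cL).
Proof.
apply: isom_banach; apply: pelczynski.
- exact: complemented_trans (complemented_c0_summand _) (c0_cspace_complemented BA cL cK sL sK wL wK).
- exact: complemented_trans (complemented_c0_summand _) (c0_cspace_complemented BA cK cL sK sL wK wL).
- exact: c0_cspace_complemented.
- exact: c0_cspace_complemented.
Qed.
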